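(* Let $M$ be a compact, orientable smooth manifold of dimension $m\le n$ (possibly with boundary). The following spaces are totally geodesic subspaces of the space $\Omega^1_+(M,\mathbb R^n)$ of full-ranked one-forms equipped with the generalized Ebin metric $G$: (1) any one-dimensional space of scalings $\mathcal A:=\{t\alpha_0\mid t\in\mathbb R_{>0}\}$, where $\alpha_0$ is a fixed element of $\Omega^1_+(M,\mathbb R^n)$; (2) the space $\mathcal B:=\{\alpha\in\Omega^1_+(M,\mathbb R^n)\mid W(\alpha)=f_0\}$, where $f_0$ is any fixed element of $C^\infty(M,\operatorname{Gr}(m,n))$. (This space is empty unless $TM\cong f_0^*(\xi)$.)
   Context: $\Omega^1_+(M,\mathbb R^n)$ is the open subset of the Fréchet space $\Omega^1(M,\mathbb R^n)$ of smooth $\mathbb R^n$-valued one-forms consisting of those $\alpha$ for which $\alpha(x):T_xM\to\mathbb R^n$ is injective for all $x\in M$. In local coordinates (one-forms represented at $x$ by $n\times m$ matrices) $$G_\alpha(\zeta,\eta)=\int_M \operatorname{tr}\big(\zeta_x(\alpha_x^T\alpha_x)^{-1}\eta_x^T\big)\sqrt{\det(\alpha_x^T\alpha_x)}\,dx,\qquad \zeta,\eta\in\Omega^1(M,\mathbb R^n).$$ $\operatorname{Gr}(m,n)$ is the Grassmannian of $m$-dimensional linear subspaces of $\mathbb R^n$, $\xi$ is the canonical $m$-plane bundle over it, and $W:\Omega^1_+(M,\mathbb R^n)\to C^\infty(M,\operatorname{Gr}(m,n))$ is defined by $W(\alpha)(x)=\alpha(T_xM)$. *)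

(* Defs.v *)
From HB Require Import structures.
From mathcomp Require Import all_boot all_order all_algebra.
From mathcomp Require Import all_classical all_reals all_analysis.

Set Implicit Arguments.
Unset Strict Implicit.
Unset Printing Implicit Defensive.

Import Order.TTheory GRing.Theory Num.Theory.
Import numFieldNormedType.Exports.

Local Open Scope classical_set_scope.
Local Open Scope ring_scope.

(** * Smooth functions *)

(* [Ck k U f]: f is of class C^k on the open set U (V finite-dimensional). *)
Fixpoint Ck (R : realType) (V : normedModType R) (k : nat) (U : set V)
    (f : V -> R) : Prop :=
  match k with
  | 0%N => forall x, U x -> {for x, continuous f}
  | k'.+1 => (forall x, U x -> differentiable f x) /\
             (forall v : V, Ck k' U ('D_v f))
  end.

(* Smoothness on an arbitrary subset: local extendability to a smooth function
   on an open set. This is what is needed at boundary points of half-spaces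
   and at end points of time intervals. *)
Definition smooth_on (R : realType) (V : normedModType R) (A : set V)
    (f : V -> R) : Prop :=
  forall x, A x -> exists (O : set V) (g : V -> R),
    [/\ open O, O x, forall k, Ck k O g & forall y, O y -> A y -> f y = g y].

(** * Smooth manifolds with (possibly empty) boundary *)

(* For m = 0 there is no constraint. *)
Definition half_space (R : realType) (m : nat) : set 'cV[R]_m :=
  [set y | forall i : 'I_m, i = 0%N :> nat -> 0 <= y i ord0].

(* The smooth structure is given by an atlas, not necessarily maximal, indexed
   by [chart]. [param c] is the inverse of [coord c] on [coord c @` dom c];
   the values of [coord c] off [dom c], and of [param c] off that image, are
   irrelevant. *)
Record manifold (R : realType) (m : nat) := Manifold {
  points :> topologicalType;
  chart : Type;
  dom : chart -> set points;
  coord : chart -> points -> 'cV[R]_m;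
  param : chart -> 'cV[R]_m -> points;
  points_hausdorff : hausdorff_space points;
  points_second_countable : @second_countable points;
  dom_open : forall c, open (dom c);
  dom_cover : forall x, exists c, dom c x;
  coordK : forall c x, dom c x -> param c (coord c x) = x;
  coord_image : forall c, exists2 O : set 'cV[R]_m,
    open O & coord c @` dom c = O `&` @half_space R m;
  coord_continuous : forall c x, dom c x -> {for x, continuous (coord c)};
  param_continuous : forall c, {within coord c @` dom c, continuous (param c)};
  transition_smooth : forall c d (i : 'I_m),
    smooth_on (coord c @` (dom c `&` dom d))
      (fun y => coord d (param c y) i ord0)
}.

Arguments chart {R m} M : rename.
Arguments dom {R m M} c : rename.
Arguments coord {R m M} c x : rename.
Arguments param {R m M} c y : rename.

Section Manifolds.
Variables (R : realType) (m : nat).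
Implicit Types (M : manifold R m).

Definition smooth_fun M (U : set M) (f : M -> R) : Prop :=
  forall c : chart M,
    smooth_on (coord c @` (dom c `&` U)) (fun y => f (param c y)).

(* J is the Jacobian matrix at x of the change of coordinates from c to d. The
   limit is taken inside the domain of the transition map, which is relatively
   open in the half-space, so J is unique also at boundary points. *)
Definition is_jacobian M (c d : chart M) (x : M) (J : 'M[R]_m) : Prop :=
  forall e : R, 0 < e -> \forall y \near coord c x,
    (coord c @` (dom c `&` dom d)) y ->
    `|coord d (param c y) - coord d x - J *m (y - coord c x)|
      <= e * `|y - coord c x|.

(* A continuous choice [o c x] = 1 or -1 of an orientation of each T_xM,
   relative to the basis of T_xM given by c. (An atlas of half-space charts with
   positive Jacobians need not exist for oriented M when m = 1.) *)
Definition orientable M : Prop :=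
  exists o : chart M -> M -> R,
    [/\ forall c x, dom c x -> o c x = 1 \/ o c x = -1,
        forall c x, dom c x -> \forall y \near x, o c y = o c x &
        forall c d x J, dom c x -> dom d x -> is_jacobian c d x J ->
          o c x = Num.sg (\det J) * o d x].

(** ** Integration of densities *)

Record partition_of_unity M := PartitionOfUnity {
  pu_size : nat;
  pu_chart : 'I_pu_size -> chart M;
  pu_fun : 'I_pu_size -> M -> R;
  pu_ge0 : forall i x, 0 <= pu_fun i x;
  pu_support : forall i,
    closure [set x | pu_fun i x != 0] `<=` dom (pu_chart i);
  pu_sum1 : forall x, \sum_i pu_fun i x = 1;
  pu_smooth : forall i, smooth_fun setT (pu_fun i)
}.

(* Lebesgue integral over R^k, as an iterated integral. *)
Fixpoint integral_cV (k : nat) : ('cV[R]_k -> R) -> R :=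
  match k return ('cV[R]_k -> R) -> R with
  | 0%N => fun f => f 0
  | k'.+1 => fun f =>
      \int[lebesgue_measure]_(t in [set: R])
        integral_cV (fun y : 'cV[R]_k' => f (col_mx (t%:M : 'cV[R]_1) y))
  end.

(* The integral over M of the density with local expression [rho c] in the chart
   c, i.e. rho c x = |det J| * rho d x when J is the Jacobian at x of the
   transition from c to d. It does not depend on the partition of unity. *)
Definition integral_density M (P : partition_of_unity M)
    (rho : chart M -> M -> R) : R :=
  \sum_(i < pu_size P) let c := pu_chart i in
    integral_cV (patch (fun=> 0) (coord c @` dom c)
      (fun y => pu_fun i (param c y) * rho c (param c y))).

End Manifolds.

(** * R^n-valued one-forms *)

Section OneForms.
Variables (R : realType) (m n : nat) (M : manifold R m).

(* [alpha c x] is the n x m matrix of alpha(x) : T_xM -> R^n, where T_xM is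
   identified with R^m by the chart c. *)
Definition form_rep := chart M -> M -> 'M[R]_(n, m).

Definition chart_compatible (alpha : form_rep) : Prop :=
  forall (c d : chart M) (x : M) (J : 'M[R]_m), dom c x -> dom d x ->
    is_jacobian c d x J -> alpha c x = alpha d x *m J.

(* The normalization off [dom c] makes the representation of a one-form unique,
   so that equality of one-forms is equality of [form_rep]s. *)
Definition Omega1 : set form_rep :=
  [set alpha |
    [/\ forall c x, ~ dom c x -> alpha c x = 0,
        chart_compatible alpha &
        forall c i j,
          smooth_on (coord c @` dom c) (fun y => alpha c (param c y) i j)]].

Definition Omega1_plus : set form_rep :=
  [set alpha | Omega1 alpha /\
    forall c x, dom c x -> injective (fun v : 'cV[R]_m => alpha c x *m v)].

(** ** The generalized Ebin metric *)

Definition ebin_density (alpha zeta eta : form_rep) (c : chart M) (x : M) : R :=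
  let g := (alpha c x)^T *m alpha c x in
  \tr (zeta c x *m invmx g *m (eta c x)^T) * Num.sqrt (\det g).

Definition ebin_metric (P : partition_of_unity M) (alpha zeta eta : form_rep) :=
  integral_density P (ebin_density alpha zeta eta).

(** ** Geodesics *)

(* A smooth map from D into the Frechet space Omega1 is a family of one-forms
   that is jointly smooth in the parameter and the point of M (exponential
   law). *)
Definition smooth_family (T : normedModType R) (D : set T)
    (gamma : T -> form_rep) : Prop :=
  forall c i j, smooth_on (D `*` (coord c @` dom c))
    (fun z : T * 'cV[R]_m => gamma z.1 c (param c z.2) i j).

Definition velocity (gamma : R -> form_rep) (t : R) : form_rep :=
  fun c x => \matrix_(i, j) derive1 (fun u : R => gamma u c x i j) t.

Definition energy (P : partition_of_unity M) (p q : R) (gamma : R -> form_rep)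
    : R :=
  2^-1 * \int[lebesgue_measure]_(t in `[p, q])
           ebin_metric P (gamma t) (velocity gamma t) (velocity gamma t).

(* Smooth variation [beta s t], |s| < e, of gamma on [p, q], inside S and with
   fixed end points. *)
Definition proper_variation (S : set form_rep) (p q : R) (gamma : R -> form_rep)
    (e : R) (beta : R -> R -> form_rep) : Prop :=
  [/\ smooth_family (`]- e, e[ `*` `[p, q] : set (R * R))
        (fun st => beta st.1 st.2),
      forall s t, s \in `]- e, e[ -> t \in `[p, q] -> S (beta s t),
      forall t, t \in `[p, q] -> beta 0 t = gamma t &
      forall s, s \in `]- e, e[ -> beta s p = gamma p /\ beta s q = gamma q].

(* Geodesics of S for the metric induced by the generalized Ebin metric: smooth
   curves in S which, on every compact subinterval, are critical points of the
   energy among curves in S with the same end points. *)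
Definition geodesic (P : partition_of_unity M) (S : set form_rep) (I : set R)
    (gamma : R -> form_rep) : Prop :=
  [/\ smooth_family I gamma,
      forall t, I t -> S (gamma t) &
      forall p q : R, p < q -> `[p, q] `<=` I ->
        forall e beta, 0 < e -> proper_variation S p q gamma e beta ->
          is_derive (0 : R) (1 : R) (fun s => energy P p q (beta s)) (0 : R)].

Definition totally_geodesic (P : partition_of_unity M) (S : set form_rep)
    : Prop :=
  S `<=` Omega1_plus /\
  forall (I : set R) (gamma : R -> form_rep), is_interval I ->
    geodesic P S I gamma -> geodesic P Omega1_plus I gamma.

(** ** The two families of subspaces *)

Definition scalings (alpha0 : form_rep) : set form_rep :=
  [set alpha | exists2 t : R, 0 < t & alpha = fun c x => t *: alpha0 c x].

Definition grassmannian := {V : {vspace 'cV[R]_n} | \dim V == m}.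

Definition spans (V : grassmannian) (A : 'M[R]_(n, m)) : Prop :=
  [set A *m v | v in [set: 'cV[R]_m]] = [set w | w \in val V].

Definition smooth_frame (f : M -> grassmannian) (U : set M)
    (F : M -> 'M[R]_(n, m)) : Prop :=
  [/\ open U, forall x, U x -> spans (f x) (F x) &
      forall i j, smooth_fun U (fun x => F x i j)].

(* Smoothness with respect to the standard atlas of Gr(m, n): for an injection
   sigma of {0..m-1} into {0..n-1}, the chart with index sigma is defined on
   the V which have a (unique) frame whose rows sigma form the identity matrix,
   and its coordinates are the entries of that frame. *)
Definition smooth_grassmannian (f : M -> grassmannian) : Prop :=
  forall x : M, exists (sigma : 'I_m -> 'I_n) (U : set M)
      (F : M -> 'M[R]_(n, m)),
    [/\ injective sigma, U x, smooth_frame f U F &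
        forall y, U y -> rowsub sigma (F y) = 1%:M].

(* W alpha x = alpha(T_xM). *)
Definition W (alpha : form_rep) (x : M) : set 'cV[R]_n :=
  [set w | exists (c : chart M) (v : 'cV[R]_m), dom c x /\ w = alpha c x *m v].

Definition W_fiber (f0 : M -> grassmannian) : set form_rep :=
  [set alpha | Omega1_plus alpha /\
    forall x, W alpha x = [set w | w \in val (f0 x)]].

(* TM is isomorphic to the pullback by f0 of the canonical m-plane bundle:
   [phi c x] is the matrix of a linear isomorphism from T_xM onto f0 x, with
   matrix [K x] in the local trivializations of the two bundles given by the
   chart c and by the frame F. *)
Definition tangent_iso_pullback (f0 : M -> grassmannian) : Prop :=
  exists phi : form_rep,
    [/\ chart_compatible phi,
        forall c x, dom c x ->
          injective (fun v : 'cV[R]_m => phi c x *m v) /\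
          spans (f0 x) (phi c x) &
        forall c U F, smooth_frame f0 U F ->
          exists K : M -> 'M[R]_m,
            (forall i j, smooth_fun (U `&` dom c) (fun x => K x i j)) /\
            (forall x, U x -> dom c x -> phi c x = F x *m K x)].

End OneForms.

Arguments grassmannian R m n : clear implicits.

(* Main.v *)
Require Import Defs.
From HB Require Import structures.
From mathcomp Require Import all_boot all_order all_algebra.
From mathcomp Require Import all_classical all_reals all_analysis.
From mathcomp Require Import measurable_realfun perm ring lra.

(** Geodesics of a space of one-forms are the smooth curves that are critical for
    the energy among the curves of that space with the same end points. A geodesic
    gamma of a subspace S is therefore a geodesic of the ambient space once the
    energy of every variation beta_s of gamma in the ambient space can be compared,
    up to O(s^2), with a function of s whose derivative at 0 vanishes because gamma
    is critical in S ([is_derive_quadratic]). The comparisons are made pointwise for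
    the integrands, with constants that are uniform on the compact supports of the
    partition of unity, and are then integrated ([action_integral_quadratic]). The
    energy density depends only on the Gram matrices G = beta^T beta and
    X = beta'^T beta', through tr (X G^-1) sqrt (det G) ([dens]).

    Fibers of W. Let Q x be the orthogonal projection onto the plane f0 x. For small
    s the forms Q beta_s are injective, hence form a variation of gamma inside the
    fiber, and their energy is stationary. By Pythagoras the Gram matrices of beta_s
    and Q beta_s differ by the Gram matrix of (1 - Q) beta_s, which is O(s^2) because
    (1 - Q) beta_0 = 0; the same holds for the velocities
    ([gram_density_projected], [fiber_totally_geodesic]).

    Scalings. Let gamma = r(t) alpha0 and beta_s = r alpha0 + h with h = O(s). To
    first order the density only sees the trace k of the component of h along alpha0:
    it equals the volume density of alpha0 times
      m r^(m-2) r'^2 + L(k) + O(s^2),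
    where L(k) is the first variation of r^(m-2) r'^2 in the direction k
    ([dens_expand], [energy_expansion]). Testing the criticality of gamma on the
    variations (r + s phi) alpha0 shows that L(phi) has integral 0 over time for every
    phi that vanishes at the end times ([lagr_variation_critical]). At each point of M
    the function t |-> k is such a phi, so after an exchange of the integrals over time
    and over M the first order term of the energy vanishes
    ([scaling_variation_critical], [scalings_totally_geodesic]).

    A form in the fiber over f0 is itself an isomorphism from TM onto the pullback of
    the canonical bundle ([fiber_tangent_iso]). *)

Set Implicit Arguments.
Unset Strict Implicit.
Unset Printing Implicit Defensive.

Import Order.TTheory GRing.Theory Num.Theory.
Import numFieldNormedType.Exports.

Local Open Scope classical_set_scope.
Local Open Scope ring_scope.

Local Notation coord := Defs.coord.

(** * Calculus of smooth functions *)

Section CkCalculus.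
Variables (R : realType) (V : normedModType R).
Implicit Types (U A B : set V) (f g : V -> R).

Lemma Ck_continuous k U f x : Ck k U f -> U x -> {for x, continuous f}.
Proof.
case: k => [|k] /=; first by move=> h; apply: h.
by move=> [df _] Ux; apply: differentiable_continuous; exact: df.
Qed.

Lemma CkW k U f : Ck k.+1 U f -> Ck k U f.
Proof.
elim: k f => [|k IH] f; first by move=> fC x; exact: Ck_continuous fC.
by move=> [df dvf]; split => // v; exact/IH/dvf.
Qed.

Lemma Ck_sub k U U' f : U' `<=` U -> Ck k U f -> Ck k U' f.
Proof.
move=> UU'; elim: k f => [|k IH] f /=; first by move=> fC x /UU'/fC.
by move=> [df dvf]; split=> [x /UU'/df//|v]; exact: IH.
Qed.

Lemma differentiable_near_eq f g (x : V) : {near x, f =1 g} ->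
  differentiable f x -> differentiable g x.
Proof.
move=> fg /diff_locallyP [dc de]; have fgx := nbhs_singleton fg.
have gE : g \o shift x = cst (g x) + 'd f x +o_ (0 : V) id.
  apply/eqaddoP => _/posnumP[e].
  have /eqaddoP/(_ e%:num (gt0 e)) de' := de.
  have fg0 : \forall h \near (0 : V), f (h + x) = g (h + x).
    have cvx : (h + x @[h --> (0:V)]) --> x.
      by rewrite -{2}(add0r x); apply: cvgD; [exact: cvg_id|exact: cvg_cst].
    exact: cvx _ fg.
  near=> h.
  have fgh : f (h + x) = g (h + x) by near: h.
  have : `|(f \o shift x - (cst (f x) + 'd f x)) h| <= e%:num * `|h|.
    by near: h.
  by rewrite /= !fctE /= -fgx -fgh.
have dE := diff_unique dc gE.
by apply/diff_locallyP; rewrite dE; split.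
Unshelve. all: by end_near. Qed.

Lemma open_near_eq U f g x : open U -> (forall x, U x -> f x = g x) -> U x ->
  {near x, f =1 g}.
Proof.
by move=> oU fg Ux; near=> y; apply: fg; near: y; exact: open_nbhs_nbhs.
Unshelve. all: by end_near. Qed.

Lemma Ck_eq k U f g : open U -> (forall x, U x -> f x = g x) ->
  Ck k U f -> Ck k U g.
Proof.
move=> oU; elim: k f g => [|k IH] f g fg /=.
  move=> fC x Ux; have fgx := open_near_eq oU fg Ux.
  rewrite /prop_for /continuous_at -(fg _ Ux).
  by apply: cvg_trans (fC x Ux); exact: near_eq_cvg.
move=> [df dvf]; split=> [x Ux|v].
  exact: differentiable_near_eq (open_near_eq oU fg Ux) (df x Ux).
apply: (IH ('D_v f)); last exact: dvf.
by move=> x Ux; apply: near_eq_derive; exact: open_near_eq oU fg Ux.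
Qed.

Lemma Ck_cst k U (a : R) : Ck k U (fun=> a).
Proof.
elim: k U a => [|k IH] U a /=; first by move=> x _; exact: cvg_cst.
split=> [x _|v]; first exact: differentiable_cst.
by rewrite (_ : 'D_v _ = fun=> 0) //; apply/funext => x; exact: derive_cst.
Qed.

Lemma CkD k U f g : open U -> Ck k U f -> Ck k U g ->
  Ck k U (fun x => f x + g x).
Proof.
move=> oU; elim: k f g => [|k IH] f g /=.
  by move=> fC gC x Ux; apply: cvgD; [exact: fC|exact: gC].
move=> [df dvf] [dg dvg]; split=> [x Ux|v].
  exact: differentiableD (df x Ux) (dg x Ux).
apply: (Ck_eq oU _ (IH _ _ (dvf v) (dvg v))) => x Ux.
by rewrite -deriveD//; apply: diff_derivable; [exact: df|exact: dg].
Qed.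

Lemma CkM k U f g : open U -> Ck k U f -> Ck k U g ->
  Ck k U (fun x => f x * g x).
Proof.
move=> oU; elim: k f g => [|k IH] f g.
  by move=> fC gC x Ux; apply: cvgM; [exact: fC|exact: gC].
move=> fC gC; have [df dvf] := fC; have [dg dvg] := gC; split=> [x Ux|v].
  exact: differentiableM (df x Ux) (dg x Ux).
apply: (Ck_eq oU _
  (CkD oU (IH _ _ (CkW fC) (dvg v)) (IH _ _ (CkW gC) (dvf v)))) => x Ux.
by rewrite -deriveM//; apply: diff_derivable; [exact: df|exact: dg].
Qed.

Lemma CkV k U f : open U -> (forall x, U x -> f x != 0) -> Ck k U f ->
  Ck k U (fun x => (f x)^-1).
Proof.
move=> oU f0; elim: k => [|k IH].
  by move=> fC x Ux; apply: cvgV; [exact: f0|exact: fC].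
move=> fC; have [df dvf] := fC; split=> [x Ux|v].
  by apply: differentiableV; [exact: df|exact: f0].
have fVC := IH (CkW fC).
have C1 := CkM oU (Ck_cst k U (-1)) (CkM oU (CkM oU fVC fVC) (dvf v)).
apply: (Ck_eq oU _ C1) => x Ux.
rewrite deriveV ?f0//; last exact/diff_derivable/df.
by rewrite mulN1r scaleNr -exprVn expr2.
Qed.

Lemma Ck_linear k U f : linear f -> continuous f -> Ck k U f.
Proof.
move=> lf cf; case: k => [|k]; first by move=> x _; exact: cf.
pose fl : {linear V -> R} := HB.pack f (GRing.isLinear.Build _ _ _ _ _ lf).
have df x : differentiable f x := @linear_differentiable _ _ _ fl x cf.
split=> // v; rewrite (_ : 'D_v f = fun=> f v); first exact: Ck_cst.
apply/funext => x; rewrite deriveE//.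
by rewrite (@diff_lin _ _ _ fl x cf).
Qed.

End CkCalculus.

Lemma Ck_sum (R : realType) (V : normedModType R) k (U : set V) (I : Type)
    (r : seq I) (P : pred I) (F : I -> V -> R) : open U ->
  (forall i, P i -> Ck k U (F i)) -> Ck k U (fun x => \sum_(i <- r | P i) F i x).
Proof.
move=> oU FC; elim: r => [|i r IH].
  by apply: (Ck_eq oU _ (Ck_cst k U 0)) => x _; rewrite big_nil.
case Pi: (P i); last by apply: (Ck_eq oU _ IH) => x _; rewrite big_cons Pi.
by apply: (Ck_eq oU _ (CkD oU (FC i Pi) IH)) => x _; rewrite big_cons Pi.
Qed.

(** With the inner function in components, the chain rule only involves directional
    derivatives of real functions, as the definition of C^k does. *)
Lemma Ck_comp (R : realType) (V V' : normedModType R) k (U : set V)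
    (U' : set V') (f : V' -> R) p (h : 'I_p -> V -> R) (e : 'I_p -> V') :
  open U -> (forall x, U x -> U' (\sum_i h i x *: e i)) ->
  (forall i, Ck k U (h i)) -> Ck k U' f ->
  Ck k U (fun x => f (\sum_i h i x *: e i)).
Proof.
move=> oU UU'; pose H x := \sum_i h i x *: e i.
elim: k f => [|k IH] f.
  move=> hC fC x Ux; apply: (@continuous_comp _ _ _ H f); last exact/fC/UU'.
  rewrite /continuous_at /H; apply: (@cvg_big _ _ +%R) => [|i _].
    exact: add_continuous.
  by apply: cvgZr_tmp; exact: hC.
move=> hC fC; have [df dvf] := fC.
have dh i x : U x -> differentiable (h i) x by have [+ _] := hC i; apply.
have HE : H = \sum_i (fun x => h i x *: e i).
  by apply/funext => x; rewrite fct_sumE.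
have dH x : U x -> differentiable H x.
  move=> Ux; rewrite HE; apply: differentiable_sum => i.
  by apply: differentiableZl; exact: dh.
split=> [x Ux|v]; first exact: differentiable_comp (dH x Ux) (df _ (UU' _ Ux)).
have C1 : Ck k U (fun x => \sum_i ('D_v (h i) x * 'D_(e i) f (H x))).
  apply: Ck_sum => // i _; apply: CkM => //; first by have [_] := hC i; apply.
  exact: (IH ('D_(e i) f) (fun j => CkW (hC j)) (dvf (e i))).
apply: (Ck_eq oU _ C1) => x Ux.
have dfH := df _ (UU' _ Ux).
rewrite deriveE; last exact: differentiable_comp (dH x Ux) dfH.
rewrite (diff_comp (dH x Ux) dfH) /=.
have -> : 'd H x v = \sum_i 'D_v (h i) x *: e i.
  rewrite -deriveE; last exact: dH.
  rewrite HE derive_sum => [|i]; last first.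
    exact/diff_derivable/differentiableZl/dh.
  apply: eq_bigr => i _; rewrite deriveE; last exact/differentiableZl/dh.
  by rewrite diffZl; [rewrite -deriveE//; exact: dh|exact: dh].
rewrite linear_sum; apply: eq_bigr => i _.
by rewrite linearZ /= -deriveE.
Qed.

(** [smooth_rel A B f]: near every point of A, the restriction of f to B extends
    to a smooth function. With A larger than B this says that f, which is only
    meaningful on B, is smooth up to A; velocities of curves are of this kind at
    the end points of the time interval. *)
Definition smooth_rel (R : realType) (V : normedModType R) (A B : set V)
    (f : V -> R) : Prop :=
  forall x, A x -> exists (O : set V) (g : V -> R),
    [/\ open O, O x, forall k, Ck k O g & forall y, O y -> B y -> f y = g y].

Section SmoothRel.
Variables (R : realType) (V : normedModType R).
Implicit Types (A B : set V) (f g : V -> R).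

Lemma smooth_relS A B A' B' f : A' `<=` A -> B' `<=` B ->
  smooth_rel A B f -> smooth_rel A' B' f.
Proof.
move=> sA sB sf x /sA/sf [U [g [oO Ox gC fg]]].
by exists U, g; split=> // y Oy /sB; exact: fg.
Qed.

Lemma smooth_on_rel A B f : B `<=` A -> smooth_on A f -> smooth_rel A B f.
Proof. by move=> BA; apply: smooth_relS. Qed.

Lemma smooth_rel_eq A B f g : (forall x, B x -> f x = g x) ->
  smooth_rel A B f -> smooth_rel A B g.
Proof.
move=> fg sf x /sf [U [h [oO Ox hC fh]]]; exists U, h; split => // y Oy By.
by rewrite -fg // fh.
Qed.

Lemma smooth_rel_Ck A B f : (forall k, Ck k setT f) -> smooth_rel A B f.
Proof. by move=> fC x _; exists setT, f; split=> //; exact: openT. Qed.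

Lemma smooth_rel_cst A B (a : R) : smooth_rel A B (fun=> a).
Proof. by apply: smooth_rel_Ck => k; exact: Ck_cst. Qed.

Lemma smooth_rel_linear A B f : linear f -> continuous f -> smooth_rel A B f.
Proof. by move=> lf cf; apply: smooth_rel_Ck => k; exact: Ck_linear. Qed.

Lemma smooth_rel_op A B (op : R -> R -> R) f g :
  (forall k U f g, open U -> Ck k U f -> Ck k U g -> Ck k U (fun x => op (f x) (g x))) ->
  smooth_rel A B f -> smooth_rel A B g -> smooth_rel A B (fun x => op (f x) (g x)).
Proof.
move=> opC sf sg x Ax; have [U [f' [oU Ux fC ff']]] := sf x Ax.
have [U' [g' [oU' U'x gC gg']]] := sg x Ax.
have oI := openI oU oU'.
exists (U `&` U'); exists (fun x => op (f' x) (g' x)); split => //.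
- by move=> k; apply: opC => //; [apply: Ck_sub (fC k)|apply: Ck_sub (gC k)];
    move=> y [].
- by move=> y [Uy U'y] By; rewrite ff' // gg'.
Qed.

Lemma smooth_relD A B f g : smooth_rel A B f -> smooth_rel A B g ->
  smooth_rel A B (fun x => f x + g x).
Proof. by apply: smooth_rel_op => k U f' g'; exact: CkD. Qed.

Lemma smooth_relM A B f g : smooth_rel A B f -> smooth_rel A B g ->
  smooth_rel A B (fun x => f x * g x).
Proof. by apply: smooth_rel_op => k U f' g'; exact: CkM. Qed.

Lemma smooth_relN A B f : smooth_rel A B f -> smooth_rel A B (fun x => - f x).
Proof.
move=> sf; apply: (@smooth_rel_eq A B (fun x => -1 * f x)); last first.
  exact: (smooth_relM (smooth_rel_cst _ _) sf).
by move=> x _ /=; rewrite mulN1r.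
Qed.

Lemma smooth_relB A B f g : smooth_rel A B f -> smooth_rel A B g ->
  smooth_rel A B (fun x => f x - g x).
Proof. by move=> sf sg; apply: smooth_relD => //; exact: smooth_relN. Qed.

Lemma smooth_rel_big A B (op : R -> R -> R) idx (I : Type) (r : seq I) (P : pred I)
    (F : I -> V -> R) :
  (forall f g, smooth_rel A B f -> smooth_rel A B g ->
    smooth_rel A B (fun x => op (f x) (g x))) ->
  (forall i, P i -> smooth_rel A B (F i)) ->
  smooth_rel A B (fun x => \big[op/idx]_(i <- r | P i) F i x).
Proof.
move=> sop sF; elim: r => [|i r IH].
  by apply: (smooth_rel_eq _ (smooth_rel_cst B idx)) => x _; rewrite big_nil.
case Pi: (P i); last by apply: (smooth_rel_eq _ IH) => x _; rewrite big_cons Pi.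
by apply: (smooth_rel_eq _ (sop _ _ (sF i Pi) IH)) => x _; rewrite big_cons Pi.
Qed.

Lemma smooth_rel_sum A B (I : Type) (r : seq I) (P : pred I) (F : I -> V -> R) :
  (forall i, P i -> smooth_rel A B (F i)) ->
  smooth_rel A B (fun x => \sum_(i <- r | P i) F i x).
Proof. by apply: smooth_rel_big => f g; exact: smooth_relD. Qed.

Lemma smooth_rel_prod A B (I : Type) (r : seq I) (P : pred I) (F : I -> V -> R) :
  (forall i, P i -> smooth_rel A B (F i)) ->
  smooth_rel A B (fun x => \prod_(i <- r | P i) F i x).
Proof. by apply: smooth_rel_big => f g; exact: smooth_relM. Qed.

Lemma smooth_rel_det A B n (F : V -> 'M[R]_n) :
  (forall i j, smooth_rel A B (fun x => F x i j)) ->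
  smooth_rel A B (fun x => \det (F x)).
Proof.
move=> sF; apply: smooth_rel_sum => s _; apply: smooth_relM.
  exact: smooth_rel_cst.
by apply: smooth_rel_prod => i _; exact: sF.
Qed.

Lemma smooth_rel_mulmx A B m n p (F : V -> 'M[R]_(m, n)) (G : V -> 'M[R]_(n, p)) :
  (forall i j, smooth_rel A B (fun x => F x i j)) ->
  (forall i j, smooth_rel A B (fun x => G x i j)) ->
  forall i j, smooth_rel A B (fun x => (F x *m G x) i j).
Proof.
move=> sF sG i j.
have sum_smooth : smooth_rel A B (fun x => \sum_k (F x i k * G x k j)).
  by apply: smooth_rel_sum => k _; exact: smooth_relM.
by apply: (smooth_rel_eq _ sum_smooth) => x _; rewrite mxE.
Qed.

Lemma smooth_rel_trmx A B m n (F : V -> 'M[R]_(m, n)) :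
  (forall i j, smooth_rel A B (fun x => F x i j)) ->
  forall i j, smooth_rel A B (fun x => (F x)^T i j).
Proof. by move=> sF i j; apply: (smooth_rel_eq _ (sF j i)) => x _; rewrite mxE. Qed.

Lemma smooth_rel_adj A B n (F : V -> 'M[R]_n) :
  (forall i j, smooth_rel A B (fun x => F x i j)) ->
  forall i j, smooth_rel A B (fun x => (\adj (F x)) i j).
Proof.
move=> sF i j.
have cof_smooth : smooth_rel A B (fun x => cofactor (F x) j i).
  apply: smooth_relM; first exact: smooth_rel_cst.
  apply: smooth_rel_det => k l.
  by apply: (smooth_rel_eq _ (sF (lift j k) (lift i l))) => x _; rewrite !mxE.
by apply: (smooth_rel_eq _ cof_smooth) => x _; rewrite mxE.
Qed.

Lemma smooth_onV A f : (forall x, A x -> f x != 0) -> smooth_on A f ->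
  smooth_on A (fun x => (f x)^-1).
Proof.
move=> f0 sf x Ax; have [U [f' [oO Ox fC ff']]] := sf x Ax.
have f'x : f' x != 0 by rewrite -ff' // f0.
have oU' : open (U `&` [set y | f' y != 0]).
  rewrite openE => y [Oy f'y]; apply: filterI.
    exact: open_nbhs_nbhs.
  exact: (cvgr_neq0 _ (Ck_continuous (fC 0%N) Oy) f'y).
exists (U `&` [set y | f' y != 0]); exists (fun x => (f' x)^-1); split => //.
- move=> k; apply: CkV => //; first by move=> y [].
  by apply: Ck_sub (fC k) => y [].
- by move=> y [Oy _] Ay; rewrite ff'.
Qed.

Lemma smooth_on_invmx A n (F : V -> 'M[R]_n) :
  (forall x, A x -> F x \in unitmx) ->
  (forall i j, smooth_on A (fun x => F x i j)) ->
  forall i j, smooth_on A (fun x => invmx (F x) i j).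
Proof.
move=> uF sF i j.
have detV : smooth_on A (fun x => (\det (F x))^-1).
  apply: smooth_onV; last exact: smooth_rel_det.
  by move=> x /uF; rewrite unitmxE unitfE.
apply: (smooth_rel_eq _ (smooth_relM detV (smooth_rel_adj sF i j))) => x Ax.
by rewrite /invmx uF // !mxE.
Qed.

Lemma smooth_rel_near A B f x : smooth_rel A B f -> A x ->
  exists g : V -> R, {for x, continuous g} /\
    \forall y \near x, B y -> f y = g y.
Proof.
move=> sf /sf [U [g [oO Ox gC fg]]]; exists g; split.
  exact: Ck_continuous (gC 0%N) Ox.
by near=> y; apply: fg; near: y; exact: open_nbhs_nbhs.
Unshelve. all: by end_near. Qed.

Lemma smooth_on_cvg A f x : smooth_on A f -> A x ->
  f @ within A (nbhs x) --> f x.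
Proof.
move=> sf Ax; have [g [gx fg]] := smooth_rel_near sf Ax.
rewrite (nbhs_singleton fg Ax) => P /gx gP.
change (\forall y \near x, A y -> P (f y)); near=> y => Ay.
have -> : f y = g y by move: Ay; near: y.
near: y; exact: gP.
Unshelve. all: by end_near. Qed.

End SmoothRel.

Lemma smooth_rel_comp (R : realType) (V V' : normedModType R) (A B : set V)
    (A' B' : set V') (f : V' -> R) p (h : 'I_p -> V -> R) (e : 'I_p -> V') :
  (forall x, A x -> A' (\sum_i h i x *: e i)) ->
  (forall x, B x -> B' (\sum_i h i x *: e i)) ->
  B `<=` A ->
  (forall i, smooth_on A (h i)) -> smooth_rel A' B' f ->
  smooth_rel A B (fun x => f (\sum_i h i x *: e i)).
Proof.
move=> AA' BB' BA sh sf x Ax.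
have /choice [Og OgP] : forall i, exists Og : set V * (V -> R),
    [/\ open Og.1, Og.1 x, forall k, Ck k Og.1 Og.2 &
     forall y, Og.1 y -> A y -> h i y = Og.2 y].
  by move=> i; have [U [g ?]] := sh i x Ax; exists (U, g).
have [U' [g [oU' U'x gC fg]]] := sf _ (AA' x Ax).
pose U := [set y | forall i, (Og i).1 y].
have oO : open U.
  rewrite openE => y Uy; apply: filter_forall => i.
  by apply: open_nbhs_nbhs; split; [have [] := OgP i|exact: Uy].
have Ox : U x by move=> i; have [] := OgP i.
have OC k i : Ck k U (Og i).2.
  by have [_ _ + _] := OgP i => /(_ k); apply: Ck_sub => y /(_ i).
have hE y : U y -> A y -> \sum_i h i y *: e i = \sum_i (Og i).2 y *: e i.
  move=> Oy Ay; apply: eq_bigr => i _; have [_ _ _ hiE] := OgP i.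
  by rewrite hiE //; exact: (Oy i).
pose O1 := U `&` (fun y => \sum_i (Og i).2 y *: e i) @^-1` U'.
have oO1 : open O1.
  rewrite openE => y [Oy U'y]; apply: filterI; first exact: open_nbhs_nbhs.
  have : {for y, continuous (fun y => \sum_i (Og i).2 y *: e i)}.
    apply: (@cvg_big _ _ +%R) => [|i _]; first exact: add_continuous.
    by apply: cvgZr_tmp; exact: Ck_continuous (OC 0%N i) Oy.
  by apply; exact: open_nbhs_nbhs.
exists O1; exists (fun y => g (\sum_i (Og i).2 y *: e i)); split => //.
- by split => //=; rewrite -hE.
- move=> k; apply: (Ck_comp oO1 (U' := U')) => //; first by move=> y [].
  by move=> i; apply: Ck_sub (OC k i) => y [].
- move=> y [Oy U'y] By; rewrite hE //; last exact: BA.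
  by rewrite -fg // -hE; [exact: BB'| |exact: BA].
Qed.

(** * Smooth families in space and time *)

Section Intervals.
Variable R : realType.

Lemma near_itvoo (a b t : R) : t \in `]a, b[ -> \forall u \near t, u \in `]a, b[.
Proof.
by move=> It; apply: open_nbhs_nbhs; split => //; exact: interval_open.
Qed.

Lemma zero_in_itv (e : R) : 0 < e -> 0 \in `]- e, e[.
Proof. by move=> e0; rewrite in_itv /= oppr_lt0 e0. Qed.

End Intervals.

Section Pullbacks.
Variables (R : realType) (V : normedModType R).

Lemma smooth_rel_comp_cV (A B : set V) m (A' B' : set 'cV[R]_m)
    (f : 'cV[R]_m -> R) (h : V -> 'cV[R]_m) :
  (forall x, A x -> A' (h x)) -> (forall x, B x -> B' (h x)) -> B `<=` A ->
  (forall i, smooth_on A (fun x => h x i ord0)) -> smooth_rel A' B' f ->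
  smooth_rel A B (fun x => f (h x)).
Proof.
move=> AA' BB' BA sh sf.
have hE x : \sum_i h x i ord0 *: delta_mx i ord0 = h x.
  rewrite [RHS]matrix_sum_delta; apply: eq_bigr => i _.
  by rewrite big_ord1.
have := @smooth_rel_comp R V _ A B A' B' f m (fun i x => h x i ord0)
  (fun i => delta_mx i ord0).
move=> /(_ _ _ BA sh sf) comp.
apply: (@smooth_rel_eq _ _ _ _ (fun x => f (\sum_i h x i ord0 *: delta_mx i ord0))).
  by move=> x _; rewrite hE.
by apply: comp => x; rewrite hE; [exact: AA'|exact: BB'].
Qed.

Lemma smooth_rel_line (A B : set V) (A' B' : set R) (f : V -> R) (a v : V) :
  (forall t, A' t -> A (a + t *: v)) -> (forall t, B' t -> B (a + t *: v)) ->
  B' `<=` A' -> smooth_rel A B f -> smooth_rel A' B' (fun t => f (a + t *: v)).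
Proof.
move=> AA' BB' BA sf.
pose h (i : 'I_2) (t : R) := if i == ord0 then 1 else t.
pose e (i : 'I_2) := if i == ord0 then a else v.
have zE t : \sum_(i < 2) h i t *: e i = a + t *: v.
  by rewrite !big_ord_recl big_ord0 addr0 /h /e /= scale1r.
have := @smooth_rel_comp R _ _ A' B' A B f 2 h e.
move=> /(_ _ _ BA _ sf) comp.
apply: (@smooth_rel_eq _ _ _ _ (fun t => f (\sum_i h i t *: e i))).
  by move=> t _; rewrite zE.
apply: comp => [t|t|i]; rewrite ?zE; [exact: AA'|exact: BB'|].
rewrite /h; case: eqP => _; first exact: smooth_rel_cst.
by apply: smooth_rel_linear => // t; exact: cvg_id.
Qed.

End Pullbacks.

(** Families are studied through their expressions on triples ((s, t), y): the
    variation parameter s, the time t and the point y of a chart. *)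
Section SpaceTime.
Variables (R : realType) (m : nat).
Local Notation Z := ((R * R) * 'cV[R]_m)%type.
Implicit Types (z : Z) (f : Z -> R) (D : set 'cV[R]_m).

Lemma smooth_rel_space (A B : set Z) (A' B' : set 'cV[R]_m) (f : 'cV[R]_m -> R) :
  (forall z, A z -> A' z.2) -> (forall z, B z -> B' z.2) -> B `<=` A ->
  smooth_rel A' B' f -> smooth_rel A B (fun z => f z.2).
Proof.
move=> AA' BB' BA; apply: smooth_rel_comp_cV => // i.
apply: smooth_rel_linear => [a u v|z]; first by rewrite /= !mxE.
apply: (@continuous_comp _ _ _ snd (fun y : 'cV[R]_m => y i ord0)).
  exact: cvg_snd.
exact: coord_continuous.
Qed.

Lemma smooth_rel_time (A B : set Z) (A' B' : set R) (f : R -> R) :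
  (forall z, A z -> A' z.1.2) -> (forall z, B z -> B' z.1.2) -> B `<=` A ->
  smooth_rel A' B' f -> smooth_rel A B (fun z => f z.1.2).
Proof.
move=> AA' BB' BA sf.
have tE z : \sum_(i < 1) z.1.2 *: (1 : R) = z.1.2.
  by rewrite big_ord1; exact: mulr1.
have := @smooth_rel_comp R _ _ A B A' B' f 1 (fun i z => z.1.2) (fun i => 1).
move=> /(_ _ _ BA _ sf) comp.
apply: (@smooth_rel_eq _ _ _ _ (fun z => f (\sum_(i < 1) z.1.2 *: (1 : R)))).
  by move=> z _; rewrite tE.
apply: comp => [z|z|i]; rewrite ?tE; [exact: AA'|exact: BB'|].
apply: smooth_rel_linear => // z.
by apply: (@continuous_comp _ _ _ fst snd); [exact: cvg_fst|exact: cvg_snd].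
Qed.

Lemma smooth_rel_slice (A B : set Z) (A' B' : set R) f (s : R) (y : 'cV[R]_m) :
  (forall t, A' t -> A ((s, t), y)) -> (forall t, B' t -> B ((s, t), y)) ->
  B' `<=` A' ->
  smooth_rel A B f -> smooth_rel A' B' (fun t => f ((s, t), y)).
Proof.
move=> AA' BB' BA sf.
have zE (t : R) : ((s, 0), y) + t *: ((0, 1), 0) = ((s, t), y) :> Z.
  congr (_, _); first congr (_, _).
  - by rewrite /= scaler0 addr0.
  - by rewrite /= add0r; exact: mulr1.
  - by rewrite /= scaler0 addr0.
apply: (@smooth_rel_eq _ _ _ _ (fun t : R => f (((s, 0), y) + t *: ((0, 1), 0)))).
  by move=> t _; rewrite zE.
by apply: (smooth_rel_line _ _ BA sf) => t; rewrite zE; [exact: AA'|exact: BB'].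
Qed.

(** At interior times only the values of f on the strip matter; at the end
    points the two-sided derivative depends on values outside the time interval. *)
Definition tderiv f z : R := derive1 (fun u => f ((z.1.1, u), z.2)) z.1.2.

Lemma line_quotient f z :
  (fun h : R => h^-1 *: (f ((z.1.1, h *: 1 + z.1.2), z.2) -
     f ((z.1.1, z.1.2), z.2))) =
  (fun h : R => h^-1 *: (f (h *: ((0, 1), 0) + z) - f z)).
Proof.
apply/funext => h; congr (_ *: (f _ - f _)); last by case: z => -[].
by case: z => -[a b] c; congr (_, _); first congr (_, _);
  rewrite /= ?scaler0 ?add0r.
Qed.

Lemma derive1_line f z :
  derive1 (fun u => f ((z.1.1, u), z.2)) z.1.2 = 'D_((0, 1), 0) f z.
Proof. by rewrite derive1E /derive /= line_quotient. Qed.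

Lemma derivable_line f z : differentiable f z ->
  derivable (fun u => f ((z.1.1, u), z.2)) z.1.2 1.
Proof.
move=> /diff_derivable - /(_ ((0, 1), 0)).
by rewrite /derivable /= line_quotient.
Qed.

Lemma is_derive_sline f z : differentiable f z ->
  is_derive z.1.1 1 (fun u => f ((u, z.1.2), z.2)) ('D_((1, 0), 0) f z).
Proof.
move=> /diff_derivable - /(_ ((1, 0), 0)) df.
have E : (fun h : R => h^-1 *: (f (h *: ((1, 0), 0) + z) - f z)) =
    (fun h : R => h^-1 *: (f ((h *: 1 + z.1.1, z.1.2), z.2) - f ((z.1.1, z.1.2), z.2))).
  apply/funext => h; congr (_ *: (f _ - f _)); last by case: z {df} => -[].
  by case: z {df} => -[a b] c; congr (_, _); first congr (_, _);
    rewrite /= ?scaler0 ?add0r.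
apply: DeriveDef; first by rewrite /derivable /= -E.
by rewrite /derive /= -E.
Qed.

Variables (e p q : R) (D : set 'cV[R]_m).
Hypothesis e0 : 0 < e.

Definition closed_strip : set Z := (`]- e, e[ `*` `[p, q]) `*` D.
Definition open_strip : set Z := (`]- e, e[ `*` `]p, q[) `*` D.

Lemma open_strip_sub : open_strip `<=` closed_strip.
Proof.
move=> [[s t] y] [[/= es tpq] Dy]; split=> //; split=> //=.
exact: subset_itv_oo_cc.
Qed.

Lemma tderiv_near f g U z : open U -> U z -> open_strip z ->
  (forall z, U z -> open_strip z -> f z = g z) ->
  \forall u \near z.1.2, f ((z.1.1, u), z.2) = g ((z.1.1, u), z.2).
Proof.
move=> oU Uz [[sz tz] yz] fg.
have cu : ((z.1.1, u), z.2) @[u --> z.1.2] --> z.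
  have {2}-> : z = ((z.1.1, z.1.2), z.2) by case: z {Uz sz tz yz fg} => -[].
  apply: (@cvg_pair _ _ _ _ (nbhs (z.1.1, z.1.2)) (nbhs z.2)).
    apply: (@cvg_pair _ _ _ _ (nbhs z.1.1) (nbhs z.1.2)); last exact: cvg_id.
    exact: cvg_cst.
  exact: cvg_cst.
near=> u; apply: fg.
- near: u; apply: cu; exact: open_nbhs_nbhs.
- by split=> //; split=> //=; near: u; exact: near_itvoo.
Unshelve. all: by end_near. Qed.

Lemma smooth_rel_tderiv f : smooth_on closed_strip f ->
  smooth_rel closed_strip open_strip (tderiv f).
Proof.
move=> sf z0 /sf [U [g [oU Uz0 gC fg]]].
exists U; exists ('D_((0, 1), 0) g); split => //.
  by move=> k; have [_] := gC k.+1; apply.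
move=> z Uz Bz; rewrite -derive1_line /tderiv !derive1E; apply: near_eq_derive.
by apply: (tderiv_near oU Uz Bz) => z' Uz' /open_strip_sub; exact: fg.
Qed.

Lemma smooth_on_derivable f z : smooth_on closed_strip f -> open_strip z ->
  derivable (fun u => f ((z.1.1, u), z.2)) z.1.2 1.
Proof.
move=> sf Bz; have [U [g [oU Uz gC fg]]] := sf z (open_strip_sub Bz).
have dg : differentiable g z by have [+ _] := gC 1%N; apply.
apply: near_eq_derivable (derivable_line dg).
near=> u; apply/esym; near: u.
by apply: (tderiv_near oU Uz Bz) => z' Uz' /open_strip_sub; exact: fg.
Unshelve. all: by end_near. Qed.

End SpaceTime.

Section Lipschitz.
Variables (R : realType) (m : nat).
Local Notation Z := ((R * R) * 'cV[R]_m)%type.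

Lemma mvt_bound (f df : R -> R) (s C : R) :
  (forall u, `|u| <= `|s| -> is_derive u (1 : R) f (df u)) ->
  (forall u, `|u| <= `|s| -> `|df u| <= C) -> `|f s - f 0| <= C * `|s|.
Proof.
move=> fd dC.
wlog s0 : s f df fd dC / 0 <= s.
  move=> H; have [/H|s0] := leP 0 s; first by move=> /(_ dC).
  have := @H (- s) (fun u => f (- u)) (fun u => - df (- u)).
  rewrite normrN opprK oppr0; apply; last by rewrite oppr_ge0 ltW.
    move=> u us; have fu : is_derive (- u) (1 : R) f (df (- u)).
      by apply: fd; rewrite normrN.
    by rewrite -mulrN1; apply: is_derive1_comp.
  by move=> u us; rewrite normrN; apply: dC; rewrite normrN.
have us u : u \in `[0, s] -> `|u| <= `|s|.
  by rewrite in_itv /= => /andP[u0 us]; rewrite !ger0_norm.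
have [||c cs ->] := @MVT_segment R f df 0 s s0.
- by move=> u /subset_itv_oo_cc/us; exact: fd.
- by apply: derivable_within_continuous => u /us /fd [].
rewrite subr0 normrM ler_wpM2r//.
exact/dC/us.
Qed.

(** Mean value theorem in s. The constant is uniform near (t0, y0), end times
    included; this is how a quantity that vanishes for s = 0 is seen to be O(s). *)
Lemma smooth_rel_lipschitz e p q D (f : Z -> R) t0 y0 : 0 < e ->
  smooth_rel (closed_strip e p q D) (open_strip e p q D) f ->
  t0 \in `[p, q] -> D y0 ->
  exists C, \forall z \near ((0, t0), y0), open_strip e p q D z ->
    `|f z - f ((0, z.1.2), z.2)| <= C * `|z.1.1|.
Proof.
move=> e0 sf t0pq Dy0; pose z0 : Z := ((0, t0), y0).
have Az0 : closed_strip e p q D z0.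
  by split=> //; split=> //=; exact: zero_in_itv.
have [U [g [oU Uz0 gC fg]]] := sf z0 Az0.
pose gs := 'D_((1, 0), 0) g.
have gs_cont : {for z0, continuous gs}.
  by have [_ /(_ ((1, 0), 0)) g1] := gC 1%N; exact: (g1 _ Uz0).
have gs_bnd : \forall z \near z0, `|gs z| <= `|gs z0| + 1.
  by apply: (cvgr_le _ (cvg_norm gs_cont)); rewrite ltrDl.
exists (`|gs z0| + 1).
have : \forall z \near z0, U z /\ `|gs z| <= `|gs z0| + 1.
  by apply: filterI => //; exact: open_nbhs_nbhs.
move=> /nbhs_ballP[d /= d0 dU].
apply/nbhs_ballP; exists d => //= -[[s t] y] zd Bz /=.
have /= [[sd td] yd] := zd.
have lineU u : `|u| <= `|s| -> ball z0 d ((u, t), y).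
  move=> us; split=> //; split=> //=.
  move: sd; rewrite -!ball_normE /= !sub0r !normrN; exact: le_lt_trans.
have B0 : open_strip e p q D ((0, t), y).
  by case: Bz => -[/= se tpq] Dy; split=> //; split=> //=; exact: zero_in_itv.
have ballU z : ball z0 d z -> U z by move=> /dU [].
rewrite fg //; last exact: ballU.
rewrite fg //; last by apply: ballU; apply: lineU; rewrite normr0.
apply: (@mvt_bound (fun u => g ((u, t), y)) (fun u => gs ((u, t), y))) => u us.
  have dg : differentiable g ((u, t), y).
    by have [+ _] := gC 1%N; apply; exact/ballU/lineU.
  exact: (is_derive_sline dg).
by have /dU [] := lineU u us.
Qed.

End Lipschitz.

Section Jacobian.
Variables (R : realType) (m : nat) (M : manifold R m).

(** The derivative of any smooth extension of the transition map across the
    boundary of the half-space is a Jacobian. *)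
Lemma jacobian_exists (c d : chart M) x : dom c x -> dom d x ->
  exists J, is_jacobian c d x J.
Proof.
move=> cx dx; pose y0 := coord c x.
have Ay0 : (coord c @` (dom c `&` dom d)) y0 by exists x.
have /choice [Ug UgP] : forall i : 'I_m, exists Ug : set 'cV[R]_m * ('cV[R]_m -> R),
    [/\ open Ug.1, Ug.1 y0, forall k, Ck k Ug.1 Ug.2 &
     forall y, Ug.1 y -> (coord c @` (dom c `&` dom d)) y ->
       coord d (param c y) i ord0 = Ug.2 y].
  move=> i; have [U [g ?]] := @transition_smooth _ _ M c d i _ Ay0.
  by exists (U, g).
have dg i : differentiable (Ug i).2 y0.
  by have [_ Uy0 + _] := UgP i => /(_ 1%N) [+ _]; apply.
exists (\matrix_(i, j) 'D_(delta_mx j ord0) (Ug i).2 y0) => e0 e0_gt0.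
have step i : \forall y \near y0, (coord c @` (dom c `&` dom d)) y ->
   `|(Ug i).2 y - (Ug i).2 y0 - 'd ((Ug i).2) y0 (y - y0)| <= e0 * `|y - y0|
   /\ coord d (param c y) i ord0 = (Ug i).2 y.
  have /diff_locallyP[_ /eqaddoP/(_ _ e0_gt0) gE] := dg i.
  have [oU Uy0 _ gext] := UgP i.
  have cv : (y - y0 @[y --> y0]) --> (0 : 'cV[R]_m).
    rewrite -(subrr y0); apply: (@cvgD _ _ _ (nbhs y0) _ id (cst (- y0))).
      exact: cvg_id.
    exact: cvg_cst.
  have gE' := cv _ gE.
  near=> y => Ay; split; last first.
    by apply: gext => //; near: y; exact: open_nbhs_nbhs.
  have : `|((Ug i).2 \o shift y0 - (cst ((Ug i).2 y0) + 'd ((Ug i).2) y0)) (y - y0)|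
      <= e0 * `|y - y0| by near: y; exact: gE'.
  by rewrite /= !fctE /= subrK opprD addrA.
apply: filterS (filter_forall _ step) => y stepy Ay.
rewrite [leLHS]/Num.Def.normr/= mx_normrE.
apply: bigmax_le => [|[i j] _ /=]; first by rewrite mulr_ge0 // ltW.
have [gE cE] := stepy i Ay.
have [_ Uy0 _ gext] := UgP i.
have c0E : coord d x i ord0 = (Ug i).2 y0.
  by rewrite -gext // coordK.
rewrite (ord1 j) !mxE cE c0E.
have dE : 'd ((Ug i).2) y0 (y - y0) =
    \sum_j0 (\matrix_(i, j) 'D_(delta_mx j ord0) (Ug i).2 y0) i j0 * (y - y0) j0 ord0.
  rewrite {1}(matrix_sum_delta (y - y0)) linear_sum; apply: eq_bigr => k _.
  rewrite big_ord1 linearZ /= mxE mulrC; congr (_ * _).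
  by rewrite deriveE.
by move: gE; rewrite dE.
Unshelve. all: by end_near. Qed.

End Jacobian.

(** * Calculus modulo powers of a small parameter *)

Section OrderCalculus.
Variables (R : realType) (Z : Type) (F : set_system Z).
Context {FF : Filter F}.
Variable ell : Z -> R.
Hypothesis ell0 : ell @ F --> (0 : R).
Implicit Types (f g : Z -> R) (j : nat) (c : R).

Definition ordO j f : Prop :=
  exists C, \forall z \near F, `|f z| <= C * `|ell z| ^+ j.

Lemma ell_le1 : \forall z \near F, `|ell z| <= 1.
Proof.
have := cvgr0_norm_le _ ell0; apply; exact: ltr01.
Qed.

Lemma ordO_eq j f g : (\forall z \near F, f z = g z) -> ordO j f -> ordO j g.
Proof.
move=> fg [C fC]; exists C; apply: filterS2 fg fC => z <-; exact.
Qed.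

Lemma ordOD j f g : ordO j f -> ordO j g -> ordO j (fun z => f z + g z).
Proof.
move=> [C fC] [C' gC]; exists (C + C'); apply: filterS2 fC gC => z fz gz.
by rewrite mulrDl (le_trans (ler_normD _ _)) // lerD.
Qed.

Lemma ordON j f : ordO j f -> ordO j (fun z => - f z).
Proof. by move=> [C fC]; exists C; apply: filterS fC => z; rewrite normrN. Qed.

Lemma ordOB j f g : ordO j f -> ordO j g -> ordO j (fun z => f z - g z).
Proof. by move=> fO gO; apply: ordOD => //; exact: ordON. Qed.

Lemma ordOM j k f g : ordO j f -> ordO k g -> ordO (j + k) (fun z => f z * g z).
Proof.
move=> [C fC] [C' gC]; exists (C * C'); apply: filterS2 fC gC => z fz gz.
by rewrite normrM exprD mulrACA ler_pM.
Qed.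

Lemma ordOW j k f : (k <= j)%N -> ordO j f -> ordO k f.
Proof.
move=> kj [C fC]; exists `|C|; apply: filterS2 ell_le1 fC => z z1 /le_trans; apply.
apply: (@le_trans _ _ (`|C| * `|ell z| ^+ j)).
  by rewrite ler_wpM2r ?exprn_ge0 // ler_norm.
by rewrite ler_wpM2l // ler_wiXn2l.
Qed.

Lemma ordOM0l j f g : ordO 0 f -> ordO j g -> ordO j (fun z => f z * g z).
Proof. exact: ordOM. Qed.

Lemma ordOM0r j f g : ordO j f -> ordO 0 g -> ordO j (fun z => f z * g z).
Proof. by move=> fO gO; rewrite -(addn0 j); exact: ordOM. Qed.

Lemma ordO_zero j : ordO j (fun=> 0).
Proof. by exists 0; apply: nearW => z; rewrite normr0 mul0r. Qed.

Lemma ordO_cst c : ordO 0 (fun=> c).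
Proof. by exists `|c|; apply: nearW => z; rewrite expr0 mulr1. Qed.

Lemma ordO_sum j (I : Type) (r : seq I) (P : pred I) (f : I -> Z -> R) :
  (forall i, P i -> ordO j (f i)) -> ordO j (fun z => \sum_(i <- r | P i) f i z).
Proof.
move=> fO; elim: r => [|i r IH].
  by apply: (ordO_eq _ (ordO_zero j)); apply: nearW => z; rewrite big_nil.
case Pi: (P i); [apply: (ordO_eq _ (ordOD (fO i Pi) IH))|apply: (ordO_eq _ IH)];
  by apply: nearW => z; rewrite big_cons Pi.
Qed.

Lemma ordO_prod (I : Type) (r : seq I) (P : pred I) (f : I -> Z -> R) :
  (forall i, P i -> ordO 0 (f i)) ->
  ordO 0 (fun z => \prod_(i <- r | P i) f i z).
Proof.
move=> fO; elim: r => [|i r IH].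
  by apply: (ordO_eq _ (ordO_cst 1)); apply: nearW => z; rewrite big_nil.
case Pi: (P i); [apply: (ordO_eq _ (ordOM (fO i Pi) IH))|apply: (ordO_eq _ IH)];
  by apply: nearW => z; rewrite big_cons Pi.
Qed.

Lemma ordOM_sub j f f' g g' : ordO 0 f' -> ordO 0 g ->
  ordO j (fun z => f z - f' z) -> ordO j (fun z => g z - g' z) ->
  ordO j (fun z => f z * g z - f' z * g' z).
Proof.
move=> f'O gO fO gO'.
apply: (ordO_eq _ (ordOD (ordOM0r fO gO) (ordOM0l f'O gO'))).
by apply: nearW => z; ring.
Qed.

Lemma ordO_prod_sub j (I : Type) (r : seq I) (P : pred I) (f g : I -> Z -> R) :
  (forall i, P i -> ordO 0 (f i)) -> (forall i, P i -> ordO 0 (g i)) ->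
  (forall i, P i -> ordO j (fun z => f i z - g i z)) ->
  ordO j (fun z => \prod_(i <- r | P i) f i z - \prod_(i <- r | P i) g i z).
Proof.
move=> fO gO fgO; elim: r => [|i r IH].
  apply: (ordO_eq _ (ordO_zero j)); apply: nearW => z.
  by rewrite !big_nil subrr.
case Pi: (P i); last first.
  by apply: (ordO_eq _ IH); apply: nearW => z; rewrite !big_cons Pi.
have H := ordOM_sub (gO i Pi) (ordO_prod r fO) (fgO i Pi) IH.
by apply: (ordO_eq _ H); apply: nearW => z; rewrite !big_cons Pi.
Qed.

Lemma ordO_small f c : 0 < c -> ordO 1 f -> \forall z \near F, `|f z| <= c.
Proof.
move=> c0 [C fC].
have d0 : 0 < c / (`|C| + 1) by rewrite divr_gt0 // ltr_wpDl.
have ls : \forall z \near F, `|ell z| <= c / (`|C| + 1).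
  exact: (cvgr0_norm_le _ ell0 _ d0).
apply: filterS2 ls fC => z lz /le_trans; apply.
rewrite expr1 (@le_trans _ _ ((`|C| + 1) * `|ell z|)) //.
  by rewrite ler_wpM2r // (le_trans (ler_norm C)) // lerDl.
by rewrite mulrC -ler_pdivlMr // ltr_wpDl.
Qed.

Lemma ordO_inv f c : 0 < c -> (\forall z \near F, c <= f z) ->
  ordO 0 (fun z => (f z)^-1).
Proof.
move=> c0 fc; exists c^-1; apply: filterS fc => z cf.
have f0 := lt_le_trans c0 cf.
by rewrite expr0 mulr1 gtr0_norm ?invr_gt0 // lef_pV2 // posrE.
Qed.

Lemma ordO_rsqrt f c : 0 < c -> (\forall z \near F, c <= f z) ->
  ordO 0 (fun z => (Num.sqrt (f z))^-1).
Proof.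
move=> c0 fc; apply: (@ordO_inv _ (Num.sqrt c)); first by rewrite sqrtr_gt0.
by apply: filterS fc => z cf; rewrite ler_wsqrtr.
Qed.

Lemma ordO_rsqrt_sub j f g c : 0 < c ->
  (\forall z \near F, c <= f z) -> (\forall z \near F, c <= g z) ->
  ordO j (fun z => f z - g z) ->
  ordO j (fun z => (Num.sqrt (f z))^-1 - (Num.sqrt (g z))^-1).
Proof.
move=> c0 fc gc fg.
have wO : ordO 0 (fun z => (Num.sqrt (f z) + Num.sqrt (g z))^-1).
  apply: (@ordO_inv _ (Num.sqrt c)); first by rewrite sqrtr_gt0.
  apply: filterS fc => z cf; rewrite (le_trans (ler_wsqrtr cf)) // lerDl.
  exact: sqrtr_ge0.
have H := ordOM0r (ordON fg)
  (ordOM wO (ordOM (ordO_rsqrt c0 fc) (ordO_rsqrt c0 gc))).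
apply: (ordO_eq _ H); apply: filterS2 fc gc => z cf cg.
have f0 := lt_le_trans c0 cf; have g0 := lt_le_trans c0 cg.
rewrite -{1}(sqr_sqrtr (ltW f0)) -{1}(sqr_sqrtr (ltW g0)).
have sf : Num.sqrt (f z) > 0 by rewrite sqrtr_gt0.
have sg : Num.sqrt (g z) > 0 by rewrite sqrtr_gt0.
move: sf sg; move: (Num.sqrt (f z)) (Num.sqrt (g z)) => a b a0 b0.
by field; rewrite !gt_eqF // addr_gt0.
Qed.

Lemma ordO_sqrt j f g c : 0 < c -> (\forall z \near F, 0 <= f z) ->
  (\forall z \near F, c <= g z) ->
  ordO j (fun z => f z - g z ^+ 2) -> ordO j (fun z => Num.sqrt (f z) - g z).
Proof.
move=> c0 f0 gc fg.
have wO : ordO 0 (fun z => (Num.sqrt (f z) + g z)^-1).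
  apply: (@ordO_inv _ c) => //.
  apply: filterS gc => z cg; rewrite (le_trans cg) // lerDr.
  exact: sqrtr_ge0.
have H := ordOM0r fg wO.
apply: (ordO_eq _ H); apply: filterS2 f0 gc => z fz0 cg.
have g0 := lt_le_trans c0 cg.
rewrite -{1}(sqr_sqrtr fz0) subr_sqr mulfK //.
by rewrite gt_eqF // ltr_wpDl // sqrtr_ge0.
Qed.

Definition mxO j m n (A : Z -> 'M[R]_(m, n)) : Prop :=
  forall i k, ordO j (fun z => A z i k).

Lemma mxO_eq j m n (A B : Z -> 'M[R]_(m, n)) :
  (\forall z \near F, A z = B z) -> mxO j A -> mxO j B.
Proof.
move=> AB AO i k; apply: (ordO_eq _ (AO i k)).
by apply: filterS AB => z ->.
Qed.

Lemma mxOW j k m n (A : Z -> 'M[R]_(m, n)) : (k <= j)%N -> mxO j A -> mxO k A.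
Proof. by move=> kj AO i l; exact: ordOW kj (AO i l). Qed.

Lemma mxOD j m n (A B : Z -> 'M[R]_(m, n)) :
  mxO j A -> mxO j B -> mxO j (fun z => A z + B z).
Proof.
move=> AO BO i k; apply: (ordO_eq _ (ordOD (AO i k) (BO i k))).
by apply: nearW => z; rewrite mxE.
Qed.

Lemma mxOT j m n (A : Z -> 'M[R]_(m, n)) : mxO j A -> mxO j (fun z => (A z)^T).
Proof.
move=> AO i k; apply: (ordO_eq _ (AO k i)).
by apply: nearW => z; rewrite mxE.
Qed.

Lemma mxOZ j k m n f (A : Z -> 'M[R]_(m, n)) :
  ordO j f -> mxO k A -> mxO (j + k) (fun z => f z *: A z).
Proof.
move=> fO AO i l; apply: (ordO_eq _ (ordOM fO (AO i l))).
by apply: nearW => z; rewrite mxE.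
Qed.

Lemma mxOM j k m n p (A : Z -> 'M[R]_(m, n)) (B : Z -> 'M[R]_(n, p)) :
  mxO j A -> mxO k B -> mxO (j + k) (fun z => A z *m B z).
Proof.
move=> AO BO i l.
have H : ordO (j + k) (fun z => \sum_x (A z i x * B z x l)).
  by apply: ordO_sum => x _; exact: ordOM.
by apply: (ordO_eq _ H); apply: nearW => z; rewrite mxE.
Qed.

Lemma mxO_cst m n (A : 'M[R]_(m, n)) : mxO 0 (fun=> A).
Proof. by move=> i k; exact: ordO_cst. Qed.

Lemma ordO_tr j m (A : Z -> 'M[R]_m) : mxO j A -> ordO j (fun z => \tr (A z)).
Proof. by move=> AO; apply: ordO_sum => i _; exact: AO. Qed.

Lemma ordO_det m (A : Z -> 'M[R]_m) : mxO 0 A -> ordO 0 (fun z => \det (A z)).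
Proof.
move=> AO; apply: ordO_sum => s _; apply: ordOM0l; first exact: ordO_cst.
by apply: ordO_prod => i _; exact: AO.
Qed.

Lemma ordO_det_sub j m (A B : Z -> 'M[R]_m) : mxO 0 A -> mxO 0 B ->
  mxO j (fun z => A z - B z) -> ordO j (fun z => \det (A z) - \det (B z)).
Proof.
move=> AO BO ABO.
have ABO' i k : ordO j (fun z => A z i k - B z i k).
  by apply: (ordO_eq _ (ABO i k)); apply: nearW => z; rewrite !mxE.
have H : ordO j (fun z => \sum_(s : 'S_m) ((-1) ^+ s * \prod_i A z i (s i) -
    (-1) ^+ s * \prod_i B z i (s i))).
  apply: ordO_sum => s _; apply: ordOM_sub.
  - exact: ordO_cst.
  - by apply: ordO_prod => i _; exact: AO.
  - by apply: (ordO_eq _ (ordO_zero j)); apply: nearW => z; rewrite subrr.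
  - apply: ordO_prod_sub => i _; [exact: AO|exact: BO|exact: ABO'].
by apply: (ordO_eq _ H); apply: nearW => z; rewrite sumrB.
Qed.

Lemma cofactor_det m (A : 'M[R]_m) i k :
  \adj A i k = (-1) ^+ (k + i) * \det (row' k (col' i A)).
Proof. by rewrite mxE. Qed.

Lemma mxO_adj m (A : Z -> 'M[R]_m) : mxO 0 A -> mxO 0 (fun z => \adj (A z)).
Proof.
move=> AO i k.
have H : ordO 0 (fun z => (-1) ^+ (k + i) * \det (row' k (col' i (A z)))).
  apply: ordOM0l; first exact: ordO_cst.
  apply: ordO_det => a b; apply: (ordO_eq _ (AO (lift k a) (lift i b))).
  by apply: nearW => z; rewrite !mxE.
by apply: (ordO_eq _ H); apply: nearW => z; rewrite cofactor_det.
Qed.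

Lemma mxO_adj_sub j m (A B : Z -> 'M[R]_m) : mxO 0 A -> mxO 0 B ->
  mxO j (fun z => A z - B z) -> mxO j (fun z => \adj (A z) - \adj (B z)).
Proof.
move=> AO BO ABO i k.
have minorO (C : Z -> 'M[R]_m) l : mxO l C -> mxO l (fun z => row' k (col' i (C z))).
  move=> CO a b; apply: (ordO_eq _ (CO (lift k a) (lift i b))).
  by apply: nearW => z; rewrite !mxE.
have H : ordO j (fun z => (-1) ^+ (k + i) *
    (\det (row' k (col' i (A z))) - \det (row' k (col' i (B z))))).
  apply: ordOM0l; first exact: ordO_cst.
  apply: ordO_det_sub; [exact: minorO|exact: minorO|].
  apply: mxO_eq (minorO _ _ ABO); apply: nearW => z.
  by apply/matrixP => a b; rewrite !mxE.
apply: (ordO_eq _ H); apply: nearW => z.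
rewrite mulrBr -!cofactor_det; move: (\adj (A z)) (\adj (B z)) => A' B'.
by rewrite !mxE.
Qed.

(** ** The energy density *)

(** The integrand of the metric as a function of the symmetric matrices
    zeta^T zeta and alpha^T alpha: in these, the part of a
    one-form normal to a given plane enters quadratically. *)
Definition dens m (X G : 'M[R]_m) : R := \tr (X *m invmx G) * Num.sqrt (\det G).

(** The adjugate and the determinant are polynomials in the entries, so that
    estimates only require det G to stay away from 0. *)
Lemma dens_adj m (X G : 'M[R]_m) : 0 < \det G ->
  dens X G = \tr (X *m \adj G) * (Num.sqrt (\det G))^-1.
Proof.
move=> dG; rewrite /dens /invmx unitmxE unitfE gt_eqF //=.
rewrite -scalemxAr mxtraceZ.
have s0 : Num.sqrt (\det G) > 0 by rewrite sqrtr_gt0.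
have -> : (\det G)^-1 = (Num.sqrt (\det G) * Num.sqrt (\det G))^-1.
  by rewrite -expr2 sqr_sqrtr // ltW.
by move: (Num.sqrt _) s0 => a a0; field; rewrite gt_eqF.
Qed.

(** Congruence modulo ell^j passes through products, determinants, adjugates and,
    away from 0, inverse square roots. *)
Lemma dens_sub j m (X X' G G' : Z -> 'M[R]_m) c : 0 < c ->
  mxO 0 X -> mxO 0 X' -> mxO 0 G -> mxO 0 G' ->
  mxO j (fun z => X z - X' z) -> mxO j (fun z => G z - G' z) ->
  (\forall z \near F, c <= \det (G z)) -> (\forall z \near F, c <= \det (G' z)) ->
  ordO j (fun z => dens (X z) (G z) - dens (X' z) (G' z)).
Proof.
move=> c0 XO X'O GO G'O XX' GG' cG cG'.
have trO : ordO j (fun z => \tr (X z *m \adj (G z)) - \tr (X' z *m \adj (G' z))).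
  have H : mxO j (fun z => (X z - X' z) *m \adj (G z) +
      X' z *m (\adj (G z) - \adj (G' z))).
    apply: mxOD; first by rewrite -(addn0 j); apply: mxOM => //; exact: mxO_adj.
    by rewrite -(add0n j); apply: mxOM => //; exact: mxO_adj_sub.
  apply: (ordO_eq _ (ordO_tr H)); apply: nearW => z.
  by rewrite mulmxBl mulmxBr subrKA raddfB.
have tr0 : ordO 0 (fun z => \tr (X' z *m \adj (G' z))).
  by apply: ordO_tr; apply: (@mxOM 0 0) => //; exact: mxO_adj.
have H := ordOM_sub tr0 (ordO_rsqrt c0 cG) trO
  (ordO_rsqrt_sub c0 cG cG' (ordO_det_sub GO G'O GG')).
apply: (ordO_eq _ H); apply: filterS2 cG cG' => z cz cz'.
by rewrite !dens_adj //; exact: lt_le_trans c0 _.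
Qed.

Lemma dens_mul m (g X G : 'M[R]_m) : 0 < \det g -> G \in unitmx ->
  dens (g *m X) (g *m G) = Num.sqrt (\det g) * dens X G.
Proof.
move=> dg uG; have ug : g \in unitmx by rewrite unitmxE unitfE gt_eqF.
have invE : invmx (g *m G) = invmx G *m invmx g.
  have u : g *m G \in unitmx by rewrite unitmx_mul ug.
  apply: (can_inj (mulKmx u)); rewrite mulmxV // mulmxA -(mulmxA g) mulmxV //.
  by rewrite mulmx1 mulmxV.
rewrite /dens invE det_mulmx sqrtrM ?(ltW dg) // -mulmxA mxtrace_mulC.
by rewrite !mulmxA mulmxKV // mulrCA.
Qed.

Lemma dens_scale m a (X G : 'M[R]_m) : 0 < a -> G \in unitmx ->
  dens X (a ^+ 2 *: G) = a ^+ m * a ^- 2 * dens X G.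
Proof.
move=> a0 uG; have a2 : a ^+ 2 \is a GRing.unit by rewrite unitfE expf_neq0 // gt_eqF.
have uaG : a ^+ 2 *: G \in unitmx by rewrite unitmxZ.
rewrite /dens invmxZ // detZ sqrtrM; last by rewrite exprn_ge0 // exprn_ge0 // ltW.
rewrite -exprM mulnC exprM sqrtr_sqr ger0_norm ?exprn_ge0 ?ltW //.
by rewrite -scalemxAr mxtraceZ; ring.
Qed.

(** The first order expansion of the determinant at the identity: in the Leibniz
    formula every other permutation moves at least two indices. *)
Lemma det1D m (N : Z -> 'M[R]_m) : mxO 1 N ->
  ordO 2 (fun z => \det (1%:M + N z) - (1 + \tr (N z))).
Proof.
move=> NO.
have entryO i k : ordO 0 (fun z => (1%:M + N z) i k).
  have : ordO 0 (fun z => (1%:M : 'M[R]_m) i k + N z i k).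
    by apply: ordOD; [exact: ordO_cst|exact: ordOW (leq0n _) (NO i k)].
  by move=> H; apply: (ordO_eq _ H); apply: nearW => z; rewrite [RHS]mxE.
have offdiag i k : i != k -> ordO 1 (fun z => (1%:M + N z) i k).
  move=> ik; apply: (ordO_eq _ (NO i k)); apply: nearW => z.
  by rewrite !mxE (negbTE ik) add0r.
have diag (r : seq 'I_m) : ordO 2 (fun z =>
    \prod_(i <- r) (1%:M + N z) i i - (1 + \sum_(i <- r) N z i i)).
  elim: r => [|i r IH].
    apply: (ordO_eq _ (ordO_zero 2)); apply: nearW => z.
    by rewrite !big_nil addr0 subrr.
  have H1 : ordO 2 (fun z => N z i i * \sum_(k <- r) N z k k).
    by apply: (@ordOM 1 1) => //; apply: ordO_sum => k _; exact: NO.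
  apply: (ordO_eq _ (ordOD (ordOM0l (entryO i i) IH) H1)); apply: nearW => z.
  by rewrite !big_cons [(1%:M + N z) i i]mxE [1%:M i i]mxE eqxx /=; ring.
have perms : ordO 2 (fun z => \sum_(s : 'S_m | s != 1%g)
    (-1) ^+ s * \prod_i (1%:M + N z) i (s i)).
  apply: ordO_sum => s s1; apply: ordOM0l; first exact: ordO_cst.
  have [i si] : exists i, s i != i.
    apply/existsP; rewrite -[[exists i, _]]negbK; apply: contraNN s1 => sN.
    apply/eqP/permP => i; rewrite perm1; apply/eqP.
    by move: sN; rewrite negb_exists => /forallP /(_ i); rewrite negbK.
  have H : ordO 2 (fun z => (1%:M + N z) i (s i) * ((1%:M + N z) (s i) (s (s i)) *
      \prod_(k | (k != i) && (k != s i)) (1%:M + N z) k (s k))).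
    apply: (@ordOM 1 1); first by apply: offdiag; rewrite eq_sym.
    apply: ordOM0r; last by apply: ordO_prod => k _; exact: entryO.
    by apply: offdiag; rewrite (inj_eq perm_inj) eq_sym.
  apply: (ordO_eq _ H); apply: nearW => z.
  by rewrite [RHS](bigD1 i) //= [X in _ = _ * X](bigD1 (s i)).
apply: (ordO_eq _ (ordOD (diag (index_enum 'I_m)) perms)); apply: nearW => z.
rewrite [\det _](bigD1 (1%g : 'S_m)) //= odd_perm1 expr0 mul1r.
under [X in _ = X + _ - _]eq_bigr do rewrite perm1.
by rewrite /mxtrace; ring.
Qed.

(** Here (1 + N)^-1 = 1 - N + O(ell^2) and sqrt (det (1 + N)) = 1 + tr N / 2 + O(ell^2). *)
Lemma dens_expand1 m (a : Z -> R) (S N : Z -> 'M[R]_m) :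
  ordO 0 a -> mxO 1 S -> mxO 1 N ->
  ordO 2 (fun z => dens ((a z ^+ 2)%:M + a z *: S z) (1%:M + N z) -
    (m%:R * a z ^+ 2 + a z * \tr (S z) + (m%:R / 2 - 1) * a z ^+ 2 * \tr (N z))).
Proof.
move=> aO SO NO.
have trN := ordO_tr NO; have trS := ordO_tr SO.
have a2O : ordO 0 (fun z => a z ^+ 2) by exact: (@ordOM 0 0).
have I0 : mxO 0 (fun=> 1%:M : 'M[R]_m) := mxO_cst _.
have NO0 : mxO 0 N := mxOW (leq0n _) NO.
have IN0 := mxOD I0 NO0.
have detO := det1D NO.
have half_gt0 : (0 : R) < 2^-1 by rewrite invr_gt0.
have half : (1 : R) - 2^-1 = 2^-1 by field.
have tr_half : \forall z \near F, 2^-1 <= 1 + \tr (N z) / 2.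
  have := ordO_small half_gt0 (ordOM0r trN (ordO_cst 2^-1)).
  by apply: filterS => z; rewrite ler_norml => /andP[+ _]; lra.
have det_half : \forall z \near F, 2^-1 <= \det (1%:M + N z).
  have H := ordOD (ordOW (isT : (1 <= 2)%N) detO) trN.
  have := ordO_small half_gt0 H.
  by apply: filterS => z; rewrite ler_norml => /andP[+ _]; lra.
pose V z := invmx (1%:M + N z).
have unitN : \forall z \near F, 1%:M + N z \in unitmx.
  apply: filterS det_half => z dz; rewrite unitmxE unitfE gt_eqF //.
  exact: lt_le_trans dz.
have VO : mxO 0 V.
  have H := @mxOZ 0 0 _ _ _ _ (ordO_inv half_gt0 det_half) (mxO_adj IN0).
  apply: mxO_eq H; apply: filterS unitN => z uz.
  by rewrite /V /invmx uz.
(* The error is (1 + N)^-1 N^2. *)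
have VN : mxO 2 (fun z => V z - (1%:M - N z)).
  have H := @mxOM 0 2 _ _ _ _ _ VO (@mxOM 1 1 _ _ _ _ _ NO NO).
  apply: mxO_eq H; apply: filterS unitN => z uz.
  apply: (can_inj (mulKmx uz)).
  rewrite /V !mulmxA mulmxV // mul1mx mulmxBr mulmxV // mulmxBr mulmx1.
  by rewrite mulmxDl mul1mx opprB addrCA opprD addNKr addrC addKr.
pose X z := (a z ^+ 2)%:M + a z *: S z.
have aS1 : mxO 1 (fun z => a z *: S z) by exact: (@mxOZ 0 1).
have X0 : mxO 0 X.
  apply: mxOD; last exact: mxOW aS1.
  have H := @mxOZ 0 0 _ _ _ _ a2O I0.
  by apply: mxO_eq H; apply: nearW => z; rewrite scalemx1.
have trX : ordO 2 (fun z => \tr (X z *m V z) -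
    (m%:R * a z ^+ 2 + a z * \tr (S z) - a z ^+ 2 * \tr (N z))).
  have H := ordOB (ordO_tr (@mxOM 0 2 _ _ _ _ _ X0 VN))
    (ordO_tr (@mxOM 1 1 _ _ _ _ _ aS1 NO)).
  apply: (ordO_eq _ H); apply: nearW => z.
  rewrite mulmxBr raddfB /= -addrA -opprD; congr (_ - _).
  rewrite mulmxBr mulmx1 raddfB /= /X mulmxDl !mxtraceD mxtrace_scalar.
  rewrite mul_scalar_mx !mxtraceZ; ring.
have sqrtO : ordO 2 (fun z => Num.sqrt (\det (1%:M + N z)) - (1 + \tr (N z) / 2)).
  apply: (ordO_sqrt half_gt0 _ tr_half).
    by apply: filterS det_half => z; exact/le_trans/ltW.
  have H := ordOB detO (ordOM0r (@ordOM 1 1 _ _ trN trN) (ordO_cst 4^-1)).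
  apply: (ordO_eq _ H); apply: nearW => z.
  by field; rewrite ?pnatr_eq0.
have Y0 : ordO 0 (fun z => m%:R * a z ^+ 2 + a z * \tr (S z) - a z ^+ 2 * \tr (N z)).
  apply: ordOB; last by exact: (@ordOM 0 0 _ _ a2O (ordOW (leq0n _) trN)).
  apply: ordOD; first exact: (@ordOM 0 0 _ _ (ordO_cst m%:R) a2O).
  exact: (@ordOM 0 0 _ _ aO (ordOW (leq0n _) trS)).
have sq0 : ordO 0 (fun z => Num.sqrt (\det (1%:M + N z))).
  have t0 : ordO 0 (fun z => 1 + \tr (N z) / 2).
    apply: ordOD; first exact: ordO_cst.
    by apply: ordOM0r; [exact: ordOW trN|exact: ordO_cst].
  apply: (ordO_eq _ (ordOD (ordOW (leq0n _) sqrtO) t0)); apply: nearW => z.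
  by rewrite subrK.
have tail : ordO 2 (fun z => (a z * \tr (S z) - a z ^+ 2 * \tr (N z)) *
    (\tr (N z) / 2)).
  apply: (@ordOM 1 1).
    by apply: ordOB; apply: ordOM0l.
  by apply: ordOM0r => //; exact: ordO_cst.
have H := ordOD (ordOM_sub Y0 sq0 trX sqrtO) tail.
apply: (ordO_eq _ H); apply: nearW => z.
rewrite /dens -/(V z) -/(X z).
by field; rewrite ?pnatr_eq0.
Qed.

(** First order expansion of the energy density along r A, where A is a fixed
    frame: [k h] and [k h'] measure the components of the perturbation and of its
    velocity along A. The terms h^T h and h'^T h' are dropped, after which A^T A
    factors out and the Gram matrices become perturbations of the identity. *)
Lemma dens_expand m n (A h h' : Z -> 'M[R]_(n, m)) (r r' : Z -> R) c :
  0 < c -> mxO 0 A -> mxO 1 h -> mxO 1 h' -> ordO 0 r -> ordO 0 r' ->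
  (\forall z \near F, c <= r z) ->
  (\forall z \near F, c <= \det ((A z)^T *m A z)) ->
  (\forall z \near F,
     c <= \det ((r z *: A z + h z)^T *m (r z *: A z + h z))) ->
  let k B z := \tr (invmx ((A z)^T *m A z) *m ((A z)^T *m B z)) in
  ordO 2 (fun z =>
    dens ((r' z *: A z + h' z)^T *m (r' z *: A z + h' z))
         ((r z *: A z + h z)^T *m (r z *: A z + h z)) -
    Num.sqrt (\det ((A z)^T *m A z)) * r z ^+ m *
      (m%:R * r' z ^+ 2 / r z ^+ 2 + 2 * r' z * k h' z / r z ^+ 2 +
       (m%:R - 2) * r' z ^+ 2 * k h z / r z ^+ 3)).
Proof.
move=> c0 AO hO h'O rO r'O rc cg cG k.
pose g z := (A z)^T *m A z.
have gO : mxO 0 g by apply: (@mxOM 0 0) => //; exact: mxOT.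
have g_gt0 : \forall z \near F, 0 < \det (g z).
  by apply: filterS cg => z; exact: lt_le_trans.
have r_gt0 : \forall z \near F, 0 < r z.
  by apply: filterS rc => z; exact: lt_le_trans.
have gu : \forall z \near F, g z \in unitmx.
  by apply: filterS g_gt0 => z gz; rewrite unitmxE unitfE gt_eqF.
pose u z : 'M[R]_m := invmx (g z).
have uO : mxO 0 u.
  have H := @mxOZ 0 0 _ _ _ _ (ordO_inv c0 cg) (mxO_adj gO).
  by apply: mxO_eq H; apply: filterS gu => z uz; rewrite /u /invmx uz.
pose sym (B : Z -> 'M[R]_(n, m)) z : 'M[R]_m := (A z)^T *m B z + (B z)^T *m A z.
have symO B : mxO 1 B -> mxO 1 (sym B).
  move=> BO; apply: mxOD; first by apply: (@mxOM 0 1) => //; exact: mxOT.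
  by apply: (@mxOM 1 0) => //; exact: mxOT.
have lin (a : Z -> R) (B : Z -> 'M[R]_(n, m)) z : (a z *: A z + B z)^T *m (a z *: A z + B z) =
    a z ^+ 2 *: g z + a z *: sym B z + (B z)^T *m B z.
  rewrite [(_ + _)^T]linearD /= [(_ *: _)^T]linearZ /= mulmxDl !mulmxDr -!scalemxAl -!scalemxAr.
  by rewrite scalerA -expr2 scalerDr -!addrA.
have quadO (a : Z -> R) B : ordO 0 a -> mxO 1 B ->
    mxO 0 (fun z => a z ^+ 2 *: g z + a z *: sym B z).
  move=> aO BO; apply: mxOD; last first.
    exact: (@mxOZ 0 0 _ _ _ _ aO (mxOW (leq0n _) (symO _ BO))).
  exact: (@mxOZ 0 0 _ _ _ _ (@ordOM 0 0 _ _ aO aO) gO).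
have BBO (B : Z -> 'M[R]_(n, m)) : mxO 1 B -> mxO 2 (fun z => (B z)^T *m B z).
  by move=> BO; apply: (@mxOM 1 1) => //; exact: mxOT.
have fullO (a : Z -> R) B : ordO 0 a -> mxO 1 B ->
    mxO 0 (fun z => (a z *: A z + B z)^T *m (a z *: A z + B z)).
  move=> aO BO.
  have H := mxOD (quadO _ _ aO BO) (mxOW (leq0n 2) (BBO _ BO)).
  apply: (mxO_eq _ H).
  by apply: nearW => z; rewrite lin.
have subO (a : Z -> R) B : ordO 0 a -> mxO 1 B ->
    mxO 2 (fun z => (a z *: A z + B z)^T *m (a z *: A z + B z) -
      (a z ^+ 2 *: g z + a z *: sym B z)).
  move=> aO BO; apply: (mxO_eq _ (BBO _ BO)).
  by apply: nearW => z; rewrite lin [_ + _ *m _]addrC addrK.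
have c20 : 0 < c / 2 by rewrite divr_gt0.
have cG1 : \forall z \near F, c / 2 <= \det (r z ^+ 2 *: g z + r z *: sym h z).
  have H := ordOW (isT : (1 <= 2)%N)
    (ordO_det_sub (fullO _ _ rO hO) (quadO _ _ rO hO) (subO _ _ rO hO)).
  have Hs := ordO_small c20 H.
  apply: filterS2 Hs cG => z; rewrite ler_norml => /andP[_ +] cz; lra.
have cG2 : \forall z \near F,
    c / 2 <= \det ((r z *: A z + h z)^T *m (r z *: A z + h z)).
  by apply: filterS cG => z; lra.
(* Drop the quadratic terms. *)
have step1 := dens_sub c20 (fullO _ _ r'O h'O) (quadO _ _ r'O h'O)
  (fullO _ _ rO hO) (quadO _ _ rO hO) (subO _ _ r'O h'O) (subO _ _ rO hO) cG2 cG1.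
pose S' z := u z *m sym h' z.
pose N z := (r z)^-1 *: (u z *m sym h z).
have rV : ordO 0 (fun z => (r z)^-1) := ordO_inv c0 rc.
have S'O : mxO 1 S' by apply: (@mxOM 0 1) => //; exact: symO.
have NO : mxO 1 N.
  by apply: (@mxOZ 0 1) => //; apply: (@mxOM 0 1) => //; exact: symO.
have step2 := dens_expand1 r'O S'O NO.
have sqrtg : ordO 0 (fun z => Num.sqrt (\det (g z))).
  have H := @ordOM 0 0 _ _ (ordO_det gO) (ordO_rsqrt c0 cg).
  apply: (ordO_eq _ H); apply: filterS g_gt0 => z gz.
  rewrite -{1}(sqr_sqrtr (ltW gz)) expr2 mulfK //.
  by rewrite gt_eqF // sqrtr_gt0.
have rm : ordO 0 (fun z => r z ^+ m * r z ^- 2).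
  apply: (@ordOM 0 0).
    elim: m {A h h' AO hO h'O cg cG k g gO g_gt0 gu u uO sym symO lin quadO BBO
      fullO subO cG1 cG2 step1 S' N S'O NO step2 sqrtg} => [|m IH].
      exact: ordO_cst.
    by apply: (ordO_eq _ (@ordOM 0 0 _ _ rO IH)); apply: nearW => z; rewrite exprS.
  apply: (ordO_eq _ (@ordOM 0 0 _ _ rV rV)); apply: nearW => z.
  by rewrite -exprVn expr2.
have step3 := ordOM0l (@ordOM 0 0 _ _ sqrtg rm) step2.
have detN : \forall z \near F, 1%:M + N z \in unitmx.
  have half_gt0 : (0 : R) < 2^-1 by rewrite invr_gt0.
  have H := ordOD (ordOW (isT : (1 <= 2)%N) (det1D NO)) (ordO_tr NO).
  have := ordO_small half_gt0 H.
  apply: filterS => z; rewrite ler_norml => /andP[d1 _].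
  rewrite unitmxE unitfE gt_eqF //; move: d1.
  by move: (\det _) (\tr _) => x y; lra.
have tru B z : g z \in unitmx -> \tr (u z *m sym B z) = 2 * k B z.
  move=> gz; rewrite /sym mulmxDr mxtraceD.
  have -> : \tr (u z *m ((B z)^T *m A z)) = k B z.
    rewrite -mxtrace_tr !trmx_mul trmxK /u trmx_inv.
    have -> : (g z)^T = g z by rewrite /g trmx_mul trmxK.
    by rewrite mxtrace_mulC.
  by rewrite -/(k B z); ring.
apply: (ordO_eq _ (ordOD step1 step3)).
near=> z.
have gz : 0 < \det (g z) by near: z.
have uz : g z \in unitmx by near: z.
have rz : 0 < r z by near: z.
have Nz : 1%:M + N z \in unitmx by near: z.
(* Both Gram matrices are multiples of g = A^T A. *)
have GE : r z ^+ 2 *: g z + r z *: sym h z = g z *m (r z ^+ 2 *: (1%:M + N z)).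
  rewrite -scalemxAr mulmxDr mulmx1 [RHS]scalerDr; congr (_ + _).
  rewrite /N -scalemxAr scalerA mulmxA mulmxV // mul1mx; congr (_ *: _).
  by rewrite expr2 mulfK // gt_eqF.
have XE : r' z ^+ 2 *: g z + r' z *: sym h' z =
    g z *m ((r' z ^+ 2)%:M + r' z *: S' z).
  rewrite mulmxDr -scalemxAr /S' mulmxA mulmxV // mul1mx.
  by rewrite mul_mx_scalar.
have ur2 : r z ^+ 2 *: (1%:M + N z) \in unitmx.
  by rewrite unitmxZ // unitfE expf_neq0 // gt_eqF.
rewrite GE XE dens_mul // dens_scale //.
have -> : \tr (N z) = (r z)^-1 * (2 * k h z) by rewrite mxtraceZ tru.
rewrite tru // -/(g z).
move: (dens _ _) (Num.sqrt _) => dd sg.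
move: (dens _ _) => d0; move: (k _ _) (k _ _) (r z ^+ m) => k1 k2 rmz.
field; rewrite gt_eqF //.
Unshelve. all: by end_near. Qed.

End OrderCalculus.

(** * Iterated integrals depending on parameters *)

Lemma pair_continuous (X Y : topologicalType) (x : X) (y : Y) :
  {for y, continuous (fun t : Y => (x, t))}.
Proof.
apply: (@cvg_pair _ _ _ _ (nbhs x) (nbhs y)); first exact: cvg_cst.
exact: cvg_id.
Qed.

Section IntegralOverLine.
Variable R : realType.
Local Notation mu := (@lebesgue_measure R).
Implicit Types (D : set R) (g : R -> R) (B C : R).

Lemma itv_fin (a b : R) b1 b2 : (mu [set` Interval (BSide b1 a) (BSide b2 b)] < +oo)%E.
Proof.
rewrite lebesgue_measure_itv /=; case: ifPn => // _.
by rewrite -EFinB ltry.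
Qed.

Lemma integrable_supported D g B : measurable D -> continuous g ->
  (forall t, B < `|t| -> g t = 0) -> mu.-integrable D (EFin \o g).
Proof.
move=> mD cg g0; apply: (@integrableS _ _ _ mu setT D) => //.
have H : mu.-integrable `[- B, B] (EFin \o g).
  apply: continuous_compact_integrable; first exact: segment_compact.
  exact: continuous_subspaceT.
have : mu.-integrable setT ((EFin \o g) \_ `[- B, B]).
  exact: (integrable_mkcond _ _).1.
congr (mu.-integrable _ _); apply/funext => t; rewrite /patch.
case: ifPn => //; rewrite notin_setE /= in_itv /= => /negP tB.
by rewrite g0 //; move: tB; rewrite -ler_norml -ltNge.
Qed.

Lemma bounded_continuous_integrable (p q : R) g C :
  (forall t, t \in `]p, q[ -> {for t, continuous g}) ->
  (forall t, t \in `]p, q[ -> `|g t| <= C) -> mu.-integrable `]p, q[ (EFin \o g).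
Proof.
move=> cg gC; apply: measurable_bounded_integrable => //; first exact: itv_fin.
  apply: open_continuous_measurable_fun; first exact: interval_open.
  by move=> t /set_mem; exact: cg.
exists C; split; first exact: num_real.
by move=> N CN t It; apply: le_trans (ltW CN); exact: gC.
Qed.

Lemma Rintegral_bound D g B C : 0 <= B -> 0 <= C -> measurable D -> continuous g ->
  (forall t, B < `|t| -> g t = 0) -> (forall t, `|g t| <= C) ->
  `|\int[mu]_(t in D) g t| <= C * (2 * B).
Proof.
move=> B0 C0 mD cg g0 gC.
pose K : set R := [set` `[- B, B]].
have gE : \int[mu]_(t in D) g t = \int[mu]_(t in D `&` K) g t.
  rewrite Rintegral_mkcondr; apply: eq_Rintegral => t _; rewrite /patch.
  case: ifPn => //; rewrite notin_setE /K /= in_itv /= => /negP tB.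
  by rewrite g0 //; move: tB; rewrite -ler_norml -ltNge.
have mK : measurable K by exact: measurable_itv.
have mDB : measurable (D `&` K) by exact: measurableI.
have fin : (mu (D `&` K) < +oo)%E.
  apply: le_lt_trans (itv_fin (- B) B _ _).
  by apply: le_measure; rewrite ?inE //; exact: subIsetr.
rewrite gE; apply: le_trans (le_normr_Rintegral _ _) _ => //.
  exact: integrable_supported cg g0.
apply: (@le_trans _ _ (\int[mu]_(t in D `&` K) C)).
  apply: le_Rintegral => //.
  - have := integrable_supported mDB cg g0; exact: integrable_norm.
  - by apply: measurable_bounded_integrable => //; exact: bounded_cst.
rewrite Rintegral_cst // ler_wpM2l //.
have : (mu (D `&` K) <= mu K)%E.
  by apply: le_measure; rewrite ?inE //; exact: subIsetr.
move=> /fine_le; rewrite !ge0_fin_numE // => /(_ fin (itv_fin _ _ _ _)) /le_trans; apply.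
rewrite lebesgue_measure_itv /= lte_fin; case: ifPn => _ /=.
  by rewrite opprK; lra.
by rewrite mulr_ge0.
Qed.

(** On the compact interval [-B, B] the continuity in the parameter is uniform in t. *)
Lemma Rintegral_param_continuous (X : topologicalType) (U : set X)
    (G : X -> R -> R) D B : open U -> 0 <= B -> measurable D ->
  (forall x t, U x -> {for (x, t), continuous (fun z => G z.1 z.2)}) ->
  (forall x t, U x -> B < `|t| -> G x t = 0) ->
  forall x, U x -> {for x, continuous (fun x => \int[mu]_(t in D) G x t)}.
Proof.
move=> oU B0 mD cG G0 x Ux.
have cGx y : U y -> continuous (G y).
  move=> Uy t.
  apply: (@continuous_comp _ _ _ (fun t => (y, t)) (fun z => G z.1 z.2)).
    exact: pair_continuous.
  exact: cG.
apply/cvgrPdist_le => e e0.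
pose d := e / (2 * B + 1).
have d0 : 0 < d by rewrite divr_gt0 // ltr_wpDl // mulr_ge0.
have unif : \forall x' \near x, `[- B, B] `<=`
    (fun t => `|G x t - G x' t| <= d).
  have /compact_near_coveringP cpt := @segment_compact R (- B) B.
  apply: (cpt _ (nbhs x) (fun x' t => `|G x t - G x' t| <= d)) => t _.
  have d20 : 0 < d / 2 by rewrite divr_gt0.
  have /cvgrPdist_le/(_ _ d20) H := cG x t Ux.
  have /cvgrPdist_le/(_ _ d20) H1 := cGx x Ux t.
  have H2 : \forall t' \near t & x' \near x,
      `|G x t - G x' t'| <= d / 2.
    move: H => [[/= P Q] [Px Qt] PQ].
    by exists (Q, P) => //= -[a b] [/= Qa Pb]; exact: (PQ (b, a)).
  have H1' : \forall t' \near t & x' \near x, `|G x t - G x t'| <= d / 2.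
    exists ([set t' : R | `|G x t - G x t'| <= d / 2], [set: X]) => [|[a b] []] //.
    by split => //; exact: filterT.
  apply: filterS2 H1' H2 => -[t' x'] /= H1t H2t.
  by rewrite (le_trans (ler_distD (G x t) _ _)) // (splitr d) lerD // distrC.
have nearU : \forall x' \near x, U x' by exact: open_nbhs_nbhs.
near=> x'.
have Ux' : U x' by near: x'.
have bnd : forall t, `|t| <= B -> `|G x t - G x' t| <= d.
  move=> t tB; have : `[- B, B] `<=` (fun t => `|G x t - G x' t| <= d).
    by near: x'; exact: unif.
  by apply => /=; rewrite in_itv /= -ler_norml.
rewrite -RintegralB //; last 2 first.
- by apply: (integrable_supported (B := B)) => // [|t]; [exact: cGx|exact: G0].
- by apply: (integrable_supported (B := B)) => // [|t]; [exact: cGx|exact: G0].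
apply: le_trans (Rintegral_bound (B := B) (C := d) _ _ _ _ _ _) _ => //.
- exact: ltW.
- by move=> t; apply: cvgB; exact: cGx.
- by move=> t Bt; rewrite !G0 // subrr.
- move=> t; have [/bnd//|Bt] := leP `|t| B.
  by rewrite !G0 // subrr normr0 ltW.
rewrite /d mulrAC ler_pdivrMr ?ltr_wpDl ?mulr_ge0 // ler_pM2l //.
by rewrite lerDl.
Unshelve. all: by end_near. Qed.

End IntegralOverLine.


Section BoxIntegral.
Variable R : realType.
Local Notation mu := (@lebesgue_measure R).
Implicit Types (B C : R) (k : nat).

(** The iterated integral over a product of one-dimensional sets. The first set
    will be a half-line, which accounts for the boundary of the manifold, while
    the integrand is continuous on the whole space. *)
Fixpoint box_integral (D : nat -> set R) (k : nat) : ('cV[R]_k -> R) -> R :=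
  match k return ('cV[R]_k -> R) -> R with
  | 0%N => fun f => f 0
  | k'.+1 => fun f => \int[mu]_(t in D 0%N)
      box_integral (fun i => D i.+1)
        (fun y : 'cV[R]_k' => f (col_mx (t%:M : 'cV[R]_1) y))
  end.

Definition consv k (t : R) (y : 'cV[R]_k) : 'cV[R]_k.+1 :=
  col_mx (t%:M : 'cV[R]_1) y.

Lemma consv0 k t (y : 'cV[R]_k) : consv t y ord0 ord0 = t.
Proof.
by rewrite /consv mxE; case: splitP => // j _; rewrite (ord1 j) mxE.
Qed.

Lemma consvS k t (y : 'cV[R]_k) i : consv t y (lift ord0 i) ord0 = y i ord0.
Proof.
rewrite /consv mxE; case: splitP => [j|j [/val_inj ->]] //=.
by rewrite (ord1 j).
Qed.

Lemma box_integral0 D k : @box_integral D k (fun=> 0) = 0.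
Proof.
elim: k D => [|k IH] D //=.
under eq_Rintegral do rewrite IH.
by rewrite /Rintegral integral0.
Qed.

Lemma integral_cV0 k : integral_cV (fun _ : 'cV[R]_k => 0) = 0.
Proof.
elim: k => //= k IH; under eq_Rintegral do rewrite IH.
by rewrite /Rintegral integral0.
Qed.

(** Extending by 0 destroys continuity along the boundary of the half-space;
    integrating over a smaller box instead restores it. *)
Lemma integral_cV_indic (D : nat -> set R) k (f : 'cV[R]_k -> R) :
  integral_cV (fun y => if `[< forall i : 'I_k, D i (y i ord0) >] then f y else 0) =
  box_integral D f.
Proof.
elim: k D f => [|k IH] D f /=.
  by case: asboolP => // -[]; case.
rewrite [RHS]Rintegral_mkcond; apply: eq_Rintegral => t _; rewrite /patch.
case: ifPn => [/set_mem D0t|/negP D0t].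
  rewrite -IH; congr integral_cV; apply/funext => y; congr (if _ then _ else _).
  apply/asbool_equiv_eq; split=> [Dy i|Dy i].
    by have := Dy (lift ord0 i); rewrite -/(consv t y) consvS.
  rewrite -/(consv t y); case: (unliftP ord0 i) => [j ->|->].
    by rewrite consvS; exact: Dy.
  by rewrite consv0.
rewrite -[RHS](integral_cV0 k); congr integral_cV.
apply/funext => y; case: asboolP => // Dy.
case: D0t; apply/mem_set; have := Dy ord0.
by rewrite -/(consv t y) consv0.
Qed.

Lemma cvg_cV k (T : Type) (F : set_system T) {FF : Filter F} (h : T -> 'cV[R]_k)
    (l : 'cV[R]_k) :
  (forall i, h z i ord0 @[z --> F] --> l i ord0) -> h @ F --> l.
Proof.
move=> hl; apply/cvgrPdist_le => e e0.
have hle i : \forall z \near F, `|l i ord0 - h z i ord0| <= e.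
  by have /cvgrPdist_le/(_ e e0) := hl i.
apply: filterS (filter_forall _ hle) => z hz.
rewrite [leLHS]/Num.Def.normr/= mx_normrE.
apply: bigmax_le => [|[i j] _ /=]; first exact: ltW.
by rewrite (ord1 j) !mxE.
Qed.

Lemma consv_continuous k : continuous (fun p : R * 'cV[R]_k => consv p.1 p.2).
Proof.
move=> p; apply: (@cvg_cV k.+1 _ (nbhs p)) => i; case: (unliftP ord0 i) => [j ->|->].
  rewrite consvS.
  rewrite (_ : (fun z : R * 'cV[R]_k => _) = (fun z => z.2 j ord0)); last first.
    by apply/funext => z; rewrite consvS.
  apply: (@continuous_comp _ _ _ snd (fun y : 'cV[R]_k => y j ord0)).
    exact: cvg_snd.
  exact: coord_continuous.
rewrite consv0 (_ : (fun z : R * 'cV[R]_k => _) = fst); first exact: cvg_fst.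
by apply/funext => z; rewrite consv0.
Qed.

Definition box_supported k B (f : 'cV[R]_k -> R) : Prop :=
  forall y : 'cV[R]_k, (exists i, B < `|y i ord0|) -> f y = 0.

Lemma box_supported_consv k B (f : 'cV[R]_k.+1 -> R) t : box_supported B f ->
  box_supported B (fun y => f (consv t y)).
Proof. by move=> f0 y [i yi]; apply: f0; exists (lift ord0 i); rewrite consvS. Qed.

Lemma box_supported_out k B (f : 'cV[R]_k.+1 -> R) t D : box_supported B f ->
  B < `|t| -> box_integral D (fun y => f (consv t y)) = 0.
Proof.
move=> f0 Bt; rewrite -(box_integral0 D k); congr box_integral.
by apply/funext => y; apply: f0; exists ord0; rewrite consv0.
Qed.

Lemma cont_consv (X : topologicalType) k (F : X -> 'cV[R]_k.+1 -> R) x t y :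
  {for (x, consv t y), continuous (fun z => F z.1 z.2)} ->
  {for ((x, t), y), continuous
    (fun z : (X * R) * 'cV[R]_k => F z.1.1 (consv z.1.2 z.2))}.
Proof.
move=> cF; pose h (z : (X * R) * 'cV[R]_k) := (z.1.1, consv z.1.2 z.2).
apply: (@continuous_comp _ _ _ h (fun z => F z.1 z.2)); last exact: cF.
apply: (@cvg_pair _ _ _ _ (nbhs x) (nbhs (consv t y))).
  by apply: (@continuous_comp _ _ _ fst fst ((x, t), y)); exact: cvg_fst.
apply: (@continuous_comp _ _ _ (fun z : (X * R) * 'cV[R]_k => (z.1.2, z.2))
  (fun p => consv p.1 p.2) ((x, t), y)); last exact: consv_continuous.
apply: (@cvg_pair _ _ _ _ (nbhs t) (nbhs y)); last exact: cvg_snd.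
by apply: (@continuous_comp _ _ _ fst snd ((x, t), y));
  [exact: cvg_fst|exact: cvg_snd].
Qed.

(** The variable of the outermost integral joins the parameters in the induction. *)
Lemma box_integral_continuous (D : nat -> set R) k (X : topologicalType)
    (U : set X) (F : X -> 'cV[R]_k -> R) B :
  open U -> 0 <= B -> (forall i, measurable (D i)) ->
  (forall x y, U x -> {for (x, y), continuous (fun z => F z.1 z.2)}) ->
  (forall x, U x -> box_supported B (F x)) ->
  forall x, U x -> {for x, continuous (fun x => box_integral D (F x))}.
Proof.
move=> + B0; elim: k D X U F => [|k IH] D X U F oU mD cF F0 x Ux /=.
  apply: (@continuous_comp _ _ _ (fun x => (x, 0 : 'cV[R]_0))
    (fun z => F z.1 z.2) x).
    apply: (@cvg_pair _ _ _ _ (nbhs x) (nbhs (0 : 'cV[R]_0))).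
      exact: cvg_id.
    exact: cvg_cst.
  exact: cF.
pose G x t := box_integral (fun i => D i.+1) (fun y => F x (consv t y)).
apply: (@Rintegral_param_continuous R X U G (D 0%N) B) => //; last first.
  by move=> x' t Ux' Bt; apply: box_supported_out Bt; exact: F0.
move=> x' t Ux'.
apply: (IH (fun i => D i.+1) (X * R)%type (U `*` setT)
  (fun z y => F z.1 (consv z.2 y))) => //.
- rewrite openE => -[a b] [/= Ua _]; exists (U, setT) => //=.
  by split; [exact: open_nbhs_nbhs|exact: filterT].
- by move=> [a b] y [/= Ua _]; apply: cont_consv; exact: cF.
- by move=> [a b] [/= Ua _]; apply: box_supported_consv; exact: F0.
Qed.

Lemma cont_slice (X Y : topologicalType) (Z : topologicalType) (F : X -> Y -> Z) x :
  (forall y, {for (x, y), continuous (fun z => F z.1 z.2)}) -> continuous (F x).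
Proof.
move=> cF y.
apply: (@continuous_comp _ _ _ (fun t => (x, t)) (fun z => F z.1 z.2)).
  exact: pair_continuous.
exact: cF.
Qed.

Lemma box_integral_slice_continuous (D : nat -> set R) k
    (f : 'cV[R]_k.+1 -> R) B :
  0 <= B -> (forall i, measurable (D i)) -> continuous f -> box_supported B f ->
  continuous (fun t => box_integral D (fun y => f (consv t y))).
Proof.
move=> B0 mD cf f0 t.
apply: (@box_integral_continuous D k R setT (fun t y => f (consv t y)) B) => //.
- exact: openT.
- move=> t' y _.
  by apply: (@continuous_comp _ _ _ (fun p : R * 'cV[R]_k => consv p.1 p.2) f);
    [exact: consv_continuous|exact: cf].
- by move=> t' _; exact: box_supported_consv.
Qed.

Lemma consv_cont1 k (f : 'cV[R]_k.+1 -> R) t : continuous f ->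
  continuous (fun y => f (consv t y)).
Proof.
move=> cf; apply: (@cont_slice R _ _ (fun t y => f (consv t y))) => y.
by apply: (@continuous_comp _ _ _ (fun p : R * 'cV[R]_k => consv p.1 p.2) f);
  [exact: consv_continuous|exact: cf].
Qed.

Lemma integrable_slice (D : nat -> set R) k (f : 'cV[R]_k.+1 -> R) B :
  0 <= B -> (forall i, measurable (D i)) -> continuous f -> box_supported B f ->
  mu.-integrable (D 0%N)
    (EFin \o (fun t => box_integral (fun i => D i.+1) (fun y => f (consv t y)))).
Proof.
move=> B0 mD cf f0; apply: (@integrable_supported _ _ _ B) => //.
  exact: box_integral_slice_continuous cf f0.
by move=> t; exact: box_supported_out.
Qed.

Section Linear.
Variable B : R.
Hypothesis B0 : 0 <= B.

Lemma box_integralD (D : nat -> set R) k (f g : 'cV[R]_k -> R) :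
  (forall i, measurable (D i)) -> continuous f -> box_supported B f ->
  continuous g -> box_supported B g ->
  box_integral D (fun y => f y + g y) = box_integral D f + box_integral D g.
Proof.
elim: k D f g => [|k IH] D f g mD cf f0 cg g0 //=.
rewrite -RintegralD //; last 3 first.
- exact: mD.
- exact: integrable_slice cf f0.
- exact: integrable_slice cg g0.
apply: eq_Rintegral => t _; apply: IH => //.
- exact: consv_cont1.
- exact: box_supported_consv.
- exact: consv_cont1.
- exact: box_supported_consv.
Qed.

Lemma box_integralZ (D : nat -> set R) k (c : R) (f : 'cV[R]_k -> R) :
  (forall i, measurable (D i)) -> continuous f -> box_supported B f ->
  box_integral D (fun y => c * f y) = c * box_integral D f.
Proof.
elim: k D f => [|k IH] D f mD cf f0 //=.
rewrite -RintegralZl //; last 2 first.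
- exact: mD.
- exact: integrable_slice cf f0.
apply: eq_Rintegral => t _; apply: IH => //; first exact: consv_cont1.
exact: box_supported_consv.
Qed.

Lemma le_box_integral (D : nat -> set R) k (f g : 'cV[R]_k -> R) :
  (forall i, measurable (D i)) -> continuous f -> box_supported B f ->
  continuous g -> box_supported B g -> (forall y, f y <= g y) ->
  box_integral D f <= box_integral D g.
Proof.
elim: k D f g => [|k IH] D f g mD cf f0 cg g0 fg //=.
apply: le_Rintegral => //.
- exact: mD.
- exact: integrable_slice cf f0.
- exact: integrable_slice cg g0.
move=> t _; apply: IH => //.
- exact: consv_cont1.
- exact: box_supported_consv.
- exact: consv_cont1.
- exact: box_supported_consv.
Qed.

Lemma box_integral_bound (D : nat -> set R) k (f : 'cV[R]_k -> R) C : 0 <= C ->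
  (forall i, measurable (D i)) -> continuous f -> box_supported B f ->
  (forall y, `|f y| <= C) -> `|box_integral D f| <= C * (2 * B) ^+ k.
Proof.
move=> C0; elim: k D f => [|k IH] D f mD cf f0 fC /=; first by rewrite mulr1.
apply: le_trans (Rintegral_bound (B := B) (C := C * (2 * B) ^+ k) _ _ _ _ _ _) _ => //.
- by rewrite mulr_ge0 // exprn_ge0 // mulr_ge0.
- exact: box_integral_slice_continuous cf f0.
- by move=> t; exact: box_supported_out.
- move=> t; apply: IH => //; first exact: consv_cont1.
  exact: box_supported_consv.
- by rewrite -mulrA -exprSr.
Qed.

End Linear.

End BoxIntegral.

(** * Exchanging the time integral with the space integral *)

Section Fubini.
Variable R : realType.
Local Notation mu := (@lebesgue_measure R).
Local Notation RM := (measurableTypeR R).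

(** An open subset of the plane is a countable union of rational boxes. *)
Lemma open_prod_measurable (U : set (R * R)) : open U ->
  measurable (U : set (RM * RM)).
Proof.
move=> oU.
pose box (a b : rat) (n : nat) : set (R * R) :=
  ball (ratr a : R) n.+1%:R^-1 `*` ball (ratr b : R) n.+1%:R^-1.
pose W a b n := if `[< box a b n `<=` U >] then box a b n else set0.
have -> : U = \bigcup_a \bigcup_b \bigcup_n W a b n.
  apply/seteqP; split=> [[x y] Uxy|[x y] [a _ [b _ [n _]]]]; last first.
    by rewrite /W; case: asboolP => // sub /sub.
  have /nbhs_ballP[d /= d0 dU] : nbhs (x, y) U by exact: open_nbhs_nbhs.
  have [n nd] : exists n : nat, n.+1%:R^-1 < d / 2.
    have d20 : 0 < d / 2 by rewrite divr_gt0.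
    exists (Num.truncn (d / 2)^-1); rewrite invf_plt ?posrE //.
    exact: truncnS_gt.
  have n0 : 0 < n.+1%:R^-1 :> R by rewrite invr_gt0.
  have near_rat (u : R) : exists a : rat, ball u n.+1%:R^-1 (ratr a).
    have : ball u n.+1%:R^-1 `&` range ratr !=set0.
      by apply: dense_rat; [exists u; exact: ballxx|exact: ball_open].
    by move=> [/= _ []] /[swap] -[a _ <-]; exists a.
  have [a xa] := near_rat x; have [b yb] := near_rat y.
  exists a => //; exists b => //; exists n => //; rewrite /W.
  case: asboolP => [_|[]]; first by split => /=; exact: ball_sym.
  have tri (u v w : R) : ball u n.+1%:R^-1 v -> ball v n.+1%:R^-1 w -> ball u d w.
    move=> uv vw; have := ball_triangle uv vw; apply: le_ball.
    by rewrite (splitr d) lerD // ltW.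
  by move=> [v w] [/= av bw]; apply: dU; split => /=; [exact: tri av|exact: tri bw].
apply: bigcupT_measurable_rat => a; apply: bigcupT_measurable_rat => b.
apply: bigcupT_measurable => n; rewrite /W; case: asboolP => // _.
by apply: measurableX; apply: open_measurable; exact: ball_open.
Qed.

Variables (p q B C : R) (D : set RM) (G : R -> R -> R).
Hypothesis mD : measurable D.
Hypothesis cG : forall t y, t \in `]p, q[ ->
  {for (t, y), continuous (fun z => G z.1 z.2)}.
Hypothesis G0 : forall t y, t \in `]p, q[ -> B < `|y| -> G t y = 0.
Hypothesis GC : forall t y, t \in `]p, q[ -> `|G t y| <= C.

Let I : set RM := [set` `]p, q[].
Let H (z : RM * RM) : R := G z.1 z.2.

Lemma fubini_measurable : measurable_fun (I `*` setT) H.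
Proof.
apply: (measurability _ (RGenOpens.measurableE R)).
move=> _ [_ [a [b ->] <-]]; apply: open_prod_measurable.
rewrite openE => -[t y] [[/= It _] Ht].
have oI : \forall z \near (t, y), I z.1.
  have : nbhs t I by exact: near_itvoo.
  exact: (@cvg_fst _ _ (nbhs t) (nbhs y) _).
have oH : \forall z \near (t, y), `]a, b[%classic (H z).
  by apply: cG => //; apply: open_nbhs_nbhs; split=> //; exact: interval_open.
by apply: filterS2 oI oH => z Iz Hz.
Qed.

Let f := (EFin \o H) \_ (I `*` D).

(** The integrand is bounded and supported in a rectangle. *)
Lemma fubini_integrable : (mu \x mu)%E.-integrable setT f.
Proof.
pose K : set RM := [set` `[- B, B]].
have mI : measurable I by exact: measurable_itv.
have mK : measurable K by exact: measurable_itv.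
have mDK : measurable (D `&` K) by exact: measurableI.
have mE : measurable (I `*` (D `&` K)) by exact: measurableX.
have fE : f = (EFin \o H) \_ (I `*` (D `&` K)).
  apply/funext => -[t y]; rewrite /f /patch.
  case: ifPn => [/set_mem [/= It Dy]|tyN].
    case: ifPn => // /negP tyN; congr (_%:E); apply: G0 => //=.
    rewrite ltNge; apply/negP => yB; apply: tyN; apply/mem_set; split => //=.
    by split => //; rewrite /K /= in_itv /= -ler_norml.
  case: ifPn => // /set_mem [/= It [Dy _]].
  by move: tyN; rewrite notin_setE => -[].
rewrite fE; apply/(integrable_mkcond _ mE).
apply: measurable_bounded_integrable => //.
- apply: le_lt_trans (_ : (mu \x mu) (I `*` K) < +oo)%E.
    apply: le_measure; rewrite ?inE //; first exact: measurableX.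
    by move=> [t y] [/= It [_ Ky]].
  rewrite product_measure1E //; apply: lte_mul_pinfty => //.
    by rewrite ge0_fin_numE //; exact: itv_fin.
  exact: itv_fin.
- apply: measurable_funS fubini_measurable => //.
    by apply: measurableX.
  by move=> [t y] [].
- exists C; split; first exact: num_real.
  move=> M CM -[t y] [/= It _]; apply: le_trans (ltW CM); exact: GC.
Qed.

Lemma Rintegral_swap :
  \int[mu]_(t in I) \int[mu]_(y in D) G t y =
  \int[mu]_(y in D) \int[mu]_(t in I) G t y.
Proof.
have mI : measurable I by exact: measurable_itv.
have intG t : t \in `]p, q[ -> mu.-integrable D (EFin \o G t).
  move=> It; apply: (@integrable_supported _ _ _ B) => //.
    by apply: (cont_slice (x := t)) => y; exact: cG.
  by move=> y; exact: G0.
have intG' y : mu.-integrable I (EFin \o G^~ y).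
  apply: (@bounded_continuous_integrable _ _ _ _ C) => t It; last exact: GC.
  apply: (@continuous_comp _ _ _ (fun t => (t, y)) (fun z => G z.1 z.2)).
    apply: (@cvg_pair _ _ _ _ (nbhs t) (nbhs y)); first exact: cvg_id.
    exact: cvg_cst.
  exact: cG.
have fub := Fubini fubini_integrable.
have L : (\int[mu]_x \int[mu]_y f (x, y) =
    \int[mu]_(t in I) (\int[mu]_(y in D) G t y)%R%:E)%E.
  rewrite [RHS]integral_mkcond; apply: eq_integral => t _; rewrite /patch.
  case: ifPn => [/set_mem It|tI].
    rewrite /Rintegral fineK; last exact/integrable_fin_num/intG.
    rewrite [RHS]integral_mkcond; apply: eq_integral => y _.
    rewrite /f /patch; congr (if _ then _ else _).
    by rewrite in_setX (mem_set It).
  under eq_integral do rewrite /f /patch in_setX (negbTE tI) /=.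
  by rewrite integral0.
have L' : (\int[mu]_y \int[mu]_x f (x, y) =
    \int[mu]_(y in D) (\int[mu]_(t in I) G t y)%R%:E)%E.
  rewrite [RHS]integral_mkcond; apply: eq_integral => y _; rewrite /patch.
  case: ifPn => [Dy|Dy].
    rewrite /Rintegral fineK; last exact/integrable_fin_num/intG'.
    rewrite [RHS]integral_mkcond; apply: eq_integral => t _.
    by rewrite /f /patch in_setX Dy andbT.
  under eq_integral do rewrite /f /patch in_setX (negbTE Dy) andbF /=.
  by rewrite integral0.
by rewrite {1}/Rintegral -L fub L'.
Qed.

End Fubini.

Lemma box_integral_swap (R : realType) (p q B C : R) k (D : nat -> set R)
    (F : R -> 'cV[R]_k -> R) :
  0 <= B -> 0 <= C -> (forall i, measurable (D i)) ->
  (forall t y, t \in `]p, q[ -> {for (t, y), continuous (fun z => F z.1 z.2)}) ->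
  (forall t, t \in `]p, q[ -> box_supported B (F t)) ->
  (forall t y, t \in `]p, q[ -> `|F t y| <= C) ->
  \int[lebesgue_measure]_(t in `]p, q[) box_integral D (F t) =
  box_integral D (fun y => \int[lebesgue_measure]_(t in `]p, q[) F t y).
Proof.
move=> B0; elim: k D F C => [//|k IH] D F C C0 mD cF F0 FC /=.
pose G t x := box_integral (fun i => D i.+1) (fun y => F t (consv x y)).
have oI : open [set` `]p, q[] by exact: interval_open.
have := @Rintegral_swap R p q B (C * (2 * B) ^+ k) (D 0%N) G (mD 0%N).
rewrite /G => -> //.
- apply: eq_Rintegral => x _.
  apply: (IH _ (fun t y => F t (consv x y)) C) => //.
  + move=> t y It; pose h (z : R * 'cV[R]_k) := (z.1, consv x z.2).
    apply: (@continuous_comp _ _ _ h (fun z => F z.1 z.2)); last exact: cF.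
    apply: (@cvg_pair _ _ _ _ (nbhs t) (nbhs (consv x y))); first exact: cvg_fst.
    apply: (@continuous_comp _ _ _ snd (consv x) (t, y)); first exact: cvg_snd.
    apply: (@cont_slice R 'cV[R]_k 'cV[R]_k.+1 (@consv R k) x) => y'.
    exact: consv_continuous.
  + by move=> t It; apply: box_supported_consv; exact: F0.
  + by move=> t y It; exact: FC.
- move=> t x It.
  apply: (@box_integral_continuous R (fun i => D i.+1) k (R * R)%type
     ([set` `]p, q[] `*` setT) (fun z y => F z.1 (consv z.2 y)) B) => //.
  + rewrite openE => -[a b] [/= Ua _]; exists ([set` `]p, q[], setT) => //=.
    by split; [exact: open_nbhs_nbhs|exact: filterT].
  + by move=> [a b] y [/= Ua _]; apply: cont_consv; exact: cF.
  + by move=> [a b] [/= Ua _]; apply: box_supported_consv; exact: F0.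
- by move=> t x It; apply: box_supported_out; exact: F0.
- move=> t x It; apply: box_integral_bound => //.
  + apply: consv_cont1; apply: (cont_slice (x := t)) => y; exact: cF.
  + by apply: box_supported_consv; exact: F0.
  + by move=> y; exact: FC.
Qed.

(** * Integrals over chart domains *)

(** A locally uniform estimate is uniform on a compact set: the constant is one
    more parameter, which tends to +oo. *)
Lemma compact_uniform_bound (R : realType) (X : topologicalType) (K : set X)
    (I : Type) (F : set_system I) (P : R -> I -> X -> Prop) : Filter F ->
  compact K -> (forall C C' i x, C <= C' -> P C i x -> P C' i x) ->
  (forall x, K x -> exists C, \forall x' \near x & i \near F, P C i x') ->
  exists C, \forall i \near F, forall x, K x -> P C i x.
Proof.
move=> FF /compact_near_coveringP cK monoP locP.
have := cK _ (filter_prod F (pinfty_nbhs R)) (fun ic x => P ic.2 ic.1 x) _.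
have locP' x : K x ->
    \forall x' \near x & ic \near filter_prod F (pinfty_nbhs R), P ic.2 ic.1 x'.
  move=> /locP [C [[/= U V] [xU FV] UV]].
  exists (U, V `*` [set C' | C < C']) => [|[x' [i C']] /= [Ux' [Vi CC']]].
    split=> //=; exists (V, [set C' | C < C']) => //=; split=> //.
    by exists C; split; first exact: num_real.
  by apply: monoP (ltW CC') _; exact: (UV (x', i)).
move=> /(_ _ locP') [[/= V W] [FV [C [_ CW]]] VW].
exists (C + 1); apply: filterS FV => i Vi x Kx.
by apply: (VW (i, C + 1)) => //=; split => //; apply: CW; rewrite ltrDl.
Qed.

Section Fold.
Variables (R : realType) (m : nat).

(** The half-space is a retract of the whole space, which extends continuous
    functions on the half-space to the whole space. *)
Definition fold_half (y : 'cV[R]_m) : 'cV[R]_m :=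
  \col_i (if i == 0%N :> nat then `|y i ord0| else y i ord0).

Lemma fold_halfP y : @half_space R m (fold_half y).
Proof. by move=> i i0; rewrite mxE i0 eqxx normr_ge0. Qed.

Lemma fold_half_id y : @half_space R m y -> fold_half y = y.
Proof.
move=> Hy; apply/matrixP => i j; rewrite (ord1 j) mxE; case: eqP => // i0.
by rewrite ger0_norm // Hy.
Qed.

Lemma fold_half_norm y i : `|fold_half y i ord0| = `|y i ord0|.
Proof. by rewrite mxE; case: ifP => // _; rewrite normr_id. Qed.

Lemma fold_half_continuous : continuous fold_half.
Proof.
move=> y; apply: (@cvg_cV R m _ (nbhs y)) => i; rewrite /fold_half mxE.
have E : (fun z : 'cV[R]_m => (\col_i (if i == 0%N :> nat then `|z i ord0|
    else z i ord0)) i ord0) =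
    (fun z => if i == 0%N :> nat then `|z i ord0| else z i ord0).
  by apply/funext => z; rewrite mxE.
rewrite E; case: ifP => _; last exact: coord_continuous.
apply: cvg_norm; exact: coord_continuous.
Qed.

Definition half_sets (i : nat) : set R := if i is 0%N then [set` `[0, +oo[] else setT.

Lemma half_spaceE y : @half_space R m y <-> forall i : 'I_m, half_sets i (y i ord0).
Proof.
split=> [Hy [[|i] im] //=|Hy i i0].
  by rewrite in_itv /= andbT; exact: Hy.
have := Hy i; rewrite /half_sets; case: (nat_of_ord i) i0 => //= _.
by rewrite in_itv /= andbT.
Qed.

Lemma half_sets_measurable i : measurable (half_sets i).
Proof. by case: i => [|i] /=; [exact: measurable_itv|exact: measurableT]. Qed.

End Fold.

Section ChartIntegral.
Variables (R : realType) (m : nat) (M : manifold R m).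
Hypothesis M_compact : compact [set: M].
Variables (c : chart M) (chi : M -> R).
Hypothesis chi_ge0 : forall x, 0 <= chi x.
Hypothesis chi_le1 : forall x, chi x <= 1.
Hypothesis chi_supp : closure [set x | chi x != 0] `<=` dom c.
Hypothesis chi_smooth : smooth_fun setT chi.

Let D := coord c @` dom c.
Definition supp_image := coord c @` closure [set x | chi x != 0].
Local Notation K := supp_image.

Lemma supp_image_sub : K `<=` D.
Proof. by move=> _ [x /chi_supp cx <-]; exists x. Qed.

Lemma supp_image_compact : compact K.
Proof.
apply: continuous_compact; last first.
  apply: (subclosed_compact (B := setT)) => //; exact: closed_closure.
apply: continuous_in_subspaceT => x /set_mem /chi_supp; exact: Defs.coord_continuous.
Qed.

Lemma supp_image_box : exists2 B, 0 <= B & forall y, K y -> forall i, `|y i ord0| <= B.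
Proof.
have [B [_ BK]] := compact_bounded supp_image_compact.
exists (`|B| + 1); first by rewrite addr_ge0.
move=> y Ky i; have yB : `|y| <= `|B| + 1.
  by apply: BK => //; rewrite (le_lt_trans (ler_norm B)) // ltrDl.
apply: le_trans yB; rewrite [leRHS]/Num.Def.normr/= mx_normrE.
exact: (le_bigmax _ (fun ij : 'I_m * 'I_1 => `|y ij.1 ij.2|) (i, ord0)).
Qed.

Lemma chart_cover y : D y -> dom c (param c y) /\ coord c (param c y) = y.
Proof. by move=> [x cx <-]; rewrite coordK. Qed.

Lemma chi_out y : D y -> ~ K y -> chi (param c y) = 0.
Proof.
move=> Dy Ky; apply/eqP; apply: contra_notT Ky => chiy.
exists (param c y); last by have [] := chart_cover Dy.
exact: subset_closure.
Qed.

(** The integrand of [integral_density] in one chart. *)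
Definition patched (f : 'cV[R]_m -> R) : 'cV[R]_m -> R :=
  patch (fun=> 0) D (fun y => chi (param c y) * f y).

Lemma patched_in f y : D y -> patched f y = chi (param c y) * f y.
Proof. by move=> Dy; rewrite /patched /patch mem_set. Qed.

Lemma patched_out f y : ~ K y -> patched f y = 0.
Proof.
move=> Ky; rewrite /patched /patch; case: ifPn => // /set_mem Dy.
by rewrite chi_out // mul0r.
Qed.

Lemma chart_half y : D y -> @half_space R m y.
Proof.
by have [U _ DE] := coord_image c; rewrite -/D in DE; rewrite DE => -[].
Qed.

(** The domain of a chart is relatively open in the half-space, and folding is the
    identity there. *)
Lemma integral_patched f :
  integral_cV (patched f) = box_integral (@half_sets R) (patched f \o @fold_half R m).
Proof.
rewrite -integral_cV_indic; congr integral_cV; apply/funext => y /=.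
case: asboolP => [/half_spaceE /fold_half_id -> //|/half_spaceE Hy].
rewrite /patched /patch; case: ifPn => // /set_mem Dy.
by case: Hy; exact: chart_half.
Qed.

Section TimeDependent.
Variables (p q : R).

Definition tame (f : R -> 'cV[R]_m -> R) : Prop :=
  (forall t y, t \in `]p, q[ -> D y ->
     (fun z => f z.1 z.2) @ within ([set` `]p, q[] `*` D) (nbhs (t, y)) --> f t y) /\
  (forall t y, t \in `[p, q] -> D y -> exists C, \forall z \near (t, y),
     z.1 \in `]p, q[ -> D z.2 -> `|f z.1 z.2| <= C).

Lemma tame_bound f : tame f -> exists2 C, 0 <= C &
  forall t y, t \in `]p, q[ -> K y -> `|f t y| <= C.
Proof.
move=> [_ fb].
have cptI : compact ([set` `[p, q]] `*` K).
  by apply: compact_setX; [exact: segment_compact|exact: supp_image_compact].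
have [|[t y] [/= It Ky]|C CP] := @compact_uniform_bound R _ _ unit
  (globally setT) (fun C _ z => z.1 \in `]p, q[ -> D z.2 -> `|f z.1 z.2| <= C)
  _ cptI.
- by move=> C C' _ z CC' H zI Dz; apply: le_trans CC'; exact: H.
- have [C Cb] := fb t y It (supp_image_sub Ky); exists C.
  exists ([set z | z.1 \in `]p, q[ -> D z.2 -> `|f z.1 z.2| <= C], setT) => //.
  by move=> [z u] [].
exists `|C| => // t y It Ky; apply: le_trans (ler_norm C).
apply: (CP tt I (t, y)) => //=; last exact: supp_image_sub.
by split => //=; exact: subset_itv_oo_cc.
Qed.

Lemma chi_cont y : D y ->
  chi (param c y') @[y' --> within D (nbhs y)] --> chi (param c y).
Proof.
move=> Dy.
have sm : smooth_on D (fun y => chi (param c y)).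
  by have := @chi_smooth c; rewrite setIT.
exact: (smooth_on_cvg sm Dy).
Qed.

(** Continuity at the frontier of the chart domain inside the half-space holds
    because chi vanishes off a compact subset of the domain. *)
Lemma fold_continuous f t y : tame f -> t \in `]p, q[ ->
  {for (t, y), continuous (fun z => patched (f z.1) (fold_half z.2))}.
Proof.
move=> [fc _] It.
have snd_fold : (fun z : R * 'cV[R]_m => fold_half z.2) @ nbhs (t, y) -->
    fold_half y.
  apply: (@continuous_comp _ _ _ snd (@fold_half R m) (t, y)).
    exact: cvg_snd.
  exact: fold_half_continuous.
have nearI : \forall z \near (t, y), z.1 \in `]p, q[.
  have : \forall u \near t, u \in `]p, q[ by exact: near_itvoo.
  exact: (@cvg_fst _ _ (nbhs t) (nbhs y) _).
have [Dy|Dy] := pselect (D (fold_half y)); last first.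
  have Ky : ~ K (fold_half y) by move=> /supp_image_sub.
  have oK : nbhs (fold_half y) (~` K).
    apply: open_nbhs_nbhs; split => //; apply: closed_openC.
    by apply: compact_closed; [exact: norm_hausdorff|exact: supp_image_compact].
  rewrite /prop_for /continuous_at /= patched_out //.
  apply: cvg_near_cst; near=> z; rewrite patched_out //.
  by near: z; exact: snd_fold _ oK.
have [U oU DE] := coord_image c; rewrite -/D in DE.
have Uy : U (fold_half y) by move: Dy; rewrite DE => -[].
have nearD : \forall z \near (t, y), D (fold_half z.2).
  have nU : nbhs (fold_half y) U by exact: open_nbhs_nbhs.
  have nU' : \forall z \near (t, y), U (fold_half z.2) by exact: snd_fold _ nU.
  apply: filterS nU' => z Uz; rewrite DE; split => //.
  exact: fold_halfP.
rewrite /prop_for /continuous_at /= patched_in //.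
have cv : (fun z => chi (param c (fold_half z.2)) * f z.1 (fold_half z.2))
    @ nbhs (t, y) --> chi (param c (fold_half y)) * f t (fold_half y).
  apply: cvgM.
    have H := chi_cont Dy.
    apply: (@cvg_comp _ _ _ (fun z : R * 'cV[R]_m => fold_half z.2)
      (fun y => chi (param c y)) _ _ _ _ H).
    move=> A /snd_fold HA; apply: filterS2 nearD HA => z Dz; exact.
  have H := fc t _ It Dy.
  apply: (@cvg_comp _ _ _ (fun z : R * 'cV[R]_m => (z.1, fold_half z.2))
    (fun z => f z.1 z.2) _ _ _ _ H).
  have pr : (fun z : R * 'cV[R]_m => (z.1, fold_half z.2)) @ nbhs (t, y) -->
      (t, fold_half y).
    apply: (@cvg_pair _ _ _ _ (nbhs t) (nbhs (fold_half y))) => //.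
    exact: cvg_fst.
  by move=> A /pr HA; near=> z; near: z; apply: filterS3 nearI nearD HA => z ? ?; exact.
apply: cvg_trans cv; apply: near_eq_cvg; near=> z; rewrite patched_in //.
by near: z.
Unshelve. all: by end_near. Qed.

Lemma fold_supported (f : R -> 'cV[R]_m -> R) B t : (forall y, K y -> forall i, `|y i ord0| <= B) ->
  box_supported B (fun y => patched (f t) (fold_half y)).
Proof.
move=> KB y [i yi]; apply: patched_out => /KB /(_ i).
by rewrite fold_half_norm leNgt yi.
Qed.

Lemma fold_bound (f : R -> 'cV[R]_m -> R) C t y : 0 <= C -> t \in `]p, q[ ->
  (forall t y, t \in `]p, q[ -> K y -> `|f t y| <= C) ->
  `|patched (f t) (fold_half y)| <= C.
Proof.
move=> C0 It fC; have [Ky|Ky] := pselect (K (fold_half y)); last first.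
  by rewrite patched_out // normr0.
rewrite patched_in ?normrM; last exact: supp_image_sub.
rewrite -[leRHS]mul1r ler_pM //; last exact: fC.
by rewrite ger0_norm.
Qed.

End TimeDependent.

End ChartIntegral.

(** * Time integrals of densities *)

Section Action.
Variables (R : realType) (m : nat) (M : manifold R m) (P : partition_of_unity M).
Hypothesis M_compact : compact [set: M].
Local Notation mu := (@lebesgue_measure R).
Local Notation I := 'I_(pu_size P).
Local Notation chart_of i := (pu_chart (p := P) i).
Local Notation weight i := (pu_fun (p := P) i).
Local Notation supp i := (supp_image (chart_of i) (weight i)).

Lemma weight_le1 (i : I) x : weight i x <= 1.
Proof.
rewrite -(pu_sum1 P x) (bigD1 i) //= lerDl.
by apply: sumr_ge0 => j _; exact: pu_ge0.
Qed.

Definition space_integral (f : I -> 'cV[R]_m -> R) : R :=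
  \sum_i integral_cV (patched (chart_of i) (weight i) (f i)).

Definition action_integral (p q : R) (f : I -> R -> 'cV[R]_m -> R) : R :=
  \int[mu]_(t in `]p, q[) space_integral (fun i => f i t).

Let box_bound (i : I) : exists2 B, 0 <= B &
  forall y, supp i y -> forall k, `|y k ord0| <= B.
Proof. by apply: supp_image_box => //; exact: pu_support. Qed.

Let B (i : I) : R := sval (cid2 (box_bound i)).

Let B0 i : 0 <= B i. Proof. by rewrite /B; case: cid2. Qed.

Let BP i y : supp i y -> forall k, `|y k ord0| <= B i.
Proof. by rewrite /B; case: cid2 => B' B'0 H; exact: H. Qed.

Definition tame_family p q (f : I -> R -> 'cV[R]_m -> R) : Prop :=
  forall i, tame (chart_of i) p q (f i).

Section Interval.
Variables (p q : R).
Implicit Types (f g : I -> R -> 'cV[R]_m -> R).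

Let F f i t y := patched (chart_of i) (weight i) (f i t) (fold_half y).

Let F_cont f i t y : tame_family p q f -> t \in `]p, q[ ->
  {for (t, y), continuous (fun z => F f i z.1 z.2)}.
Proof.
move=> ft It; apply: fold_continuous => //.
- exact: pu_support.
- exact: pu_smooth.
Qed.

Let F_cont1 f i t : tame_family p q f -> t \in `]p, q[ -> continuous (F f i t).
Proof. by move=> ft It; apply: (cont_slice (x := t)) => y; exact: F_cont. Qed.

Let F_supp f i t : box_supported (B i) (F f i t).
Proof. by apply: fold_supported; exact: BP. Qed.

Let half_meas j : measurable (@half_sets R j).
Proof. exact: half_sets_measurable. Qed.

Lemma space_integralE f t : space_integral (fun i => f i t) =
  \sum_i box_integral (@half_sets R) (F f i t).
Proof. by apply: eq_bigr => i _; rewrite integral_patched. Qed.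

Lemma tame_family_bound f : tame_family p q f -> exists2 C, 0 <= C &
  forall i t y, t \in `]p, q[ -> supp i y -> `|f i t y| <= C.
Proof.
move=> ft.
have /choice [C CP] : forall i, exists C, 0 <= C /\
    forall t y, t \in `]p, q[ -> supp i y -> `|f i t y| <= C.
  move=> i; have [C C0 CP] := tame_bound M_compact (@pu_support _ _ _ P i) (ft i).
  by exists C.
exists (\sum_i C i) => [|i t y It Ky]; first by apply: sumr_ge0 => i _; case: (CP i).
have [_ /(_ t y It Ky) /le_trans] := CP i; apply.
by rewrite (bigD1 i) //= lerDl; apply: sumr_ge0 => j _; case: (CP j).
Qed.

Let A0 := \sum_i (2 * B i) ^+ m.

Let A0_ge0 : 0 <= A0.
Proof. by apply: sumr_ge0 => i _; rewrite exprn_ge0 // mulr_ge0. Qed.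

Lemma space_integral_bound f C t : tame_family p q f -> 0 <= C ->
  (forall i t y, t \in `]p, q[ -> supp i y -> `|f i t y| <= C) ->
  t \in `]p, q[ -> `|space_integral (fun i => f i t)| <= C * A0.
Proof.
move=> ft C0 fC It; rewrite space_integralE.
apply: le_trans (ler_norm_sum _ _ _) _; rewrite mulr_sumr; apply: ler_sum => i _.
apply: (box_integral_bound (B0 i)) => //; first exact: F_cont1.
move=> y; apply: fold_bound It _ => //.
- exact: pu_ge0.
- exact: weight_le1.
- exact: pu_support.
- by move=> t' y'; exact: fC.
Qed.

Lemma space_integral_continuous f : tame_family p q f ->
  {in `]p, q[, continuous (fun t => space_integral (fun i => f i t))}.
Proof.
move=> ft t It.
have -> : (fun t => space_integral (fun i => f i t)) =
    (fun t => \sum_i box_integral (@half_sets R) (F f i t)).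
  by apply/funext => u; exact: space_integralE.
apply: (@cvg_big _ _ +%R) => [|i _]; first exact: add_continuous.
apply: (@box_integral_continuous R (@half_sets R) m R [set` `]p, q[] (F f i) (B i)) => //.
by move=> t' y It'; exact: F_cont.
Qed.

Lemma space_integral_integrable f : tame_family p q f ->
  mu.-integrable `]p, q[ (EFin \o (fun t => space_integral (fun i => f i t))).
Proof.
move=> ft; have [C C0 fC] := tame_family_bound ft.
apply: (@bounded_continuous_integrable _ _ _ _ (C * A0)) => t It.
  exact: space_integral_continuous.
exact: space_integral_bound fC It.
Qed.

Lemma action_integral_bound : p < q -> exists2 A, 0 <= A & forall f C,
  tame_family p q f -> 0 <= C ->
  (forall i t y, t \in `]p, q[ -> supp i y -> `|f i t y| <= C) ->
  `|action_integral p q f| <= C * A.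
Proof.
move=> pq; exists (A0 * (q - p)); first by rewrite mulr_ge0 // subr_ge0 ltW.
move=> f C ft C0 fC.
have int := space_integral_integrable ft.
apply: le_trans (le_normr_Rintegral _ int) _ => //.
apply: (@le_trans _ _ (\int[mu]_(t in `]p, q[) (C * A0))).
  apply: le_Rintegral => //.
  - exact: integrable_norm.
  - apply: measurable_bounded_integrable => //; first exact: itv_fin.
    exact: bounded_cst.
  - by move=> t It; exact: space_integral_bound fC It.
have muE : fine (mu `]p, q[) = q - p.
  by rewrite lebesgue_measure_itv /= lte_fin pq.
rewrite Rintegral_cst // (_ : fine _ = q - p); last exact: muE.
by rewrite mulrA.
Qed.

Lemma tameB (c : chart M) (f g : R -> 'cV[R]_m -> R) : tame c p q f -> tame c p q g ->
  tame c p q (fun t y => f t y - g t y).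
Proof.
move=> [fc fb] [gc gb]; split=> [t y It Dy|t y It Dy].
  by apply: cvgB; [exact: fc|exact: gc].
have [C Cf] := fb t y It Dy; have [C' Cg] := gb t y It Dy.
exists (C + C'); apply: filterS2 Cf Cg => z fz gz zI Dz.
by rewrite (le_trans (ler_normB _ _)) // lerD // ?fz // gz.
Qed.

Lemma tame_familyB f g : tame_family p q f -> tame_family p q g ->
  tame_family p q (fun i t y => f i t y - g i t y).
Proof. by move=> ft gt i; apply: tameB. Qed.

Lemma action_integralB f g : tame_family p q f -> tame_family p q g ->
  action_integral p q (fun i t y => f i t y - g i t y) =
  action_integral p q f - action_integral p q g.
Proof.
move=> ft gt; have fgt := tame_familyB ft gt.
rewrite /action_integral -RintegralB //; last 2 first.
- exact: space_integral_integrable.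
- exact: space_integral_integrable.
apply: eq_Rintegral => t /set_mem It.
rewrite (space_integralE (fun i t y => f i t y - g i t y)) !space_integralE.
apply/eqP; rewrite -subr_eq opprK -big_split /=; apply/eqP/eq_bigr => i _.
have E := box_integralD (B0 i) half_meas (F_cont1 (i := i) fgt It)
  (@F_supp (fun i t y => f i t y - g i t y) i t) (F_cont1 (i := i) gt It)
  (@F_supp g i t).
rewrite -E; congr box_integral; apply/funext => y; rewrite /F /patched /patch.
by case: ifP => _; [rewrite -mulrDr subrK|rewrite addr0].
Qed.

(** By Fubini's theorem, applied in each chart to the folded integrands, which are
    continuous with bounded support, the time integrals can be taken first. *)
Lemma action_integral_swap f : tame_family p q f ->
  (forall i y, supp i y -> \int[mu]_(t in `]p, q[) f i t y = 0) ->
  action_integral p q f = 0.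
Proof.
move=> ft f0; have [C C0 fC] := tame_family_bound ft.
rewrite /action_integral.
under eq_Rintegral do rewrite space_integralE.
have intF i : mu.-integrable `]p, q[
    (EFin \o (fun t => box_integral (@half_sets R) (F f i t))).
  apply: (@bounded_continuous_integrable _ _ _ _ (C * (2 * B i) ^+ m)) => t It.
  - apply: (@box_integral_continuous R (@half_sets R) m R [set` `]p, q[] (F f i) (B i)) => //.
    by move=> t' y It'; exact: F_cont.
  - apply: (box_integral_bound (B0 i)) => //; first exact: F_cont1.
    move=> y; apply: fold_bound It _ => //.
    + exact: pu_ge0.
    + exact: weight_le1.
    + exact: pu_support.
    + by move=> t' y'; exact: fC.
have sumE (r : seq I) :
    mu.-integrable `]p, q[ (EFin \o
      (fun t => \sum_(i <- r) box_integral (@half_sets R) (F f i t))) /\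
    \int[mu]_(t in `]p, q[) (\sum_(i <- r) box_integral (@half_sets R) (F f i t)) =
    \sum_(i <- r) \int[mu]_(t in `]p, q[) box_integral (@half_sets R) (F f i t).
  elim: r => [|i r [IHi IHE]].
    have E0 : (fun t => \sum_(i <- [::]) box_integral (@half_sets R) (F f i t)) =
        (fun=> 0) by apply/funext => t; rewrite big_nil.
    rewrite E0 big_nil; split; first exact: integrable0.
    by rewrite /Rintegral integral0.
  have E : (fun t => \sum_(j <- i :: r) box_integral (@half_sets R) (F f j t)) =
      (fun t => box_integral (@half_sets R) (F f i t) +
         \sum_(j <- r) box_integral (@half_sets R) (F f j t)).
    by apply/funext => t; rewrite big_cons.
  rewrite E big_cons -IHE; split; last exact: RintegralD.
  have := integrableD _ (intF i) IHi; apply; exact: measurable_itv.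
have [_ ->] := sumE (index_enum I); apply: big1 => i _.
rewrite (@box_integral_swap R p q (B i) C) //.
- rewrite -[RHS](box_integral0 (@half_sets R) m); congr box_integral.
  apply/funext => y; rewrite /F /patched.
  have [Ky|Ky] := pselect (supp i (fold_half y)).
    have Dy := supp_image_sub (@pu_support _ _ _ P i) Ky.
    rewrite /patch mem_set //.
    have Hint : mu.-integrable `]p, q[ (EFin \o (f i)^~ (fold_half y)).
      apply: (@bounded_continuous_integrable _ _ _ _ C) => t It; last exact: fC.
      have [+ _] := ft i => /(_ t _ It Dy) H.
      apply: (@cvg_comp _ _ _ (fun t => (t, fold_half y))
        (fun z => f i z.1 z.2) _ _ _ _ H).
      have pc : (fun t => (t, fold_half y)) @ nbhs t --> (t, fold_half y).
        apply: (@cvg_pair _ _ _ _ (nbhs t) (nbhs (fold_half y))).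
          exact: cvg_id.
        exact: cvg_cst.
      by move=> A /pc HA; apply: filterS2 (near_itvoo It) HA => t' It' /(_ (conj It' Dy)).
    by rewrite RintegralZl // f0 // mulr0.
  have H t : patch (fun=> 0) (coord (chart_of i) @` dom (chart_of i))
      (fun y => weight i (param (chart_of i) y) * f i t y) (fold_half y) = 0.
    exact: patched_out.
  under eq_Rintegral do rewrite H.
  by rewrite /Rintegral integral0.
- by move=> t y It; exact: F_cont.
- move=> t y It; apply: fold_bound It _ => //.
  + exact: pu_ge0.
  + exact: weight_le1.
  + exact: pu_support.
  + by move=> t' y'; exact: fC.
Qed.

Lemma space_integralZ f (a : R) t : tame_family p q f -> t \in `]p, q[ ->
  space_integral (fun i y => a * f i t y) = a * space_integral (fun i => f i t).
Proof.
move=> ft It; rewrite space_integralE mulr_sumr; apply: eq_bigr => i _.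
rewrite -(box_integralZ (B0 i)) //; last exact: F_cont1.
rewrite integral_patched; congr box_integral; apply/funext => y.
rewrite /= /F /patched /patch; case: ifP => _; last by rewrite mulr0.
by rewrite mulrCA.
Qed.

(** Used when the total volume is 0, to see that every density has integral 0. *)
Lemma space_integral_dominated f g (C : R) t : tame_family p q f ->
  tame_family p q g -> t \in `]p, q[ ->
  (forall i y, supp i y -> `|f i t y| <= C * g i t y) ->
  `|space_integral (fun i => f i t)| <= C * space_integral (fun i => g i t).
Proof.
move=> ft gt It fg; rewrite !space_integralE.
apply: le_trans (ler_norm_sum _ _ _) _; rewrite mulr_sumr; apply: ler_sum => i _.
have cg : continuous (fun y => C * F g i t y).
  by move=> y; exact: (cvgM (cvg_cst C) (F_cont1 (i := i) gt It (x := y))).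
have sg : box_supported (B i) (fun y => C * F g i t y).
  by move=> y yB; rewrite F_supp // mulr0.
have FG y : `|F f i t y| <= C * F g i t y.
  rewrite /F; have [Ky|Ky] := pselect (supp i (fold_half y)); last first.
    by rewrite !patched_out // normr0 mulr0.
  have Dy := supp_image_sub (@pu_support _ _ _ P i) Ky.
  rewrite !patched_in // normrM mulrCA ger0_norm ?pu_ge0 // ler_wpM2l ?pu_ge0 //.
  exact: fg.
rewrite -(box_integralZ (B0 i)) //; last exact: F_cont1.
rewrite ler_norml; apply/andP; split.
  rewrite lerNl -mulN1r -(box_integralZ (B0 i)) //; last exact: F_cont1.
  apply: (le_box_integral (B0 i)) => //.
  - by move=> y; exact: (cvgM (cvg_cst (-1 : R)) (F_cont1 (i := i) ft It (x := y))).
  - by move=> y yB; rewrite F_supp // mulr0.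
  - by move=> y; rewrite mulN1r; have := FG y; rewrite ler_norml lerNl => /andP[].
apply: (le_box_integral (B0 i)) => //; first exact: F_cont1.
by move=> y; apply: le_trans (FG y); exact: ler_norm.
Qed.

End Interval.

Section Energy.
Variables (n : nat) (p q : R).
Hypothesis pq : p < q.

Definition energy_density (gamma : R -> form_rep n M) (i : I) (t : R)
    (y : 'cV[R]_m) : R :=
  ebin_density (gamma t) (velocity gamma t) (velocity gamma t) (chart_of i)
    (param (chart_of i) y).

(** The end points, where the velocity is not controlled, form a null set. *)
Lemma energyE gamma : tame_family p q (energy_density gamma) ->
  energy P p q gamma = 2^-1 * action_integral p q (energy_density gamma).
Proof.
move=> gt; rewrite /energy; congr (_ * _).
have int := space_integral_integrable gt.
rewrite /action_integral /Rintegral integral_itv_bndoo //.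
exact: (measurable_int mu int).
Qed.

End Energy.

End Action.

Lemma space_integral_eq (R : realType) (m : nat) (M : manifold R m)
    (P : partition_of_unity M) (f g : 'I_(pu_size P) -> 'cV[R]_m -> R) :
  (forall i y, (coord (pu_chart i) @` dom (pu_chart i)) y -> f i y = g i y) ->
  space_integral f = space_integral g.
Proof.
move=> fg; apply: eq_bigr => i _; congr integral_cV; apply/funext => y.
by rewrite /patched /patch; case: ifP => // /set_mem Dy; rewrite fg.
Qed.

(** * Variations up to second order *)

(** The difference quotient of g - f is O(s). This makes it possible to
    differentiate energies without differentiating under an integral. *)
Lemma is_derive_quadratic (R : realType) (f g : R -> R) C :
  (\forall s \near (0 : R), `|g s - f s| <= C * s ^+ 2) ->
  is_derive (0 : R) (1 : R) f 0 -> is_derive (0 : R) (1 : R) g 0.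
Proof.
move=> gf df.
pose h s := g s - f s.
have h0 : h 0 = 0.
  have := nbhs_singleton gf; rewrite expr0n mulr0 => h0.
  by apply/eqP; rewrite -normr_le0.
have cv : (fun s : R => s^-1 *: (h (s *: 1 + 0) - h 0)) @ (0 : R)^' --> (0 : R).
  apply/cvgrPdist_le => e e0.
  have d0 : 0 < e / (`|C| + 1) by rewrite divr_gt0 // ltr_wpDl.
  near=> s.
  have s0 : s != 0 by near: s; exact: nbhs_dnbhs_neq.
  have se : `|s| <= e / (`|C| + 1) by near: s; exact: dnbhs0_le.
  have hs : `|h s| <= C * s ^+ 2 by near: s; exact: nbhs_dnbhs gf.
  have -> : s *: 1 + 0 = s :> R by rewrite addr0; exact: mulr1.
  rewrite h0 subr0 sub0r normrN normrM normfV.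
  rewrite mulrC ler_pdivrMr ?normr_gt0 //.
  apply: le_trans hs _; apply: (@le_trans _ _ ((`|C| + 1) * (`|s| * `|s|))).
    rewrite -normrM -expr2 normrX real_normK ?num_real // ler_wpM2r ?sqr_ge0 //.
    by rewrite (le_trans (ler_norm C)) // lerDl.
  rewrite mulrA ler_wpM2r //.
  have C1 : 0 < `|C| + 1 by rewrite ltr_wpDl.
  by rewrite mulrC -ler_pdivlMr.
have dh : is_derive (0 : R) (1 : R) h 0.
  apply: DeriveDef; first by apply/cvg_ex; exists 0.
  by apply: cvg_lim => //; exact: cv.
have -> : g = f + h by apply/funext => s; rewrite /h /= fctE addrC subrK.
by apply: is_derive_eq; rewrite addr0.
Unshelve. all: by end_near. Qed.

Lemma is_derive_affine (R : realType) (a k : R) :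
  is_derive (0 : R) (1 : R) (fun s => a + s * k) k.
Proof.
have -> : (fun s : R => a + s * k) = cst a + k \*: id.
  by apply/funext => s; rewrite /= mulrC.
by apply: is_derive_eq; rewrite add0r; exact: mulr1.
Qed.

Section Regular.
Variables (R : realType) (m : nat).
Local Notation Z := ((R * R) * 'cV[R]_m)%type.
Variables (e p q : R) (D : set 'cV[R]_m).
Hypothesis e0 : 0 < e.
Local Notation A := (closed_strip e p q D).
Local Notation B := (open_strip e p q D).
Implicit Types (f g : Z -> R).

(** What is required of an integrand: velocities of smooth families are continuous
    at interior times and bounded up to the end points. *)
Definition regular f : Prop :=
  (forall z, B z -> f @ within B (nbhs z) --> f z) /\
  (forall z, A z -> exists C, \forall z' \near z, B z' -> `|f z'| <= C).

Lemma smooth_regular f : smooth_rel A B f -> regular f.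
Proof.
move=> sf; split=> [z Bz|z Az].
  apply: smooth_on_cvg Bz; apply: smooth_relS sf => //.
  exact: open_strip_sub.
have [g [gc fg]] := smooth_rel_near sf Az.
exists (`|g z| + 1).
have : \forall z' \near z, `|g z'| <= `|g z| + 1.
  by apply: (cvgr_le _ (cvg_norm gc)); rewrite ltrDl.
by apply: filterS2 fg => z' fgz' gz' Bz'; rewrite fgz'.
Qed.

Lemma regular_eq f g : (forall z, B z -> f z = g z) -> regular f -> regular g.
Proof.
move=> fg [fc fb]; split=> [z Bz|z Az].
  rewrite -fg // => N /(fc z Bz) HN.
  change (\forall z' \near z, B z' -> N (g z')).
  have HN' : \forall z' \near z, B z' -> N (f z') by exact: HN.
  by apply: filterS HN' => z' H Bz'; rewrite -fg //; exact: H.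
have [C Cb] := fb z Az; exists C.
by apply: filterS Cb => z' H Bz'; rewrite -fg //; exact: H.
Qed.

Lemma regularD f g : regular f -> regular g -> regular (fun z => f z + g z).
Proof.
move=> [fc fb] [gc gb]; split=> [z Bz|z Az].
  by apply: cvgD; [exact: fc|exact: gc].
have [C Cf] := fb z Az; have [C' Cg] := gb z Az.
exists (C + C'); apply: filterS2 Cf Cg => z' fz gz Bz'.
by rewrite (le_trans (ler_normD _ _)) // lerD // ?fz // gz.
Qed.

Lemma regularM f g : regular f -> regular g -> regular (fun z => f z * g z).
Proof.
move=> [fc fb] [gc gb]; split=> [z Bz|z Az].
  by apply: cvgM; [exact: fc|exact: gc].
have [C Cf] := fb z Az; have [C' Cg] := gb z Az.
exists (C * C'); apply: filterS2 Cf Cg => z' fz gz Bz'.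
by rewrite normrM ler_pM // ?fz // gz.
Qed.

Lemma regular_cst (a : R) : regular (fun=> a).
Proof. by apply: smooth_regular; exact: smooth_rel_cst. Qed.

Lemma regularB f g : regular f -> regular g -> regular (fun z => f z - g z).
Proof.
move=> fr gr; apply: (regular_eq _ (regularD fr (regularM (regular_cst (-1)) gr))).
by move=> z _; rewrite mulN1r.
Qed.

Lemma regular_sum (I : Type) (r : seq I) (P : pred I) (F : I -> Z -> R) :
  (forall i, P i -> regular (F i)) -> regular (fun z => \sum_(i <- r | P i) F i z).
Proof.
move=> sF; elim: r => [|i r IH].
  by apply: (regular_eq _ (regular_cst 0)) => x _; rewrite big_nil.
case Pi: (P i); last by apply: (regular_eq _ IH) => x _; rewrite big_cons Pi.
by apply: (regular_eq _ (regularD (sF i Pi) IH)) => x _; rewrite big_cons Pi.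
Qed.

Lemma regular_mulmx l n k (F : Z -> 'M[R]_(l, n)) (G : Z -> 'M[R]_(n, k)) :
  (forall i j, regular (fun z => F z i j)) ->
  (forall i j, regular (fun z => G z i j)) ->
  forall i j, regular (fun z => (F z *m G z) i j).
Proof.
move=> sF sG i j.
have H : regular (fun x => \sum_k (F x i k * G x k j)).
  by apply: regular_sum => k' _; exact: regularM.
by apply: (regular_eq _ H) => x _; rewrite mxE.
Qed.

Lemma regular_tr n (F : Z -> 'M[R]_n) :
  (forall i j, regular (fun z => F z i j)) -> regular (fun z => \tr (F z)).
Proof. by move=> sF; apply: regular_sum. Qed.

Lemma regular_sqrt f : smooth_on A f -> (forall z, A z -> 0 < f z) ->
  regular (fun z => Num.sqrt (f z)).
Proof.
move=> sf f0; split=> [z Bz|z Az].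
  have [/(_ z Bz) fz _] :=
    smooth_regular (smooth_on_rel (@open_strip_sub _ _ _ _ _ _) sf).
  exact: (cvg_comp _ _ fz (@sqrt_continuous R (f z))).
have [_ /(_ z Az) [C Cb]] :=
  smooth_regular (smooth_on_rel (@open_strip_sub _ _ _ _ _ _) sf).
exists (Num.sqrt C); apply: filterS Cb => z' H Bz'.
rewrite ger0_norm ?sqrtr_ge0 //; apply: ler_wsqrtr.
exact: le_trans (ler_norm _) (H Bz').
Qed.

Lemma smooth_on_pos f z : smooth_on A f -> A z -> 0 < f z ->
  exists2 c, 0 < c & \forall z' \near z, A z' -> c <= f z'.
Proof.
move=> sf Az fz0; exists (f z / 2); first by rewrite divr_gt0.
have := smooth_on_cvg sf Az => /cvgr_ge - /(_ (f z / 2)).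
by rewrite ltr_pdivrMr // mulr_natr mulr2n ltrDl => /(_ fz0).
Qed.

Lemma regular_rsqrt f : smooth_on A f -> (forall z, A z -> 0 < f z) ->
  regular (fun z => (Num.sqrt (f z))^-1).
Proof.
move=> sf f0; split=> [z Bz|z Az].
  apply: cvgV; first by rewrite gt_eqF // sqrtr_gt0 f0 //; exact: open_strip_sub.
  by have [+ _] := regular_sqrt sf f0; apply.
have [c c0 fc] := smooth_on_pos sf Az (f0 z Az).
exists (Num.sqrt c)^-1; apply: filterS fc => z' H /open_strip_sub/H cf.
have fz := lt_le_trans c0 cf.
rewrite gtr0_norm ?invr_gt0 ?sqrtr_gt0 // lef_pV2 ?posrE ?sqrtr_gt0 //.
exact: ler_wsqrtr.
Qed.

Lemma regular_dens k (X G : Z -> 'M[R]_k) :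
  (forall i j, regular (fun z => X z i j)) ->
  (forall i j, smooth_on A (fun z => G z i j)) ->
  (forall z, A z -> 0 < \det (G z)) ->
  regular (fun z => dens (X z) (G z)).
Proof.
move=> rX sG dG.
have sub := @open_strip_sub R m e p q D.
have radj i j : regular (fun z => \adj (G z) i j).
  by apply: smooth_regular; apply: (smooth_on_rel sub); exact: smooth_rel_adj.
have rt := regular_tr (regular_mulmx rX radj).
have rs := regular_rsqrt (smooth_rel_det sG) dG.
apply: (regular_eq _ (regularM rt rs)) => z /sub Az.
by rewrite dens_adj // dG.
Qed.

End Regular.

Section Slices.
Variables (R : realType) (m : nat) (M : manifold R m) (c : chart M).
Variables (e p q : R).
Local Notation D := (coord c @` dom c).

Lemma regular_tame (f : (R * R) * 'cV[R]_m -> R) s : s \in `]- e, e[ ->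
  regular e p q D f -> tame c p q (fun t y => f ((s, t), y)).
Proof.
move=> se [fc fb].
pose h (z : R * 'cV[R]_m) : (R * R) * 'cV[R]_m := ((s, z.1), z.2).
have hc z : h @ nbhs z --> h z.
  apply: (@cvg_pair _ _ _ _ (nbhs (s, z.1)) (nbhs z.2)); last exact: cvg_snd.
  apply: (@cvg_pair _ _ _ _ (nbhs s) (nbhs z.1)); first exact: cvg_cst.
  exact: cvg_fst.
split=> [t y It Dy|t y It Dy].
  have Bz : open_strip e p q D ((s, t), y) by split.
  move=> N /(fc _ Bz) HN.
  have HN' : \forall z' \near h (t, y), open_strip e p q D z' -> N (f z').
    exact: HN.
  have HN2 : \forall z \near (t, y), open_strip e p q D (h z) -> N (f (h z)).
    exact: hc (t, y) _ HN'.
  change (\forall z \near (t, y), ([set` `]p, q[] `*` D) z -> N (f (h z))).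
  by apply: filterS HN2 => z H [Iz Dz]; apply: H; split.
have Az : closed_strip e p q D ((s, t), y) by split.
have [C Cb] := fb _ Az; exists C.
have Cb2 : \forall z \near (t, y), open_strip e p q D (h z) -> `|f (h z)| <= C.
  exact: hc (t, y) _ Cb.
by apply: filterS Cb2 => z H Iz Dz; apply: H; split.
Qed.

End Slices.

Section StripFilter.
Variables (R : realType) (m : nat) (e p q : R) (D : set 'cV[R]_m).
Local Notation Z := ((R * R) * 'cV[R]_m)%type.

Definition strip_filter (t : R) (y : 'cV[R]_m) : set_system Z :=
  within (open_strip e p q D) (nbhs ((0, t), y)).

Global Instance strip_filter_filter t y : Filter (strip_filter t y).
Proof. exact: within_filter. Qed.

Lemma strip_near t y (Q : Z -> Prop) : (forall z, open_strip e p q D z -> Q z) ->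
  \forall z \near strip_filter t y, Q z.
Proof.
move=> H; have H' : \forall z \near ((0 : R, t), y), open_strip e p q D z -> Q z.
  by apply: filterE => z; exact: H.
exact: H'.
Qed.

Definition sparam (z : Z) : R := z.1.1.

Lemma sparam_cvg t y : sparam @ strip_filter t y --> (0 : R).
Proof.
apply: cvg_within_filter.
apply: (@continuous_comp _ _ _ fst fst ((0, t), y)); exact: cvg_fst.
Qed.

End StripFilter.

Section SecondOrder.
Variables (R : realType) (m : nat) (M : manifold R m) (P : partition_of_unity M).
Hypothesis M_compact : compact [set: M].
Variables (e p q : R).
Hypothesis e0 : 0 < e.
Hypothesis pq : p < q.
Local Notation I := 'I_(pu_size P).
Local Notation chart_of i := (pu_chart (p := P) i).
Local Notation D i := (coord (chart_of i) @` dom (chart_of i)).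
Local Notation Z := ((R * R) * 'cV[R]_m)%type.

(** Pointwise second order estimates are uniform on the compact supports of the
    partition of unity, hence can be integrated. *)
Lemma action_integral_quadratic (f : I -> Z -> R) :
  (forall i, regular e p q (D i) (f i)) ->
  (forall i t y, t \in `[p, q] -> D i y ->
     ordO (strip_filter e p q (D i) t y) (@sparam R m) 2 (f i)) ->
  exists C, \forall s \near (0 : R),
    `|action_integral p q (fun i t y => f i ((s, t), y))| <= C * s ^+ 2.
Proof.
move=> fr fO.
have [A A0 AP] := @action_integral_bound R m M P M_compact p q pq.
pose Q (C : R) i (s : R) := forall z,
    ([set` `[p, q]] `*` supp_image (chart_of i) (pu_fun (p := P) i)) z ->
    s \in `]- e, e[ -> z.1 \in `]p, q[ -> D i z.2 ->
      `|f i ((s, z.1), z.2)| <= C * s ^+ 2.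
have unif i : exists C, \forall s \near (0 : R), Q C i s.
  apply: (@compact_uniform_bound R _ _ _ (nbhs (0 : R)) (fun C s z =>
    s \in `]- e, e[ -> z.1 \in `]p, q[ -> D i z.2 ->
      `|f i ((s, z.1), z.2)| <= C * s ^+ 2)).
  - apply: compact_setX; first exact: segment_compact.
    by apply: supp_image_compact => //; exact: pu_support.
  - move=> C C' s z CC' H se zI Dz; apply: le_trans (H se zI Dz) _.
    by rewrite ler_wpM2r // sqr_ge0.
  - move=> [t y] [/= It Ky].
    have [C Cb] := fO i t y It (supp_image_sub (@pu_support _ _ _ P i) Ky).
    exists C.
    have hc : (fun w : (R * 'cV[R]_m) * R => ((w.2, w.1.1), w.1.2)) @
        nbhs ((t, y), (0 : R)) --> ((0, t), y).
      apply: (@cvg_pair _ _ _ _ (nbhs (0, t)) (nbhs y)).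
        apply: (@cvg_pair _ _ _ _ (nbhs (0 : R)) (nbhs t)); first exact: cvg_snd.
        by apply: (@continuous_comp _ _ _ fst fst ((t, y), 0)); exact: cvg_fst.
      apply: (@continuous_comp _ _ _ fst snd ((t, y), 0)); first exact: cvg_fst.
      exact: cvg_snd.
    have Cb' : \forall z \near ((0, t), y), open_strip e p q (D i) z ->
        `|f i z| <= C * `|sparam z| ^+ 2 by exact: Cb.
    have Cb2 : \forall w \near ((t, y), (0 : R)),
        open_strip e p q (D i) ((w.2, w.1.1), w.1.2) ->
        `|f i ((w.2, w.1.1), w.1.2)| <= C * `|w.2| ^+ 2 by exact: hc _ Cb'.
    apply: filterS Cb2 => -[z s] H se zI Dz.
    have := H (conj (conj se zI) Dz).
    by rewrite /= real_normK ?num_real.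
have /choice [C CP] := unif.
exists ((\sum_i `|C i|) * A).
have all_near : \forall s \near (0 : R), forall i, Q (C i) i s.
  exact: (filter_forall _ CP).
apply: filterS2 all_near (near_itvoo (zero_in_itv e0)) => s H se.
rewrite mulrAC; apply: AP.
- by move=> i; apply: regular_tame se (fr i).
- by rewrite mulr_ge0 ?sqr_ge0 // sumr_ge0.
- move=> i t y It Ky.
  have Dy := supp_image_sub (@pu_support _ _ _ P i) Ky.
  have := H i (t, y) (conj (subset_itv_oo_cc It) Ky) se It Dy.
  move=> /le_trans; apply; rewrite ler_wpM2r ?sqr_ge0 //.
  rewrite (le_trans (ler_norm _)) // (bigD1 i) //= lerDl.
  exact: sumr_ge0.
Qed.

End SecondOrder.

(** * Gram matrices *)

Section Gram.
Variable R : realType.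

Lemma sqr_cV_ge0 m (v : 'cV[R]_m) : 0 <= (v^T *m v) ord0 ord0.
Proof. by rewrite mxE; apply: sumr_ge0 => i _; rewrite mxE -expr2 sqr_ge0. Qed.

Lemma sqr_cV_eq0 m (v : 'cV[R]_m) : (v^T *m v) ord0 ord0 = 0 -> v = 0.
Proof.
rewrite mxE => /eqP; rewrite psumr_eq0 => [/allP v0|i _]; last first.
  by rewrite mxE -expr2 sqr_ge0.
apply/matrixP => i j; rewrite (ord1 j) mxE; apply/eqP.
have := v0 i; rewrite mem_index_enum => /(_ isT).
by rewrite mxE -expr2 sqrf_eq0.
Qed.

Lemma unitmx_cV m (G : 'M[R]_m) : (forall v : 'cV[R]_m, G *m v = 0 -> v = 0) ->
  G \in unitmx.
Proof.
move=> G0; rewrite -unitmx_tr -row_free_unit -kermx_eq0.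
apply/eqP/row_matrixP => i; rewrite row0.
have : row i (kermx G^T) *m G^T = 0 by rewrite -row_mul mulmx_ker row0.
move=> /(congr1 trmx); rewrite trmx_mul trmxK trmx0 => /G0 /(congr1 trmx).
by rewrite trmxK trmx0.
Qed.

Lemma injective_cV m n (A : 'M[R]_(n, m)) :
  injective (fun v : 'cV[R]_m => A *m v) <-> forall v : 'cV[R]_m, A *m v = 0 -> v = 0.
Proof.
split=> [Ai v Av|A0 v w /= Avw]; first by apply: Ai; rewrite /= Av mulmx0.
by apply/eqP; rewrite -subr_eq0; apply/eqP/A0; rewrite mulmxBr Avw subrr.
Qed.

Lemma gram_form m n (A : 'M[R]_(n, m)) (v : 'cV[R]_m) :
  v^T *m (A^T *m A) *m v = (A *m v)^T *m (A *m v).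
Proof. by rewrite trmx_mul !mulmxA. Qed.

(** The Gram matrix is joined to the identity by invertible matrices. *)
Lemma gram_det_gt0 m n (A : 'M[R]_(n, m)) :
  injective (fun v : 'cV[R]_m => A *m v) -> 0 < \det (A^T *m A).
Proof.
move=> /injective_cV A0; set G := A^T *m A.
pose L (t : R) : 'M[R]_m := t *: G + (1 - t) *: 1%:M.
have L_unit t : 0 <= t <= 1 -> \det (L t) != 0.
  move=> /andP[t0 t1]; rewrite -unitfE -unitmxE; apply: unitmx_cV => v Lv.
  have Q : t * ((A *m v)^T *m (A *m v)) ord0 ord0 +
      (1 - t) * (v^T *m v) ord0 ord0 = 0.
    have : (v^T *m (L t *m v)) ord0 ord0 = 0 by rewrite Lv mulmx0 mxE.
    rewrite mulmxDl mulmxDr -!scalemxAl mul1mx -!scalemxAr -gram_form !mulmxA.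
    by rewrite mxE [X in X + _]mxE [X in _ + X]mxE.
  have Q1 : t * ((A *m v)^T *m (A *m v)) ord0 ord0 >= 0.
    by rewrite mulr_ge0 // sqr_cV_ge0.
  have Q2 : (1 - t) * (v^T *m v) ord0 ord0 >= 0.
    by rewrite mulr_ge0 ?subr_ge0 // sqr_cV_ge0.
  have Q10 : t * ((A *m v)^T *m (A *m v)) ord0 ord0 = 0 by lra.
  have Q20 : (1 - t) * (v^T *m v) ord0 ord0 = 0 by lra.
  have [tE|tN] := eqVneq t 1.
    by apply: A0; apply: sqr_cV_eq0; move: Q10; rewrite tE mul1r.
  apply: sqr_cV_eq0; move/eqP: Q20; rewrite mulf_eq0 subr_eq0 eq_sym (negbTE tN).
  by move=> /eqP.
have L_smooth : smooth_on setT (fun t => \det (L t)).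
  apply: smooth_rel_det => i j.
  have idS : smooth_on setT (fun t : R => t).
    by apply: smooth_rel_linear => // t; exact: cvg_id.
  have H : smooth_on setT (fun t : R => t * G i j + (1 - t) * (1%:M : 'M[R]_m) i j).
    apply: smooth_relD; apply: smooth_relM; try exact: smooth_rel_cst.
      exact: idS.
    by apply: smooth_relB => //; exact: smooth_rel_cst.
  by apply: (smooth_rel_eq _ H) => t _; rewrite !mxE.
have L_cont : continuous (fun t => \det (L t)).
  move=> t N /(smooth_on_cvg L_smooth (x := t) Logic.I) HN.
  have HN' : \forall t' \near t, setT t' -> N (\det (L t')) by exact: HN.
  by apply: filterS HN' => t'; exact.
have L0 : \det (L 0) = 1 by rewrite /L scale0r add0r subr0 scale1r det1.
have L1 : L 1 = G by rewrite /L scale1r subrr scale0r addr0.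
rewrite -L1 ltNge; apply/negP => L1_le0.
have [||t t01 Lt0] := @IVT R (fun t => \det (L t)) 0 1 0 ler01.
- exact: continuous_subspaceT.
- by rewrite L0 ge_min le_max ler01 L1_le0 orbT.
by have := L_unit t; rewrite Lt0 eqxx => /(_ _)/negP; apply; move: t01; rewrite in_itv.
Qed.

Lemma gram_unit m n (A : 'M[R]_(n, m)) :
  injective (fun v : 'cV[R]_m => A *m v) -> A^T *m A \in unitmx.
Proof. by move=> /gram_det_gt0 d; rewrite unitmxE unitfE gt_eqF. Qed.

Lemma det_gram_inj m n (A : 'M[R]_(n, m)) : \det (A^T *m A) != 0 ->
  injective (fun v : 'cV[R]_m => A *m v).
Proof.
rewrite -unitfE -unitmxE => u; apply/injective_cV => v Av.
by apply: (can_inj (mulKmx u)); rewrite mulmx0 -mulmxA Av mulmx0.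
Qed.

End Gram.

(** * Energy densities along variations *)

Lemma derive1_mulmx (R : realType) k n m (Q : 'M[R]_(k, n)) (F : R -> 'M[R]_(n, m)) t :
  (forall i j, derivable (fun u => F u i j) t 1) -> forall i j,
  derive1 (fun u => (Q *m F u) i j) t =
  (Q *m \matrix_(i, j) derive1 (fun u => F u i j) t) i j.
Proof.
move=> dF i j; rewrite derive1E mxE.
have -> : (fun u => (Q *m F u) i j) = \sum_l (cst (Q i l) * (fun u => F u l j)).
  by apply/funext => u; rewrite mxE fct_sumE.
rewrite derive_sum => [|l]; last first.
  exact: (derivableM (derivable_cst (Q i l) t 1) (dF l j)).
apply: eq_bigr => l _; rewrite mxE derive1E.
rewrite (deriveM (derivable_cst (Q i l) t 1) (dF l j)).
by rewrite derive_cst scaler0 addr0.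
Qed.

Section Vanishing.
Variables (R : realType) (m : nat) (e p q : R) (D : set 'cV[R]_m).
Local Notation Z := ((R * R) * 'cV[R]_m)%type.
Hypothesis e0 : 0 < e.
Local Notation A := (closed_strip e p q D).
Local Notation B := (open_strip e p q D).

Local Notation F := (strip_filter e p q D).

Lemma ordO_rel (f : Z -> R) t0 y0 : smooth_rel A B f ->
  (forall t y, t \in `]p, q[ -> D y -> f ((0, t), y) = 0) ->
  t0 \in `[p, q] -> D y0 -> ordO (F t0 y0) (@sparam R m) 1 f.
Proof.
move=> sf f0 It Dy; have [C Cb] := smooth_rel_lipschitz e0 sf It Dy.
exists C; have Cb' : \forall z \near ((0 : R, t0), y0), B z ->
    `|f z| <= C * `|z.1.1|.
  apply: filterS Cb => z H Bz; have := H Bz.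
  by case: Bz => -[_ Iz] Dz; rewrite f0 // subr0.
by apply: filterS Cb' => z; rewrite expr1.
Qed.

Lemma tderiv_vanish (f : Z -> R) t y :
  (forall t y, t \in `]p, q[ -> D y -> f ((0, t), y) = 0) ->
  t \in `]p, q[ -> D y -> tderiv f ((0, t), y) = 0.
Proof.
move=> f0 It Dy; rewrite /tderiv derive1E /=.
rewrite (@near_eq_derive _ _ _ _ (fun=> 0)) ?derive_cst //.
by apply: filterS (near_itvoo It) => u Iu; exact: f0.
Qed.

Lemma ordO0_rel (f : Z -> R) t0 y0 : regular e p q D f ->
  t0 \in `[p, q] -> D y0 -> ordO (F t0 y0) (@sparam R m) 0 f.
Proof.
move=> [_ fb] It Dy.
have Az : A ((0, t0), y0) by split => //; split => //=; exact: zero_in_itv.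
have [C Cb] := fb _ Az; exists C.
have Cb' : \forall z \near ((0 : R, t0), y0), B z -> `|f z| <= C * `|sparam z| ^+ 0.
  by apply: filterS Cb => z; rewrite expr0 mulr1.
exact: Cb'.
Qed.

Lemma near_pos (f : Z -> R) t0 y0 : smooth_on A f -> (forall z, A z -> 0 < f z) ->
  t0 \in `[p, q] -> D y0 -> exists2 c, 0 < c & \forall z \near F t0 y0, c <= f z.
Proof.
move=> sf f0 It Dy.
have Az : A ((0, t0), y0) by split => //; split => //=; exact: zero_in_itv.
have [c c0 H] := smooth_on_pos sf Az (f0 _ Az); exists c => //.
have H' : \forall z \near ((0 : R, t0), y0), B z -> c <= f z.
  by apply: filterS H => z Hz /open_strip_sub; exact: Hz.
exact: H'.
Qed.

End Vanishing.

Section Variation.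
Variables (R : realType) (m n : nat) (M : manifold R m).
Variables (e p q : R).
Local Notation Z := ((R * R) * 'cV[R]_m)%type.
Local Notation D c := (coord c @` dom c).

Definition family_mx (b : R -> R -> form_rep n M) (c : chart M) (z : Z) : 'M[R]_(n, m) :=
  b z.1.1 z.1.2 c (param c z.2).

Definition velocity_mx (b : R -> R -> form_rep n M) (c : chart M) (z : Z) :
    'M[R]_(n, m) :=
  velocity (b z.1.1) z.1.2 c (param c z.2).

Definition gram_density b c z : R :=
  dens ((velocity_mx b c z)^T *m velocity_mx b c z)
       ((family_mx b c z)^T *m family_mx b c z).

Lemma ebin_densityE b c z :
  ebin_density (b z.1.1 z.1.2) (velocity (b z.1.1) z.1.2) (velocity (b z.1.1) z.1.2)
    c (param c z.2) = gram_density b c z.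
Proof.
rewrite /ebin_density /gram_density /dens; congr (_ * _).
by rewrite mxtrace_mulC mulmxA.
Qed.

Lemma velocity_mxE b c z i j :
  velocity_mx b c z i j = tderiv (fun z => family_mx b c z i j) z.
Proof. by rewrite mxE. Qed.

Variable b : R -> R -> form_rep n M.
Hypothesis b_smooth : smooth_family (`]- e, e[ `*` `[p, q] : set (R * R))
  (fun st => b st.1 st.2).

Lemma family_mx_smooth c i j :
  smooth_on (closed_strip e p q (D c)) (fun z => family_mx b c z i j).
Proof. exact: b_smooth. Qed.

Lemma velocity_mx_smooth c i j :
  smooth_rel (closed_strip e p q (D c)) (open_strip e p q (D c))
    (fun z => velocity_mx b c z i j).
Proof.
apply: (smooth_rel_eq _ (smooth_rel_tderiv (@family_mx_smooth c i j))) => z _.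
by rewrite velocity_mxE.
Qed.

Lemma family_mx_derivable c z i j : open_strip e p q (D c) z ->
  derivable (fun u => family_mx b c ((z.1.1, u), z.2) i j) z.1.2 1.
Proof. by move=> Bz; exact: (smooth_on_derivable (@family_mx_smooth c i j) Bz). Qed.

Lemma gram_smooth c i j : smooth_on (closed_strip e p q (D c))
  (fun z => ((family_mx b c z)^T *m family_mx b c z) i j).
Proof.
apply: smooth_rel_mulmx => k l; last exact: family_mx_smooth.
by apply: smooth_rel_trmx => k' l'; exact: family_mx_smooth.
Qed.

Hypothesis b_inj : forall s t, s \in `]- e, e[ -> t \in `[p, q] ->
  Omega1_plus (b s t).

Lemma gram_pos c z : closed_strip e p q (D c) z ->
  0 < \det ((family_mx b c z)^T *m family_mx b c z).
Proof.
move=> [[/= se It] Dy]; apply: gram_det_gt0.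
have [_] := b_inj se It; apply.
by have [] := chart_cover Dy.
Qed.

Lemma gram_density_regular c : regular e p q (D c) (gram_density b c).
Proof.
have vr i j : regular e p q (D c) (fun z => velocity_mx b c z i j).
  by apply: smooth_regular; exact: velocity_mx_smooth.
apply: regular_dens; [|exact: gram_smooth|exact: gram_pos].
apply: regular_mulmx => // i j.
by apply: (regular_eq _ (vr j i)) => z _; rewrite [RHS]mxE.
Qed.

Variable P : partition_of_unity M.
Hypothesis M_compact : compact [set: M].

Lemma energy_variation s : s \in `]- e, e[ ->
  energy P p q (b s) = 2^-1 * action_integral p q
    (fun i t y => gram_density b (pu_chart (p := P) i) ((s, t), y)).
Proof.
move=> se.
have E : (fun (i : 'I_(pu_size P)) t y => gram_density b (pu_chart (p := P) i) ((s, t), y))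
    = energy_density (P := P) (b s).
  apply/funext => i; apply/funext => t; apply/funext => y.
  by rewrite -ebin_densityE.
rewrite E energyE // -E => i.
by apply: regular_tame se _; exact: gram_density_regular.
Qed.

End Variation.

(** * Orthogonal projections and fibers of the Gauss map *)

Section Projection.
Variable R : realType.

Definition ortho_proj m n (A : 'M[R]_(n, m)) : 'M[R]_n :=
  A *m invmx (A^T *m A) *m A^T.

Lemma ortho_proj_tr m n (A : 'M[R]_(n, m)) : (ortho_proj A)^T = ortho_proj A.
Proof.
rewrite /ortho_proj !trmx_mul trmxK trmx_inv trmx_mul trmxK.
by rewrite mulmxA.
Qed.

Lemma ortho_projK m n (A : 'M[R]_(n, m)) :
  injective (fun v : 'cV[R]_m => A *m v) -> ortho_proj A *m A = A.
Proof.
by move=> /gram_unit u; rewrite /ortho_proj -!mulmxA mulVmx // mulmx1.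
Qed.

Lemma ortho_proj_idem m n (A : 'M[R]_(n, m)) :
  injective (fun v : 'cV[R]_m => A *m v) ->
  ortho_proj A *m ortho_proj A = ortho_proj A.
Proof.
by move=> Ai; rewrite {2}/ortho_proj !mulmxA ortho_projK.
Qed.

Lemma ortho_proj_mul m n (A : 'M[R]_(n, m)) (J : 'M[R]_m) :
  injective (fun v : 'cV[R]_m => A *m v) -> J \in unitmx ->
  ortho_proj (A *m J) = ortho_proj A.
Proof.
move=> /gram_unit u uJ; rewrite /ortho_proj trmx_mul.
have uJT : J^T \in unitmx by rewrite unitmx_tr.
have -> : invmx (J^T *m A^T *m (A *m J)) =
    invmx J *m invmx (A^T *m A) *m invmx J^T.
  have uP : J^T *m A^T *m (A *m J) \in unitmx.
    by rewrite !mulmxA unitmx_mul uJ andbT -mulmxA unitmx_mul uJT.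
  apply: (can_inj (mulKmx uP)); rewrite mulmxV //.
  rewrite !mulmxA mulmxK // -(mulmxA _ A^T A).
  by rewrite mulmxK // mulmxV.
by rewrite !mulmxA mulmxK // mulmxKV.
Qed.

Lemma ortho_proj_pythagoras m n k (A : 'M[R]_(n, m)) (v : 'M[R]_(n, k)) :
  injective (fun v : 'cV[R]_m => A *m v) ->
  v^T *m v - (ortho_proj A *m v)^T *m (ortho_proj A *m v) =
  ((1%:M - ortho_proj A) *m v)^T *m ((1%:M - ortho_proj A) *m v).
Proof.
move=> Ai; have idem := ortho_proj_idem Ai; have sym := ortho_proj_tr A.
move: (ortho_proj A) idem sym => Q idem sym.
have E : (1%:M - Q) *m (1%:M - Q) = 1%:M - Q.
  by rewrite mulmxBr mulmx1 mulmxBl mul1mx idem subrr subr0.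
rewrite !trmx_mul [(_ - _)^T]linearB /= trmx1 sym -!mulmxA.
rewrite (mulmxA Q) idem (mulmxA (1%:M - Q)) E.
by rewrite mulmxBl mul1mx mulmxBr.
Qed.

(** The image of A has the dimension m of V. *)
Lemma full_image m n (A : 'M[R]_(n, m)) (V : {vspace 'cV[R]_n}) :
  injective (fun v : 'cV[R]_m => A *m v) -> \dim V = m ->
  (forall v : 'cV[R]_m, A *m v \in V) ->
  forall w, w \in V -> exists v : 'cV[R]_m, w = A *m v.
Proof.
move=> Ai dV AV w wV.
pose L : 'Hom('cV[R]_m, 'cV[R]_n) := linfun (mulmx A).
have LE v : L v = A *m v by rewrite lfunE.
have kL : lker L = 0%VS.
  apply/eqP; rewrite -subv0; apply/subvP => v; rewrite memv_ker LE memv0 => /eqP Av.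
  by apply/eqP; apply: Ai; rewrite /= mulmx0.
have dL : \dim (limg L) = m.
  have := limg_ker_dim L fullv; rewrite kL capv0 dimv0 add0n dimvf => ->.
  by rewrite /dim /= muln1.
have sub : (limg L <= V)%VS.
  by apply/subvP => _ /memv_imgP [v _ ->]; rewrite LE; exact: AV.
have VE : limg L = V by apply/eqP; rewrite eqEdim sub dL dV leqnn.
move: wV; rewrite -VE => /memv_imgP [v _ ->].
by exists v; rewrite LE.
Qed.

End Projection.

Section Fiber.
Variables (R : realType) (m n : nat) (M : manifold R m).
Variable f0 : M -> grassmannian R m n.

Lemma fiber_mem (al : form_rep n M) c x (v : 'cV[R]_m) : W_fiber f0 al -> dom c x ->
  al c x *m v \in val (f0 x).
Proof.
move=> [_ /(_ x) WE] cx.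
have : W al x (al c x *m v) by exists c, v.
by rewrite WE.
Qed.

Lemma fiber_image (al : form_rep n M) c x w : W_fiber f0 al -> dom c x ->
  w \in val (f0 x) -> exists v : 'cV[R]_m, w = al c x *m v.
Proof.
move=> fal cx wV; have [[_ /(_ c x cx) ali] _] := fal.
apply: (full_image ali _ _ wV); first by have /eqP := valP (f0 x).
by move=> v; exact: fiber_mem.
Qed.

Lemma fiber_intro (al : form_rep n M) : Omega1_plus al ->
  (forall c x (v : 'cV[R]_m), dom c x -> al c x *m v \in val (f0 x)) ->
  W_fiber f0 al.
Proof.
move=> alO alV; split=> // x; apply/seteqP; split=> [_ [c [v [cx ->]]]|w /= wV].
  exact: alV.
have [c cx] := dom_cover x.
have [_ /(_ c x cx) ali] := alO.
have [||v ->] := full_image ali _ _ wV.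
- by have /eqP := valP (f0 x).
- by move=> v; exact: alV.
by exists c, v.
Qed.

(** J is injective because al c x = al d x *m J is. *)
Lemma jacobian_unit (al : form_rep n M) (c d : chart M) (x : M) J : Omega1_plus al ->
  dom c x -> dom d x -> is_jacobian c d x J -> J \in unitmx.
Proof.
move=> [[_ comp _] inj] cx dx Jac.
apply: unitmx_cV => v Jv; apply: (inj c x cx) => /=.
by rewrite (comp c d x J cx dx Jac) -mulmxA Jv !mulmx0.
Qed.

End Fiber.

(** Reparametrizing the source does not affect injectivity, so that it can be
    tested in a single chart. *)
Lemma injective_chart (R : realType) (m n : nat) (M : manifold R m)
    (al be : form_rep n M) (c d : chart M) (x : M) :
  chart_compatible al -> Omega1_plus be -> dom c x -> dom d x ->
  injective (fun v : 'cV[R]_m => al c x *m v) ->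
  injective (fun v : 'cV[R]_m => al d x *m v).
Proof.
move=> comp beO cx dx inj; have [J Jac] := jacobian_exists dx cx.
have uJ := jacobian_unit beO dx cx Jac.
move=> v w /=; rewrite (comp d c x J dx cx Jac) -!mulmxA => /inj.
exact: (can_inj (mulKmx uJ)).
Qed.

(** * The fibers are totally geodesic *)

(** Composing a variation of a curve in the fiber with the orthogonal projections
    onto the planes f0 x keeps it in the fiber for small parameters, and changes
    its energy to second order only: the metric depends on the Gram matrices,
    and the normal component enters these quadratically. *)
Section FiberVariation.
Variables (R : realType) (m n : nat) (M : manifold R m) (P : partition_of_unity M).
Hypothesis M_compact : compact [set: M].
Variable f0 : M -> grassmannian R m n.
Variables (p q e : R) (gamma : R -> form_rep n M) (b : R -> R -> form_rep n M).
Hypothesis pq : p < q.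
Hypothesis e0 : 0 < e.
Hypothesis gammaS : forall t, t \in `[p, q] -> W_fiber f0 (gamma t).
Hypothesis b_var : proper_variation (@Omega1_plus R m n M) p q gamma e b.
Local Notation D c := (coord c @` dom c).
Local Notation Z := ((R * R) * 'cV[R]_m)%type.

Let b_smooth : smooth_family (`]- e, e[ `*` `[p, q] : set (R * R))
  (fun st => b st.1 st.2). Proof. by case: b_var. Qed.
Let b_plus s t : s \in `]- e, e[ -> t \in `[p, q] -> Omega1_plus (b s t).
Proof. by case: b_var => _ H _ _; exact: H. Qed.
Let b_0 t : t \in `[p, q] -> b 0 t = gamma t.
Proof. by case: b_var => _ _ H _; exact: H. Qed.

Let p_in : p \in `[p, q]. Proof. by rewrite in_itv /= lexx ltW. Qed.

Let a0 : form_rep n M := gamma p.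
Let a0S : W_fiber f0 a0. Proof. exact: gammaS. Qed.
Let a0_inj c x : dom c x -> injective (fun v : 'cV[R]_m => a0 c x *m v).
Proof. by move=> cx; have [[_ inj] _] := a0S; exact: inj. Qed.

Let Q (c : chart M) (x : M) : 'M[R]_n := ortho_proj (a0 c x).

Definition projected (s t : R) : form_rep n M := fun c x => Q c x *m b s t c x.

Lemma proj_plane c x w : dom c x -> w \in val (f0 x) -> Q c x *m w = w.
Proof.
move=> cx /(fiber_image a0S cx) [v ->].
by rewrite mulmxA ortho_projK //; exact: a0_inj.
Qed.

Lemma proj_in_plane c x (w : 'cV[R]_n) : dom c x -> Q c x *m w \in val (f0 x).
Proof.
by move=> cx; rewrite /Q /ortho_proj -!mulmxA; exact: fiber_mem.
Qed.

Lemma proj_gamma c x t : dom c x -> t \in `[p, q] ->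
  Q c x *m gamma t c x = gamma t c x.
Proof.
move=> cx It; apply/matrixP => i j.
have := proj_plane cx (fiber_mem (delta_mx j ord0) (gammaS It) cx).
rewrite mulmxA => /matrixP /(_ i ord0).
by rewrite -!colE !mxE.
Qed.

Lemma proj_smooth c i j : smooth_on (D c) (fun y => Q c (param c y) i j).
Proof.
have [[[_ _ a0s] _] _] := a0S.
have sT k l : smooth_on (D c) (fun y => (a0 c (param c y))^T k l).
  exact: (smooth_rel_trmx (F := fun y => a0 c (param c y)) (a0s c)).
have u y : D c y -> (a0 c (param c y))^T *m a0 c (param c y) \in unitmx.
  by move=> /chart_cover [cy _]; apply: gram_unit; exact: a0_inj.
have sI := smooth_on_invmx (F := fun y => (a0 c (param c y))^T *m a0 c (param c y))
  u (smooth_rel_mulmx sT (a0s c)).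
exact: (smooth_rel_mulmx (smooth_rel_mulmx (a0s c) sI) sT).
Qed.

Lemma proj_smoothZ e' c i j : smooth_on (closed_strip e' p q (D c))
  (fun z : Z => Q c (param c z.2) i j).
Proof. by apply: (smooth_rel_space _ _ _ (@proj_smooth c i j)) => // z []. Qed.

Lemma projected_smooth : smooth_family (`]- e, e[ `*` `[p, q] : set (R * R))
  (fun st => projected st.1 st.2).
Proof.
move=> c i j; apply: smooth_rel_mulmx => k l; first exact: proj_smoothZ.
exact: b_smooth.
Qed.

Lemma projected_compatible s t : s \in `]- e, e[ -> t \in `[p, q] ->
  chart_compatible (projected s t).
Proof.
move=> se It c d x J cx dx Jac; have [[_ bcomp _] _] := b_plus se It.
have [a0O _] := a0S; have [[_ acomp _] _] := a0O.
rewrite /projected /Q (bcomp c d x J cx dx Jac) (acomp c d x J cx dx Jac).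
rewrite ortho_proj_mul ?mulmxA //; first exact: a0_inj.
exact: jacobian_unit a0O cx dx Jac.
Qed.

Lemma projected_Omega1 s t : s \in `]- e, e[ -> t \in `[p, q] ->
  Omega1 (projected s t).
Proof.
move=> se It; have [[b0 _ bs] _] := b_plus se It; split.
- by move=> c x cx; rewrite /projected b0 // mulmx0.
- exact: projected_compatible.
- move=> c i j; apply: smooth_rel_mulmx => k l; first exact: proj_smooth.
  exact: bs.
Qed.

Lemma projected_0 t : t \in `[p, q] -> projected 0 t = gamma t.
Proof.
move=> It; apply/funext => c; apply/funext => x; rewrite /projected b_0 //.
have [cx|cx] := pselect (dom c x); first exact: proj_gamma.
by have [[[g0 _ _] _] _] := gammaS It; rewrite g0 // mulmx0.
Qed.

Let zero_in : (0 : R) \in `]- e, e[. Proof. exact: zero_in_itv. Qed.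

Lemma projected_det_pos c t0 y0 : t0 \in `[p, q] -> D c y0 ->
  \forall z \near ((0 : R, t0), y0), closed_strip e p q (D c) z ->
    0 < \det ((family_mx projected c z)^T *m family_mx projected c z).
Proof.
move=> It Dy; have [cy _] := chart_cover Dy.
have Az : closed_strip e p q (D c) ((0, t0), y0) by [].
have sdet : smooth_on (closed_strip e p q (D c))
    (fun z => \det ((family_mx projected c z)^T *m family_mx projected c z)).
  by apply: smooth_rel_det => k l; apply: gram_smooth; exact: projected_smooth.
have [|d d0] := smooth_on_pos sdet Az.
  apply: gram_det_gt0; rewrite /family_mx /= projected_0 //.
  by have [[_ inj] _] := gammaS It; exact: inj.
by apply: filterS => z H /H; exact: lt_le_trans.
Qed.

(** Injectivity holds for s = 0 and is an open condition, uniformly on the compact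
    product of the time interval and M. *)
Lemma projected_inj_near : exists2 e', 0 < e' <= e &
  forall s t c x, s \in `]- e', e'[ -> t \in `[p, q] -> dom c x ->
    injective (fun v : 'cV[R]_m => projected s t c x *m v).
Proof.
have cpt : compact ([set` `[p, q]] `*` [set: M]).
  by apply: compact_setX => //; exact: segment_compact.
have [|[t x] [/= It _]|C CP] := @compact_uniform_bound R _ _ R (nbhs (0 : R))
  (fun _ s tx => s \in `]- e, e[ -> tx.1 \in `[p, q] -> forall c, dom c tx.2 ->
    injective (fun v : 'cV[R]_m => projected s tx.1 c tx.2 *m v)) _ cpt.
- by [].
- exists 0; have [c cx] := dom_cover x.
  have Dx : D c (coord c x) by exists x.
  have dpos := projected_det_pos It Dx.
  have hc : (fun w : (R * M) * R => ((w.2, w.1.1), coord c w.1.2)) @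
      nbhs ((t, x), (0 : R)) --> ((0, t), coord c x).
    apply: (@cvg_pair _ _ _ _ (nbhs (0, t)) (nbhs (coord c x))).
      apply: (@cvg_pair _ _ _ _ (nbhs (0 : R)) (nbhs t)); first exact: cvg_snd.
      by apply: (@continuous_comp _ _ _ fst fst ((t, x), 0)); exact: cvg_fst.
    apply: (@continuous_comp _ _ _ (fun w : (R * M) * R => w.1.2) (coord c)
      ((t, x), 0)); last exact: Defs.coord_continuous.
    apply: (@continuous_comp _ _ _ fst snd ((t, x), 0)); first exact: cvg_fst.
    exact: cvg_snd.
  have dpos2 : \forall w \near ((t, x), (0 : R)),
      closed_strip e p q (D c) ((w.2, w.1.1), coord c w.1.2) ->
      0 < \det ((family_mx projected c ((w.2, w.1.1), coord c w.1.2))^T *m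
        family_mx projected c ((w.2, w.1.1), coord c w.1.2)).
    exact: hc _ dpos.
  have cnear : \forall w \near ((t, x), (0 : R)), dom c w.1.2.
    have nx : nbhs x (dom c) by apply: open_nbhs_nbhs; split=> //; exact: dom_open.
    have sc : (fun w : (R * M) * R => w.1.2) @ nbhs ((t, x), (0 : R)) --> x.
      apply: (@continuous_comp _ _ _ fst snd ((t, x), 0)); first exact: cvg_fst.
      exact: cvg_snd.
    exact: sc _ nx.
  apply: filterS2 dpos2 cnear => -[[t' x'] s] /= H cx' se It' d dx'.
  have inj_c : injective (fun v : 'cV[R]_m => projected s t' c x' *m v).
    have Az : closed_strip e p q (D c) ((s, t'), coord c x').
      by split => //=; exists x'.
    have := H Az; rewrite /family_mx /= coordK // => dp.
    by apply: det_gram_inj; rewrite gt_eqF.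
  have bO := b_plus se It'.
  exact: (injective_chart (projected_compatible se It') bO cx' dx' inj_c).
have /nbhs_ballP [d /= d0 dP] := CP.
exists (Num.min d e); first by rewrite lt_min d0 e0 ge_min lexx orbT.
move=> s t c x se It cx.
have [sd see] : `|s| < d /\ `|s| < e.
  by move: se; rewrite in_itv /= -ltr_norml lt_min => /andP[].
apply: (dP s _ (t, x)) => //=; first by rewrite -ball_normE /= sub0r normrN.
by rewrite in_itv /= -ltr_norml.
Qed.

Lemma projected_variation e' : 0 < e' <= e ->
  (forall s t c x, s \in `]- e', e'[ -> t \in `[p, q] -> dom c x ->
    injective (fun v : 'cV[R]_m => projected s t c x *m v)) ->
  proper_variation (W_fiber f0) p q gamma e' projected.
Proof.
move=> /andP[e'0 e'e] inj.
have sub s : s \in `]- e', e'[ -> s \in `]- e, e[.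
  by rewrite !in_itv /= -!ltr_norml => /lt_le_trans; apply.
split.
- move=> c i j; apply: (smooth_relS _ _ (@projected_smooth c i j)).
    by move=> z [[/= /sub se It] Dz].
  by move=> z [[/= /sub se It] Dz].
- move=> s t se It; apply: fiber_intro.
    split; first exact: projected_Omega1 (sub _ se) It.
    by move=> c x cx; exact: inj.
  by move=> c x v cx; rewrite /projected -mulmxA; exact: proj_in_plane.
- exact: projected_0.
- move=> s /sub se; have [_ _ _ ends] := b_var; have [bp bq] := ends s se.
  have q_in : q \in `[p, q] by rewrite in_itv /= lexx ltW.
  have same t : t \in `[p, q] -> b s t = gamma t -> projected s t = gamma t.
    by move=> It bE; rewrite -[RHS]projected_0 // /projected bE b_0.
  by split; apply: same.
Qed.

Lemma projected_velocity c z : open_strip e p q (D c) z ->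
  velocity_mx projected c z = Q c (param c z.2) *m velocity_mx b c z.
Proof.
move=> Bz; apply/matrixP => i j; rewrite velocity_mxE /tderiv.
have dF k l : derivable (fun u => family_mx b c ((z.1.1, u), z.2) k l) z.1.2 1.
  exact: (@family_mx_derivable _ _ _ _ _ _ _ _ b_smooth c z k l Bz).
by rewrite (derive1_mulmx (Q c (param c z.2)) dF).
Qed.

(** For s = 0 the family lies in the fiber, where the normal component vanishes. *)
Lemma normal_ordO c t y : t \in `[p, q] -> D c y ->
  mxO (strip_filter e p q (D c) t y) (@sparam R m) 1
    (fun z => (1%:M - Q c (param c z.2)) *m family_mx b c z) /\
  mxO (strip_filter e p q (D c) t y) (@sparam R m) 1
    (fun z => (1%:M - Q c (param c z.2)) *m velocity_mx b c z).
Proof.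
move=> It Dy.
have Ns i j : smooth_on (closed_strip e p q (D c))
    (fun z : Z => ((1%:M - Q c (param c z.2)) *m family_mx b c z) i j).
  apply: smooth_rel_mulmx => k l; last exact: b_smooth.
  have H := smooth_relB (smooth_rel_cst (closed_strip e p q (D c)) ((1%:M : 'M[R]_n) k l))
    (@proj_smoothZ e c k l).
  by apply: (smooth_rel_eq _ H) => z _; rewrite !mxE.
have N0 i j t' y' : t' \in `]p, q[ -> D c y' ->
    ((1%:M - Q c (param c ((0 : R, t'), y').2)) *m family_mx b c ((0, t'), y')) i j = 0.
  move=> /subset_itv_oo_cc It' /chart_cover [cy' _].
  by rewrite /family_mx /= b_0 // mulmxBl mul1mx proj_gamma // subrr mxE.
split=> i j.
  apply: (ordO_rel e0 _ _ It Dy); last exact: N0.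
  apply: smooth_on_rel; [exact: open_strip_sub|exact: Ns].
have tE z : open_strip e p q (D c) z ->
    tderiv (fun z => ((1%:M - Q c (param c z.2)) *m family_mx b c z) i j) z =
    ((1%:M - Q c (param c z.2)) *m velocity_mx b c z) i j.
  move=> Bz; rewrite /tderiv.
  have dF k l : derivable (fun u => family_mx b c ((z.1.1, u), z.2) k l) z.1.2 1.
    exact: (@family_mx_derivable _ _ _ _ _ _ _ _ b_smooth c z k l Bz).
  by rewrite (derive1_mulmx (1%:M - Q c (param c z.2)) dF).
apply: (ordO_rel e0 _ _ It Dy).
  by apply: (smooth_rel_eq tE); apply: smooth_rel_tderiv; exact: Ns.
move=> t' y' It' Dy'; rewrite -tE; last by split=> //; split.
by apply: (tderiv_vanish (p := p) (q := q) (D := D c)) => // t2 y2 It2 Dy2; exact: N0.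
Qed.

Hypothesis proj_inj : forall s t c x, s \in `]- e, e[ -> t \in `[p, q] -> dom c x ->
  injective (fun v : 'cV[R]_m => projected s t c x *m v).

Lemma projected_plus s t : s \in `]- e, e[ -> t \in `[p, q] ->
  Omega1_plus (projected s t).
Proof.
by move=> se It; split; [exact: projected_Omega1|move=> c x; exact: proj_inj].
Qed.

(** By Pythagoras the Gram matrices of the family and of its projection differ by
    the Gram matrix of the normal component, which is O(s^2). *)
Lemma gram_density_projected c t y : t \in `[p, q] -> D c y ->
  ordO (strip_filter e p q (D c) t y) (@sparam R m) 2
    (fun z => gram_density b c z - gram_density projected c z).
Proof.
move=> It Dy.
have sub := @open_strip_sub R m e p q (D c).
have vO (b' : R -> R -> form_rep n M) :
    smooth_family (`]- e, e[ `*` `[p, q] : set (R * R)) (fun st => b' st.1 st.2) ->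
    mxO (strip_filter e p q (D c) t y) (@sparam R m) 0 (velocity_mx b' c) /\
    mxO (strip_filter e p q (D c) t y) (@sparam R m) 0 (family_mx b' c).
  move=> b's; split=> i j; apply: (ordO0_rel e0 _ It Dy); apply: smooth_regular.
    exact: velocity_mx_smooth.
  by apply: smooth_on_rel => //; exact: family_mx_smooth.
have [vb0 b0] := vO b b_smooth; have [vp0 p0] := vO projected projected_smooth.
have [Nb Nv] := normal_ordO It Dy.
have [c1 c10 d1] := near_pos e0 (smooth_rel_det (gram_smooth b_smooth (c := c)))
  (gram_pos b_plus (c := c)) It Dy.
have [c2 c20 d2] := near_pos e0 (smooth_rel_det (gram_smooth projected_smooth (c := c)))
  (gram_pos projected_plus (c := c)) It Dy.
have c0 : 0 < Num.min c1 c2 by rewrite lt_min c10.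
apply: (dens_sub c0).
- exact: (mxOM (mxOT vb0) vb0).
- exact: (mxOM (mxOT vp0) vp0).
- exact: (mxOM (mxOT b0) b0).
- exact: (mxOM (mxOT p0) p0).
- apply: (mxO_eq _ (mxOM (mxOT Nv) Nv)); apply: strip_near => z Bz.
  rewrite projected_velocity //; apply/esym/ortho_proj_pythagoras/a0_inj.
  by case: Bz => _ /chart_cover [].
- apply: (mxO_eq _ (mxOM (mxOT Nb) Nb)); apply: strip_near => z Bz.
  apply/esym/ortho_proj_pythagoras/a0_inj.
  by case: Bz => _ /chart_cover [].
- by apply: filterS d1 => z; apply: le_trans; rewrite ge_min lexx.
- by apply: filterS d2 => z; apply: le_trans; rewrite ge_min lexx orbT.
Qed.

Lemma energy_projected : exists C, \forall s \near (0 : R),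
  `|energy P p q (b s) - energy P p q (projected s)| <= C * s ^+ 2.
Proof.
have [|i t y It Dy|C CP] := @action_integral_quadratic R m M P M_compact e p q e0 pq
  (fun i z => gram_density b (pu_chart (p := P) i) z -
     gram_density projected (pu_chart (p := P) i) z).
- by move=> i; apply: regularB; apply: gram_density_regular => //;
    [exact: projected_smooth|exact: projected_plus].
- exact: gram_density_projected.
exists (2^-1 * C).
apply: filterS2 CP (near_itvoo zero_in) => s H se.
rewrite (energy_variation b_smooth b_plus P M_compact se).
rewrite (energy_variation projected_smooth projected_plus P M_compact se).
rewrite -mulrBr -action_integralB //; last 2 first.
- by move=> i; apply: (regular_tame se); exact: gram_density_regular.
- move=> i; apply: (regular_tame se); apply: gram_density_regular.
    exact: projected_smooth.
  exact: projected_plus.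
by rewrite normrM ger0_norm ?invr_ge0 // -mulrA ler_wpM2l ?invr_ge0.
Qed.

End FiberVariation.

Lemma proper_variation_shrink (R : realType) (m n : nat) (M : manifold R m)
    (S : set (form_rep n M)) (p q e e' : R) gamma b : 0 < e' <= e ->
  proper_variation S p q gamma e b -> proper_variation S p q gamma e' b.
Proof.
move=> /andP[e'0 e'e] [bs bS b0 bpq].
have sub s : s \in `]- e', e'[ -> s \in `]- e, e[.
  by rewrite !in_itv /= -!ltr_norml => /lt_le_trans; apply.
split=> // [c i j|s t se It|s se].
- apply: (smooth_relS _ _ (@bs c i j)).
    by move=> z [[/= /sub se It] Dz].
  by move=> z [[/= /sub se It] Dz].
- by apply: bS => //; exact: sub.
- by apply: bpq; exact: sub.
Qed.

Lemma fiber_totally_geodesic (R : realType) (m n : nat) (M : manifold R m)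
    (P : partition_of_unity M) (f0 : M -> grassmannian R m n) :
  compact [set: M] -> totally_geodesic P (W_fiber f0).
Proof.
move=> M_compact; split=> [al [//]|I gamma itvI [gs gS gcrit]].
split=> // [t It|p q pq sub e b e0 bvar]; first by have [] := gS t It.
have gSpq t : t \in `[p, q] -> W_fiber f0 (gamma t) by move=> It; exact/gS/sub.
have [e' e'e inj] := projected_inj_near M_compact pq e0 gSpq bvar.
have e'0 : 0 < e' by case/andP: e'e.
have pvar := projected_variation pq gSpq bvar e'e inj.
have bvar' := proper_variation_shrink e'e bvar.
have dproj := gcrit p q pq sub e' _ e'0 pvar.
have [C CP] := energy_projected P M_compact pq e'0 gSpq bvar' inj.
exact: is_derive_quadratic CP dproj.
Qed.

(** * First order variation along a line of scalings *)

Section IntegrableSlices.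
Variables (R : realType) (m : nat) (e p q : R) (D : set 'cV[R]_m).
Local Notation mu := (@lebesgue_measure R).

Lemma regular_slice_integrable (f : (R * R) * 'cV[R]_m -> R) (s : R) y :
  s \in `]- e, e[ -> D y -> regular e p q D f ->
  mu.-integrable `]p, q[ (EFin \o (fun t => f ((s, t), y))).
Proof.
move=> se Dy [fc fb].
have hc (t : R) : (fun t : R => ((s, t), y)) @ nbhs t --> ((s, t), y).
  apply: (@cvg_pair _ _ _ _ (nbhs (s, t)) (nbhs y)); last exact: cvg_cst.
  by apply: (@cvg_pair _ _ _ _ (nbhs s) (nbhs t)); [apply: cvg_cst|apply: cvg_id].
have [|t /= It|C CP] := @compact_uniform_bound R R [set` `[p, q]] unit
    (globally setT) (fun C _ t => t \in `]p, q[ -> `|f ((s, t), y)| <= C) _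
    (@segment_compact R p q).
- by move=> C C' _ t CC' H It; apply: le_trans CC'; exact: H.
- have [C Cb] := fb ((s, t), y) (conj (conj se It) Dy); exists C.
  have Cb2 : \forall u \near t, open_strip e p q D ((s, u), y) ->
      `|f ((s, u), y)| <= C by exact: hc t _ Cb.
  exists ([set u | u \in `]p, q[ -> `|f ((s, u), y)| <= C], setT) => [|[u v] []//].
  by split=> //=; apply: filterS Cb2 => u H Iu; apply: H; split.
apply: (@bounded_continuous_integrable _ _ _ _ C) => t It; last first.
  by apply: (CP tt Logic.I t) => //=; exact: subset_itv_oo_cc.
move=> N /(fc ((s, t), y) (conj (conj se It) Dy)) HN.
have HN' : \forall z \near ((s, t), y), open_strip e p q D z -> N (f z) by exact: HN.
have HN2 : \forall u \near t, open_strip e p q D ((s, u), y) -> N (f ((s, u), y)).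
  exact: hc t _ HN'.
change (\forall u \near t, N (f ((s, u), y))).
by apply: filterS2 HN2 (near_itvoo It) => u H Iu; apply: H; split.
Qed.

End IntegrableSlices.

Section ScalingVariation.
Variables (R : realType) (m n : nat) (M : manifold R m) (P : partition_of_unity M).
Hypothesis M_compact : compact [set: M].
Local Notation mu := (@lebesgue_measure R).
Local Notation D c := (coord c @` dom c).
Local Notation Z := ((R * R) * 'cV[R]_m)%type.
Variable a0 : form_rep n M.
Hypothesis a0_plus : Omega1_plus a0.
Variables (p q : R) (r : R -> R).
Hypothesis pq : p < q.
Hypothesis r_smooth : smooth_on [set` `[p, q]] r.
Hypothesis r_gt0 : forall t, t \in `[p, q] -> 0 < r t.

Let gram0 c y : 'M[R]_m := (a0 c (param c y))^T *m a0 c (param c y).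

Definition volume c y : R := Num.sqrt (\det (gram0 c y)).

(** The first variation, in the direction phi, of the Lagrangian r^(m - 2) r'^2. The
    energy density of the curve r alpha0 is m times this Lagrangian times the volume
    density of alpha0. *)
Definition lagr_variation (phi : R -> R) t : R :=
  r t ^+ m * (2 * derive1 r t * derive1 phi t / r t ^+ 2 +
    (m%:R - 2) * derive1 r t ^+ 2 * phi t / r t ^+ 3).

Definition scaling_lagrangian t : R := r t ^+ m * (m%:R * derive1 r t ^+ 2 / r t ^+ 2).

Let a0_smooth c i j : smooth_on (D c) (fun y => a0 c (param c y) i j).
Proof. by have [[_ _ as0] _] := a0_plus; exact: as0. Qed.

Let a0_inj c y : D c y -> injective (fun v : 'cV[R]_m => a0 c (param c y) *m v).
Proof. by move=> /chart_cover [cy _]; have [_] := a0_plus; apply. Qed.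

Let gram0_smooth c i j : smooth_on (D c) (fun y => gram0 c y i j).
Proof.
apply: smooth_rel_mulmx => k l; last exact: a0_smooth.
exact: (smooth_rel_trmx (F := fun y => a0 c (param c y)) (@a0_smooth c)).
Qed.

Let gram0_gt0 c y : D c y -> 0 < \det (gram0 c y).
Proof. by move=> Dy; apply: gram_det_gt0; exact: a0_inj. Qed.

Let gram0_unit c y : D c y -> gram0 c y \in unitmx.
Proof. by move=> Dy; apply: gram_unit; exact: a0_inj. Qed.

Let inv0_smooth c i j : smooth_on (D c) (fun y => invmx (gram0 c y) i j).
Proof. by apply: (smooth_on_invmx (F := gram0 c)) => // y; exact: gram0_unit. Qed.

Section OneVariation.
Variable e : R.
Hypothesis e0 : 0 < e.

Let space_smooth (c : chart M) (f : 'cV[R]_m -> R) : smooth_on (D c) f ->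
  smooth_on (closed_strip e p q (D c)) (fun z : Z => f z.2).
Proof. by move=> sf; apply: (smooth_rel_space _ _ _ sf) => // z []. Qed.

Let time_smooth (D' : set 'cV[R]_m) (f : R -> R) : smooth_on [set` `[p, q]] f ->
  smooth_on (closed_strip e p q D') (fun z : Z => f z.1.2).
Proof. by move=> sf; apply: (smooth_rel_time _ _ _ sf) => // z [[]]. Qed.

Let sub (D' : set 'cV[R]_m) := @open_strip_sub R m e p q D'.

Lemma time_deriv_regular (D' : set 'cV[R]_m) (f : R -> R) : smooth_on [set` `[p, q]] f ->
  regular e p q D' (fun z : Z => derive1 f z.1.2).
Proof.
by move=> sf; apply: smooth_regular; exact: (smooth_rel_tderiv (time_smooth (D' := D') sf)).
Qed.

Lemma time_regular (D' : set 'cV[R]_m) (f : R -> R) : smooth_on [set` `[p, q]] f ->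
  regular e p q D' (fun z : Z => f z.1.2).
Proof.
move=> sf; apply: smooth_regular; apply: smooth_on_rel; first exact: sub.
exact: time_smooth.
Qed.

Lemma r_pow_smooth k : smooth_on [set` `[p, q]] (fun t => r t ^+ k).
Proof.
elim: k => [|k IH]; first exact: smooth_rel_cst.
by apply: (smooth_rel_eq _ (smooth_relM r_smooth IH)) => t _; rewrite exprS.
Qed.

Lemma r_inv_smooth k : smooth_on [set` `[p, q]] (fun t => (r t ^+ k)^-1).
Proof.
apply: smooth_onV; last exact: r_pow_smooth.
by move=> t It; rewrite expf_neq0 // gt_eqF // r_gt0.
Qed.

Lemma lagr_variation_regular (D' : set 'cV[R]_m) (k : Z -> R) :
  smooth_on (closed_strip e p q D') k ->
  regular e p q D' (fun z => lagr_variation (fun u => k ((z.1.1, u), z.2)) z.1.2).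
Proof.
move=> sk; have r1 := time_deriv_regular (D') r_smooth.
have kr : regular e p q D' k by apply: smooth_regular; exact: smooth_on_rel (@sub D') sk.
have kd : regular e p q D' (tderiv k) by apply: smooth_regular; exact: smooth_rel_tderiv.
have R1 := regularM (regularM (regularM (regular_cst _ _ _ _ 2) r1) kd)
  (time_regular (D') (r_inv_smooth 2)).
have R2 := regularM (regularM (regularM (regular_cst _ _ _ _ (m%:R - 2))
  (regularM r1 r1)) kr) (time_regular (D') (r_inv_smooth 3)).
have R3 := regularM (time_regular (D') (r_pow_smooth m)) (regularD R1 R2).
apply: (regular_eq _ R3) => -[[s t] y] _.
by rewrite /lagr_variation expr2.
Qed.

Lemma scaling_lagrangian_regular (D' : set 'cV[R]_m) : regular e p q D' (fun z : Z => scaling_lagrangian z.1.2).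
Proof.
have r1 := time_deriv_regular (D') r_smooth.
have R1 := regularM (regularM (regular_cst _ _ _ _ m%:R) (regularM r1 r1))
  (time_regular (D') (r_inv_smooth 2)).
have R3 := regularM (time_regular (D') (r_pow_smooth m)) R1.
by apply: (regular_eq _ R3) => z _; rewrite /scaling_lagrangian expr2.
Qed.

Lemma volume_regular (c : chart M) : regular e p q (D c) (fun z : Z => volume c z.2).
Proof.
apply: regular_sqrt; last by move=> z [_]; exact: gram0_gt0.
apply: (space_smooth (f := fun y => \det (gram0 c y))); apply: smooth_rel_det.
exact: gram0_smooth.
Qed.

Variable b : R -> R -> form_rep n M.
Hypothesis b_smooth : smooth_family (`]- e, e[ `*` `[p, q] : set (R * R))
  (fun st => b st.1 st.2).
Hypothesis b_plus : forall s t, s \in `]- e, e[ -> t \in `[p, q] ->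
  Omega1_plus (b s t).
Hypothesis b_0 : forall t c x, t \in `[p, q] -> b 0 t c x = r t *: a0 c x.

Definition deviation (c : chart M) (z : Z) : 'M[R]_(n, m) :=
  family_mx b c z - r z.1.2 *: a0 c (param c z.2).

Definition deviation_velocity (c : chart M) (z : Z) : 'M[R]_(n, m) :=
  velocity_mx b c z - derive1 r z.1.2 *: a0 c (param c z.2).

(** (A^T A)^-1 A^T B is the matrix, in the frame A, of the orthogonal projection of
    B to the plane spanned by A. *)
Definition radial (c : chart M) (B : 'M[R]_(n, m)) (y : 'cV[R]_m) : R :=
  \tr (invmx (gram0 c y) *m ((a0 c (param c y))^T *m B)).

Definition radial_part c z : R := radial c (deviation c z) z.2.

Lemma deviation_smooth (c : chart M) i j :
  smooth_on (closed_strip e p q (D c)) (fun z => deviation c z i j).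
Proof.
have H := smooth_relB (family_mx_smooth b_smooth (c := c) i j)
  (smooth_relM (time_smooth (D' := D c) r_smooth) (space_smooth (@a0_smooth c i j))).
by apply: (smooth_rel_eq _ H) => z _; rewrite !mxE.
Qed.

Lemma deviation_0 (c : chart M) t y : t \in `[p, q] -> deviation c ((0, t), y) = 0.
Proof. by move=> It; rewrite /deviation /family_mx /= b_0 // subrr. Qed.

Let r_derivable t : t \in `]p, q[ -> derivable r t 1.
Proof.
move=> It.
have Bz : open_strip e p q [set: 'cV[R]_m] ((0, t), 0).
  by split=> //; split=> //=; exact: zero_in_itv.
exact: (smooth_on_derivable (time_smooth (D' := setT) r_smooth) Bz).
Qed.

Lemma deviation_tderiv (c : chart M) z i j : open_strip e p q (D c) z ->
  tderiv (fun z => deviation c z i j) z = deviation_velocity c z i j.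
Proof.
move=> Bz; have [[_ It] _] := Bz.
have db : derivable (fun u => family_mx b c ((z.1.1, u), z.2) i j) z.1.2 1.
  exact: (@family_mx_derivable _ _ _ _ _ _ _ _ b_smooth c z i j Bz).
have dr := r_derivable It.
rewrite /tderiv derive1E.
have -> : (fun u => deviation c ((z.1.1, u), z.2) i j) =
    (fun u => family_mx b c ((z.1.1, u), z.2) i j) -
    (cst (a0 c (param c z.2) i j) * r).
  apply/funext => u; rewrite /deviation !mxE /=.
  by rewrite [r u * _]mulrC.
have drc := derivableM (derivable_cst (a0 c (param c z.2) i j) z.1.2 1) dr.
rewrite (deriveB db drc) (deriveM (derivable_cst _ z.1.2 1) dr).
rewrite derive_cst scaler0 addr0 /deviation_velocity [RHS]mxE velocity_mxE /tderiv.
by rewrite derive1E !mxE derive1E; congr (_ - _); rewrite mulrC.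
Qed.

Lemma deviation_ordO (c : chart M) t y : t \in `[p, q] -> D c y ->
  mxO (strip_filter e p q (D c) t y) (@sparam R m) 1 (deviation c) /\
  mxO (strip_filter e p q (D c) t y) (@sparam R m) 1 (deviation_velocity c).
Proof.
move=> It Dy.
have N0 i j t' y' : t' \in `]p, q[ -> D c y' -> deviation c ((0, t'), y') i j = 0.
  by move=> /subset_itv_oo_cc It' _; rewrite deviation_0 // mxE.
split=> i j.
  apply: (ordO_rel e0 _ _ It Dy); last exact: N0.
  by apply: smooth_on_rel; [exact: sub|exact: deviation_smooth].
apply: (ordO_rel e0 _ _ It Dy).
  apply: (smooth_rel_eq (fun z => @deviation_tderiv (c : chart M) z i j)).
  by apply: smooth_rel_tderiv; exact: deviation_smooth.
move=> t' y' It' Dy'; rewrite -deviation_tderiv; last first.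
  by split=> //; split=> //=; exact: zero_in_itv.
by apply: (tderiv_vanish (p := p) (q := q) (D := D c)) => // t2 y2 It2 Dy2; exact: N0.
Qed.

Lemma radial_part_smooth (c : chart M) : smooth_on (closed_strip e p q (D c)) (radial_part c).
Proof.
have H k l : smooth_on (closed_strip e p q (D c)) (fun z : Z =>
    (invmx (gram0 c z.2) *m ((a0 c (param c z.2))^T *m deviation c z)) k l).
  apply: smooth_rel_mulmx => {}k {}l; first exact: (space_smooth (@inv0_smooth c k l)).
  apply: smooth_rel_mulmx => {}k {}l; last exact: deviation_smooth.
  apply: (smooth_rel_trmx (F := fun z : Z => a0 c (param c z.2))) => {}k {}l.
  exact: (space_smooth (@a0_smooth c k l)).
by apply: smooth_rel_sum => i _; exact: H.
Qed.

Lemma radial_part_tderiv (c : chart M) z : open_strip e p q (D c) z ->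
  tderiv (radial_part c) z = radial c (deviation_velocity c z) z.2.
Proof.
move=> Bz; pose N := invmx (gram0 c z.2) *m (a0 c (param c z.2))^T.
have dF i j : derivable (fun u => deviation c ((z.1.1, u), z.2) i j) z.1.2 1.
  exact: (smooth_on_derivable (@deviation_smooth c i j) Bz).
have trE (B : 'M[R]_(n, m)) : radial c B z.2 = \sum_i (N *m B) i i.
  by rewrite /radial mulmxA.
rewrite trE /tderiv derive1E.
have -> : (fun u => radial_part c ((z.1.1, u), z.2)) =
    \sum_i (fun u => (N *m deviation c ((z.1.1, u), z.2)) i i).
  by apply/funext => u; rewrite fct_sumE -trE.
have dN i : derivable (fun u => (N *m deviation c ((z.1.1, u), z.2)) i i) z.1.2 1.
  have -> : (fun u => (N *m deviation c ((z.1.1, u), z.2)) i i) =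
      \sum_l (cst (N i l) * (fun u => deviation c ((z.1.1, u), z.2) l i)).
    by apply/funext => u; rewrite mxE fct_sumE.
  apply: derivable_sum => l.
  exact: (derivableM (derivable_cst (N i l) z.1.2 1) (dF l i)).
rewrite derive_sum //; apply: eq_bigr => i _.
rewrite -derive1E (derive1_mulmx N dF); congr ((N *m _) i i).
by apply/matrixP => k l; rewrite mxE -deviation_tderiv.
Qed.

Definition radial_variation c z : R := lagr_variation (fun u => radial_part c ((z.1.1, u), z.2)) z.1.2.

Lemma radial_variation_regular (c : chart M) : regular e p q (D c) (radial_variation c).
Proof. by apply: lagr_variation_regular; exact: radial_part_smooth. Qed.

(** The deviation from r alpha0 is O(s), and so is its velocity. *)
Lemma gram_density_expansion (c : chart M) t y : t \in `[p, q] -> D c y ->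
  ordO (strip_filter e p q (D c) t y) (@sparam R m) 2
    (fun z => gram_density b c z -
       volume c z.2 * (scaling_lagrangian z.1.2 + radial_variation c z)).
Proof.
move=> It Dy; have [hO h'O] := deviation_ordO It Dy.
have regO f : regular e p q (D c) f ->
    ordO (strip_filter e p q (D c) t y) (@sparam R m) 0 f.
  by move=> fr; exact: (ordO0_rel e0 fr It Dy).
have aO : mxO (strip_filter e p q (D c) t y) (@sparam R m) 0
    (fun z : Z => a0 c (param c z.2)).
  move=> i j; apply: regO; apply: smooth_regular; apply: smooth_on_rel.
    exact: sub.
  exact: (space_smooth (@a0_smooth c i j)).
have rO := regO _ (time_regular (D c) r_smooth).
have r'O := regO _ (time_deriv_regular (D c) r_smooth).
have [c1 c10 d1] := near_pos e0 (time_smooth (D' := D c) r_smooth)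
  (fun z (Az : closed_strip e p q (D c) z) => r_gt0 (let: conj (conj _ It) _ := Az in It))
  It Dy.
have [c2 c20 d2] := near_pos e0
  (space_smooth (f := fun y => \det (gram0 c y)) (smooth_rel_det (@gram0_smooth c)))
  (fun z (Az : closed_strip e p q (D c) z) => gram0_gt0 (let: conj _ Dz := Az in Dz)) It Dy.
have [c3 c30 d3] := near_pos e0 (smooth_rel_det (gram_smooth b_smooth (c := c)))
  (gram_pos b_plus (c := c)) It Dy.
pose c0 := Num.min c1 (Num.min c2 c3).
have c00 : 0 < c0 by rewrite !lt_min c10 c20.
have fE z : r z.1.2 *: a0 c (param c z.2) + deviation c z = family_mx b c z.
  by rewrite addrC subrK.
have vE z : derive1 r z.1.2 *: a0 c (param c z.2) + deviation_velocity c z =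
    velocity_mx b c z by rewrite addrC subrK.
have e1 : \forall z \near strip_filter e p q (D c) t y, c0 <= r z.1.2.
  by apply: filterS d1 => z; apply: le_trans; rewrite ge_min lexx.
have e2 : \forall z \near strip_filter e p q (D c) t y, c0 <= \det (gram0 c z.2).
  by apply: filterS d2 => z; apply: le_trans; rewrite !ge_min lexx orbT.
have e3 : \forall z \near strip_filter e p q (D c) t y,
    c0 <= \det ((r z.1.2 *: a0 c (param c z.2) + deviation c z)^T *m
                (r z.1.2 *: a0 c (param c z.2) + deviation c z)).
  apply: filterS d3 => z; rewrite fE; apply: le_trans.
  by rewrite !ge_min lexx !orbT.
have H := dens_expand (@sparam_cvg R m e p q (D c) t y) c00 aO hO h'O rO r'O e1 e2 e3.
apply: (ordO_eq _ (H _)); apply: strip_near => z Bz.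
rewrite fE vE /gram_density -/(gram0 c z.2) -/(volume c z.2); congr (_ - _).
rewrite -/(radial c (deviation c z) z.2) -/(radial c (deviation_velocity c z) z.2).
rewrite -radial_part_tderiv // /scaling_lagrangian /radial_variation /lagr_variation -/(radial_part c z).
rewrite -/(tderiv (radial_part c) z).
case: z Bz => -[s u] v Bz /=.
by ring.
Qed.

Let vol i := volume (pu_chart (p := P) i).

Lemma energy_expansion : exists C, \forall s \near (0 : R),
  `|energy P p q (b s) - 2^-1 *
     (action_integral p q (fun i t y => vol i y * scaling_lagrangian t) +
      action_integral p q (fun i t y => vol i y * radial_variation (pu_chart (p := P) i) ((s, t), y)))|
  <= C * s ^+ 2.
Proof.
have gr c : regular e p q (D c) (gram_density b c).
  exact: gram_density_regular.
have lr c : regular e p q (D c) (fun z => volume c z.2 * (scaling_lagrangian z.1.2 + radial_variation c z)).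
  apply: regularM; first exact: volume_regular.
  by apply: regularD; [exact: scaling_lagrangian_regular|exact: radial_variation_regular].
have l0r c : regular e p q (D c) (fun z => volume c z.2 * scaling_lagrangian z.1.2).
  by apply: regularM; [exact: volume_regular|exact: scaling_lagrangian_regular].
have [|i t y It Dy|C CP] := @action_integral_quadratic R m M P M_compact e p q e0 pq
  (fun i z => gram_density b (pu_chart (p := P) i) z -
     volume (pu_chart (p := P) i) z.2 * (scaling_lagrangian z.1.2 + radial_variation (pu_chart (p := P) i) z)).
- by move=> i; apply: regularB; [exact: gr|exact: lr].
- exact: gram_density_expansion.
exists (2^-1 * C).
apply: filterS2 CP (near_itvoo (zero_in_itv e0)) => s H se.
rewrite (energy_variation b_smooth b_plus P M_compact se) -mulrBr.
have lt : tame_family p q (fun i t y =>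
    vol i y * (scaling_lagrangian t + radial_variation (pu_chart (p := P) i) ((s, t), y))).
  by move=> i; apply: (regular_tame se (lr _)).
have l0t : tame_family p q (fun i t y => vol i y * scaling_lagrangian t).
  by move=> i; apply: (regular_tame se (l0r _)).
have -> : action_integral p q (fun i t y =>
      vol i y * radial_variation (pu_chart (p := P) i) ((s, t), y)) =
    action_integral p q (fun i t y =>
      vol i y * (scaling_lagrangian t + radial_variation (pu_chart (p := P) i) ((s, t), y)) -
      vol i y * scaling_lagrangian t).
  congr action_integral; apply/funext => i; apply/funext => t; apply/funext => y.
  by rewrite -mulrBr addrC addKr.
rewrite (action_integralB M_compact lt l0t) addrCA subrr addr0.
rewrite -action_integralB //; last first.
  by move=> i; apply: (regular_tame se (gr _)).
by rewrite normrM ger0_norm ?invr_ge0 // -mulrA ler_wpM2l ?invr_ge0.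
Qed.

End OneVariation.

End ScalingVariation.

(** * Scalings are totally geodesic *)

Lemma scalings_sub (R : realType) (m n : nat) (M : manifold R m) (a0 : form_rep n M) :
  Omega1_plus a0 -> scalings a0 `<=` @Omega1_plus R m n M.
Proof.
move=> [[a0_out a0_c a0_s] a0_i] _ [t t0 ->]; split; first split.
- by move=> c x cx; rewrite a0_out // scaler0.
- by move=> c d x J cx dx cJ; rewrite (a0_c c d x J) // scalemxAl.
- move=> c i j; have H := smooth_relM (smooth_rel_cst (coord c @` dom c) t) (a0_s c i j).
  by apply: (smooth_rel_eq _ H) => y _; rewrite mxE.
- move=> c x cx v w; rewrite -!scalemxAl => /(scalerI (lt0r_neq0 t0)).
  exact: a0_i.
Qed.

Section ScalingCritical.
Variables (R : realType) (m n : nat) (M : manifold R m) (P : partition_of_unity M).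
Hypothesis M_compact : compact [set: M].
Local Notation mu := (@lebesgue_measure R).
Local Notation D c := (coord c @` dom c).
Local Notation Z := ((R * R) * 'cV[R]_m)%type.
Local Notation chart_of i := (pu_chart (p := P) i).
Variable a0 : form_rep n M.
Hypothesis a0_plus : Omega1_plus a0.
Hypothesis m_gt0 : (0 < m)%N.
Variables (p q : R) (r : R -> R).
Hypothesis pq : p < q.
Hypothesis r_smooth : smooth_on [set` `[p, q]] r.
Hypothesis r_gt0 : forall t, t \in `[p, q] -> 0 < r t.
Variable gamma : R -> form_rep n M.
Hypothesis gammaE : forall t, t \in `[p, q] -> gamma t = fun c x => r t *: a0 c x.
Hypothesis gamma_critical : forall e b, 0 < e ->
  proper_variation (scalings a0) p q gamma e b ->
  is_derive (0 : R) (1 : R) (fun s => energy P p q (b s)) (0 : R).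

Let p_in : p \in `[p, q]. Proof. by rewrite in_itv /= lexx ltW. Qed.
Let q_in : q \in `[p, q]. Proof. by rewrite in_itv /= lexx ltW. Qed.

Let total_volume := space_integral (P := P) (fun i => volume a0 (chart_of i)).

Let volume_tame : tame_family (P := P) p q (fun i _ y => volume a0 (chart_of i) y).
Proof.
move=> i; have z0 : (0 : R) \in `](- 1), 1[ by exact: zero_in_itv.
exact: (regular_tame z0 (volume_regular a0_plus p q 1 (chart_of i))).
Qed.

Let strip_smooth (phi : R -> R) : smooth_on [set` `[p, q]] phi ->
  smooth_on (closed_strip 1 p q [set: 'cV[R]_m]) (fun z : Z => phi z.1.2).
Proof. by move=> sphi; apply: (smooth_rel_time _ _ _ sphi) => // z [[]]. Qed.

Let lagr_variation_integrable (phi : R -> R) : smooth_on [set` `[p, q]] phi ->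
  mu.-integrable `]p, q[ (EFin \o lagr_variation m r phi).
Proof.
move=> /strip_smooth sphi.
have z0 : (0 : R) \in `](- 1), 1[ by exact: zero_in_itv.
exact: (regular_slice_integrable (y := 0) z0 Logic.I
  (lagr_variation_regular r_smooth r_gt0 sphi)).
Qed.

Let slice_derivable (phi : R -> R) t : smooth_on [set` `[p, q]] phi ->
  t \in `]p, q[ -> derivable phi t 1.
Proof.
move=> /strip_smooth sphi It.
have Bz : open_strip 1 p q [set: 'cV[R]_m] ((0, t), 0).
  by split=> //; split=> //=; exact: zero_in_itv.
exact: (smooth_on_derivable sphi Bz).
Qed.

Let sparam_smooth (A : set Z) : smooth_on A (@sparam R m).
Proof.
apply: smooth_rel_linear => // z.
by apply: (@continuous_comp _ _ _ fst fst z); exact: cvg_fst.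
Qed.

Let perturbed (phi : R -> R) (s t : R) := r t + s * phi t.

Let perturbed_smooth phi (A : set 'cV[R]_m) e : smooth_on [set` `[p, q]] phi ->
  smooth_on (closed_strip e p q A) (fun z : Z => perturbed phi z.1.1 z.1.2).
Proof.
move=> sphi; apply: smooth_relD.
  by apply: (smooth_rel_time _ _ _ r_smooth) => // z [[]].
apply: smooth_relM; first exact: sparam_smooth.
by apply: (smooth_rel_time _ _ _ sphi) => // z [[]].
Qed.

Let perturbed_pos phi : smooth_on [set` `[p, q]] phi ->
  exists2 e, 0 < e & forall s t, s \in `]- e, e[ -> t \in `[p, q] -> 0 < perturbed phi s t.
Proof.
move=> sphi.
have [|t It|C CP] := @compact_uniform_bound R _ [set` `[p, q]] R (nbhs (0 : R))
  (fun _ s t => t \in `[p, q] -> 0 < perturbed phi s t) _ (segment_compact (a := p) (b := q)).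
- by [].
- have z0 : (0 : R) \in `](- 1), 1[ by exact: zero_in_itv.
  have Az : closed_strip 1 p q [set: 'cV[R]_m] ((0, t), 0) by split.
  have [|c c0 cP] := smooth_on_pos (perturbed_smooth (A := setT) (e := 1) sphi) Az.
    by rewrite /perturbed mul0r addr0 r_gt0.
  exists 0.
  have hc : (fun w : R * R => ((w.2, w.1), (0 : 'cV[R]_m))) @ nbhs (t, (0 : R)) -->
      ((0, t), (0 : 'cV[R]_m)).
    apply: (@cvg_pair _ _ _ _ (nbhs ((0 : R), t)) (nbhs (0 : 'cV[R]_m))).
      apply: (@cvg_pair _ _ _ _ (nbhs (0 : R)) (nbhs t)); first exact: cvg_snd.
      exact: cvg_fst.
    exact: cvg_cst.
  have H : \forall w \near (t, (0 : R)),
      closed_strip 1 p q setT ((w.2, w.1), (0 : 'cV[R]_m)) -> c <= perturbed phi w.2 w.1.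
    exact: hc _ cP.
  have near1 : \forall w \near (t, (0 : R)), w.2 \in `](- 1), 1[.
    have c2 : (fun w : R * R => w.2) @ nbhs (t, (0 : R)) --> (0 : R) by exact: cvg_snd.
    exact: c2 _ (near_itvoo z0).
  apply: filterS2 near1 H => -[u s] /= s1 H It'.
  by apply: (lt_le_trans c0); apply: H; split.
have /nbhs_ballP [e /= e0 eP] := CP.
exists e => // s t se It; apply: (eP s _ t) => //.
by rewrite -ball_normE /= sub0r normrN; move: se; rewrite in_itv /= -ltr_norml.
Qed.

Let scaled_variation phi e : smooth_on [set` `[p, q]] phi -> phi p = 0 -> phi q = 0 ->
  (forall s t, s \in `]- e, e[ -> t \in `[p, q] -> 0 < perturbed phi s t) ->
  proper_variation (scalings a0) p q gamma e
    (fun s t c x => perturbed phi s t *: a0 c x).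
Proof.
move=> sphi phip phiq pos; split.
- move=> c i j.
  have as0 : smooth_on (D c) (fun y => a0 c (param c y) i j).
    by have [[_ _ as0] _] := a0_plus; exact: as0.
  have sa : smooth_on (closed_strip e p q (D c)) (fun z : Z => a0 c (param c z.2) i j).
    by apply: (smooth_rel_space _ _ _ as0) => // z [].
  have H := smooth_relM (perturbed_smooth (A := D c) (e := e) sphi) sa.
  by apply: (smooth_rel_eq _ H) => z _; rewrite mxE.
- by move=> s t se It; exists (perturbed phi s t) => //; exact: pos.
- by move=> t It; rewrite gammaE // /perturbed mul0r addr0.
- by move=> s se; rewrite !gammaE // /perturbed phip phiq mulr0 !addr0.
Qed.

Let lagr_variationZ (a : R) (phi : R -> R) (t : R) : derivable phi t 1 ->
  lagr_variation m r (fun u => a * phi u) t = a * lagr_variation m r phi t.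
Proof.
move=> dphi; rewrite /lagr_variation.
have -> : derive1 (fun u => a * phi u) t = a * derive1 phi t.
  rewrite !derive1E.
  have -> : (fun u => a * phi u) = cst a * phi by [].
  rewrite (deriveM (derivable_cst a t 1) dphi) derive_cst scaler0 addr0.
  by [].
by ring.
Qed.

(** For the variation (r + s phi) alpha0, which consists of scalings, the energy is
    affine in s up to O(s^2), and its slope is the integral times the nonzero
    constant m / 2 times the total volume. *)
Lemma lagr_variation_critical phi : smooth_on [set` `[p, q]] phi -> phi p = 0 -> phi q = 0 ->
  total_volume != 0 -> \int[mu]_(t in `]p, q[) lagr_variation m r phi t = 0.
Proof.
move=> sphi phip phiq V0.
have [e e0 pos] := perturbed_pos sphi.
have bvar := scaled_variation sphi phip phiq pos.
pose b s t : form_rep n M := fun c x => perturbed phi s t *: a0 c x.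
have crit := gamma_critical e0 bvar.
have [b_smooth b_scal b_0 _] := bvar.
have b_plus s t : s \in `]- e, e[ -> t \in `[p, q] -> Omega1_plus (b s t).
  by move=> se It; apply: (scalings_sub a0_plus); exact: b_scal.
have b_0' t c x : t \in `[p, q] -> b 0 t c x = r t *: a0 c x.
  by move=> It; rewrite /b /perturbed mul0r addr0.
have [C CP] := energy_expansion P M_compact a0_plus pq r_smooth r_gt0 e0 b_smooth b_plus b_0'.
set A0 := action_integral p q _ in CP.
have radialE c s t y : D c y -> radial_part a0 r b c ((s, t), y) = s * m%:R * phi t.
  move=> Dy; rewrite /radial_part /radial.
  have -> : deviation a0 r b c ((s, t), y) = (s * phi t) *: a0 c (param c y).
    by rewrite /deviation /family_mx /= /b -scalerBl /perturbed addrAC subrr add0r.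
  rewrite /= -!scalemxAr mulVmx ?mxtraceZ ?mxtrace1; first by ring.
  apply: gram_unit; have [_] := a0_plus; apply.
  by have [] := chart_cover Dy.
set T := Rintegral _ _ _.
have actE s : action_integral p q (fun i t y =>
    volume a0 (chart_of i) y * radial_variation a0 r b (chart_of i) ((s, t), y)) =
    s * (m%:R * total_volume * T).
  rewrite /action_integral.
  have E t : t \in `]p, q[ -> space_integral (fun i y =>
      volume a0 (chart_of i) y * radial_variation a0 r b (chart_of i) ((s, t), y)) =
      (s * m%:R * total_volume) * lagr_variation m r phi t.
    move=> It; rewrite -mulrA [total_volume * _]mulrC mulrA.
    rewrite -(space_integralZ M_compact _ volume_tame It).
    apply: space_integral_eq => i y Dy; rewrite mulrC; congr (_ * _).
    rewrite -lagr_variationZ; last exact: slice_derivable.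
    congr (lagr_variation m r _ t); apply/funext => u; exact: radialE.
  have -> : \int[mu]_(t in `]p, q[) space_integral (fun i y =>
      volume a0 (chart_of i) y * radial_variation a0 r b (chart_of i) ((s, t), y)) =
      \int[mu]_(t in `]p, q[) ((s * m%:R * total_volume) * lagr_variation m r phi t).
    by apply: eq_Rintegral => t /set_mem It; exact: E.
  by rewrite RintegralZl //; [rewrite -/T; ring|exact: lagr_variation_integrable].
have aff : is_derive (0 : R) (1 : R) (fun s => 2^-1 * A0 + s * (2^-1 * (m%:R * total_volume * T)))
    (0 : R).
  apply: (@is_derive_quadratic _ _ _ C _ crit); apply: filterS CP => s; rewrite actE distrC.
  by rewrite mulrDr mulrCA.
have aff' := is_derive_affine (2^-1 * A0) (2^-1 * (m%:R * total_volume * T)).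
have : 2^-1 * (m%:R * total_volume * T) = 0.
  by rewrite -(@derive_val _ _ _ _ _ _ _ aff') (@derive_val _ _ _ _ _ _ _ aff).
move=> /eqP; rewrite !mulf_eq0 invr_eq0 !pnatr_eq0 (negbTE V0).
by rewrite (gtn_eqF m_gt0) /= => /eqP.
Qed.

(** At a fixed point of M, the radial part of an arbitrary variation is a function
    of time that vanishes at the end points, so that the previous lemma applies to
    it; the time integrals are taken first. *)
Lemma scaling_variation_critical e b : 0 < e ->
  proper_variation (@Omega1_plus R m n M) p q gamma e b ->
  is_derive (0 : R) (1 : R) (fun s => energy P p q (b s)) (0 : R).
Proof.
move=> e0 [b_smooth b_plus b_0 b_ends].
have b_0' t c x : t \in `[p, q] -> b 0 t c x = r t *: a0 c x.
  by move=> It; rewrite b_0 // gammaE.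
have [C CP] := energy_expansion P M_compact a0_plus pq r_smooth r_gt0 e0 b_smooth b_plus b_0'.
set A0 := action_integral p q _ in CP.
apply: (@is_derive_quadratic R (fun=> 2^-1 * A0) _ C).
apply: filterS2 (near_itvoo (zero_in_itv e0)) CP => s se.
suff -> : action_integral p q (fun i t y =>
    volume a0 (chart_of i) y * radial_variation a0 r b (chart_of i) ((s, t), y)) = 0.
  by rewrite addr0.
have lr i := radial_variation_regular a0_plus r_smooth r_gt0 b_smooth (chart_of i).
have lt : tame_family (P := P) p q (fun i t y => radial_variation a0 r b (chart_of i) ((s, t), y)).
  by move=> i; exact: (regular_tame se (lr i)).
have vlt : tame_family (P := P) p q (fun i t y =>
    volume a0 (chart_of i) y * radial_variation a0 r b (chart_of i) ((s, t), y)).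
  move=> i; apply: (regular_tame (f := fun z => volume a0 (chart_of i) z.2 *
    radial_variation a0 r b (chart_of i) z) se).
  by apply: regularM => //; exact: volume_regular.
have [V0|V0] := eqVneq total_volume 0.
  have [C' C'0 lC] := tame_family_bound M_compact lt.
  have Vt : tame_family (P := P) p q (fun i _ y => volume a0 (chart_of i) y) := volume_tame.
  rewrite /action_integral.
  have E t : t \in `]p, q[ -> space_integral (fun i y =>
      volume a0 (chart_of i) y * radial_variation a0 r b (chart_of i) ((s, t), y)) = 0.
    move=> It; apply/eqP; rewrite -normr_le0.
    have := @space_integral_dominated _ _ _ _ M_compact _ _ _ _ C' _ vlt Vt It.
    rewrite [X in _ * X]V0 mulr0; apply => i y Ky.
    rewrite normrM ger0_norm ?sqrtr_ge0 // mulrC ler_wpM2r ?sqrtr_ge0 //.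
    exact: lC.
  have -> : \int[mu]_(t in `]p, q[) space_integral (fun i y =>
      volume a0 (chart_of i) y * radial_variation a0 r b (chart_of i) ((s, t), y)) =
      \int[mu]_(t in `]p, q[) 0.
    by apply: eq_Rintegral => t /set_mem It; exact: E.
  by rewrite /Rintegral integral0.
apply: (action_integral_swap M_compact vlt) => i y Ky.
have Dy := supp_image_sub (@pu_support _ _ _ P i) Ky.
have sphi : smooth_on [set` `[p, q]] (fun t => radial_part a0 r b (chart_of i) ((s, t), y)).
  by apply: (smooth_rel_slice _ _ _ (radial_part_smooth a0_plus r_smooth b_smooth (c := chart_of i))).
rewrite RintegralZl //; last exact: lagr_variation_integrable sphi.
have ends t : t \in `[p, q] -> b s t = gamma t ->
    radial_part a0 r b (chart_of i) ((s, t), y) = 0.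
  move=> It bE; rewrite /radial_part /radial /deviation /family_mx /= bE gammaE //.
  by rewrite subrr !mulmx0 mxtrace0.
have [bp bq] := b_ends s se.
by rewrite (lagr_variation_critical sphi) ?mulr0 // ends.
Qed.

End ScalingCritical.

Section Scalings.
Variables (R : realType) (m n : nat) (M : manifold R m) (P : partition_of_unity M).
Hypothesis M_compact : compact [set: M].
Local Notation D c := (coord c @` dom c).
Variable a0 : form_rep n M.
Hypothesis a0_plus : Omega1_plus a0.

(** An injective zero map has a trivial source, so that M has dimension 0 or is
    empty, and every density vanishes. *)
Lemma energy_degenerate p q (b : R -> form_rep n M) :
  (forall c x i j, dom c x -> a0 c x i j = 0) -> energy P p q b = 0.
Proof.
move=> a00; rewrite /energy.
have no_index (c : chart M) x (j : 'I_m) : dom c x -> False.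
  move=> cx; have [_ /(_ c x cx) inj] := a0_plus.
  have a0E : a0 c x = 0 by apply/matrixP => i k; rewrite a00 // mxE.
  have /matrixP /(_ j ord0) : delta_mx j ord0 = 0 :> 'cV[R]_m.
    by apply: inj; rewrite /= a0E !mul0mx.
  by rewrite !mxE !eqxx => /eqP; rewrite oner_eq0.
have E al z : ebin_metric P al z z = 0.
  rewrite -[LHS]/(space_integral (fun i y =>
    ebin_density al z z (pu_chart (p := P) i) (param (pu_chart (p := P) i) y))).
  rewrite (@space_integral_eq _ _ _ _ _ (fun _ _ => 0)) => [|i y /chart_cover [cx _]].
    rewrite /space_integral big1 // => i _.
    rewrite (_ : patched _ _ _ = fun=> 0) ?integral_cV0 //.
    by apply/funext => y; rewrite /patched /patch mulr0; case: ifP.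
  rewrite /ebin_density (_ : z _ _ = 0) ?mul0mx ?mxtrace0 ?mul0r //.
  by apply/matrixP => k j; case: (no_index _ _ j cx).
under eq_Rintegral do rewrite E.
by rewrite /Rintegral integral0 mulr0.
Qed.

(** The function r of a curve gamma = r alpha0 is read off from an entry of alpha0
    which is not 0. *)
Lemma scalings_totally_geodesic : totally_geodesic P (scalings a0).
Proof.
split=> [|I gamma itvI [gs gS gcrit]]; first exact: scalings_sub.
split=> // [t It|p q pq sub e b e0 bvar]; first exact: scalings_sub a0_plus _ (gS t It).
have [[c0 [x0 [i0 [j0 [cx0 nz]]]]]|degenerate] :=
  pselect (exists c x i j, dom c x /\ a0 c x i j != 0); last first.
  have E : (fun s => energy P p q (b s)) = cst 0.
    apply/funext => s; apply: energy_degenerate => c x i j cx.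
    apply/eqP; apply: contrapT => /negP nz.
    by apply: degenerate; exists c, x, i, j.
  by rewrite E; exact: is_derive_cst.
pose r t := gamma t c0 x0 i0 j0 / a0 c0 x0 i0 j0.
have rP t : t \in `[p, q] -> 0 < r t /\ gamma t = fun c x => r t *: a0 c x.
  move=> /sub /gS [s s0 E].
  by have -> : r t = s by rewrite /r E mxE mulfK.
apply: (@scaling_variation_critical _ _ _ _ P M_compact a0 a0_plus _ p q r pq _ _ gamma _ _ e b e0 bvar).
- exact: leq_ltn_trans (leq0n _) (ltn_ord j0).
- have H : smooth_on [set` `[p, q]] (fun t : R =>
      gamma ((0, coord c0 x0) + t *: (1, 0) : R * 'cV[R]_m).1 c0
        (param c0 ((0, coord c0 x0) + t *: (1, 0) : R * 'cV[R]_m).2) i0 j0).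
    have lE (t : R) : (0, coord c0 x0) + t *: (1, 0) = (t, coord c0 x0) :> R * 'cV[R]_m.
      by congr (_, _); rewrite /= ?scaler0 ?addr0 // add0r; exact: mulr1.
    have In t : [set` `[p, q]] t -> (I `*` D c0)
        ((0, coord c0 x0) + t *: (1, 0) : R * 'cV[R]_m).
      by rewrite lE => /sub It; split => //; exists x0.
    exact: (smooth_rel_line In In (fun t => id) (gs c0 i0 j0)).
  have H2 := smooth_relM H (smooth_rel_cst _ (a0 c0 x0 i0 j0)^-1).
  apply: (smooth_rel_eq _ H2) => t _; rewrite /r; congr (gamma _ c0 _ i0 j0 / _).
    by rewrite /= add0r; exact: mulr1.
  by rewrite /= scaler0 addr0 coordK.
- by move=> t /rP [].
- by move=> t /rP [].
- by move=> e' b' e'0 b'var; exact: gcrit pq sub e' b' e'0 b'var.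
Qed.

End Scalings.

(** * The tangent bundle as a pullback *)

Section TangentIsomorphism.
Variables (R : realType) (m n : nat) (M : manifold R m).
Variable f0 : M -> grassmannian R m n.
Variable al : form_rep n M.
Hypothesis al_fiber : W_fiber f0 al.

Lemma fiber_frame (c : chart M) x (F : 'M[R]_(n, m)) : dom c x -> spans (f0 x) F ->
  injective (fun v : 'cV[R]_m => F *m v) /\ exists X, al c x = F *m X.
Proof.
move=> cx FV.
have colX j : exists v : 'cV[R]_m, F *m v = al c x *m delta_mx j ord0.
  have : [set w | w \in val (f0 x)] (al c x *m delta_mx j ord0) by exact: fiber_mem.
  by rewrite -FV => -[v _ <-]; exists v.
have /choice [v vP] := colX.
pose X : 'M[R]_m := \matrix_(i, j) v j i ord0.
have alX : al c x = F *m X.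
  apply/matrixP => i j; have /matrixP /(_ i ord0) := vP j.
  rewrite -colE [RHS]mxE => <-; rewrite mxE mxE.
  by apply: eq_bigr => k _; rewrite [in RHS]mxE.
have [[_ /(_ c x cx) /injective_cV al_inj] _] := al_fiber.
have uX : X \in unitmx.
  by apply: unitmx_cV => w Xw; apply: al_inj; rewrite alX -mulmxA Xw mulmx0.
split; last by exists X.
apply/injective_cV => w Fw.
have : invmx X *m w = 0 by apply: al_inj; rewrite alX -mulmxA mulKVmx.
by move=> /(congr1 (mulmx X)); rewrite mulKVmx // mulmx0.
Qed.

(** A form in the fiber is itself an isomorphism onto the pullback: in a frame F
    its matrix is (F^T F)^-1 F^T alpha. *)
Lemma fiber_tangent_iso : tangent_iso_pullback f0.
Proof.
have [[[_ al_comp al_smooth] al_inj] _] := al_fiber.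
exists al; split=> // [c x cx|c U F [oU FV Fs]].
  split; first exact: al_inj.
  apply/seteqP; split=> [_ [v _ <-]|w /= /(fiber_image al_fiber cx) [v ->]].
    exact: fiber_mem.
  by exists v.
pose K (x : M) : 'M[R]_m := invmx ((F x)^T *m F x) *m ((F x)^T *m al c x).
exists K; split=> [i j d|x Ux cx]; last first.
  have [Fi [X alX]] := fiber_frame cx (FV x Ux).
  by rewrite /K !mulmxA -/(ortho_proj (F x)) alX mulmxA ortho_projK.
set A := coord d @` _.
have AP y : A y -> [/\ U (param d y), dom c (param d y), dom d (param d y) &
    coord d (param d y) = y].
  by move=> [x [dx [Ux cx]] <-]; rewrite coordK.
have sF k l : smooth_on A (fun y => F (param d y) k l).
  apply: (smooth_relS _ _ (Fs k l d)).
    by move=> _ [x [dx [Ux _]] <-]; exists x.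
  by move=> _ [x [dx [Ux _]] <-]; exists x.
have sFT k l : smooth_on A (fun y => (F (param d y))^T k l).
  exact: (smooth_rel_trmx (F := fun y => F (param d y)) sF).
have sal k l : smooth_on A (fun y => al c (param d y) k l).
  have H : smooth_on A (fun y => al c (param c (coord c (param d y))) k l).
    have sub y : A y -> (coord c @` dom c) (coord c (param d y)).
      by move=> /AP [_ cy _ _]; exists (param d y).
    apply: (smooth_rel_comp_cV sub sub _ _ (al_smooth c k l)) => // i'.
    apply: (smooth_relS _ _ (@transition_smooth _ _ M d c i')).
      by move=> _ [x [dx [_ cx]] <-]; exists x.
    by move=> _ [x [dx [_ cx]] <-]; exists x.
  by apply: (smooth_rel_eq _ H) => y /AP [_ cy _ _]; rewrite coordK.
have u y : A y -> (F (param d y))^T *m F (param d y) \in unitmx.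
  move=> /AP [Uy cy _ _]; apply: gram_unit.
  by have [] := fiber_frame cy (FV _ Uy).
have sI := smooth_on_invmx (F := fun y => (F (param d y))^T *m F (param d y)) u
  (smooth_rel_mulmx sFT sF).
exact: (smooth_rel_mulmx sI (smooth_rel_mulmx sFT sal)).
Qed.

End TangentIsomorphism.

Theorem theorem4p8 (R : realType) (m n : nat) (M : manifold R m)
    (P : partition_of_unity M)
    (le_mn : (m <= n)%N)
    (M_compact : compact [set: M])
    (M_orientable : orientable M) :
  (forall alpha0 : form_rep n M, Omega1_plus alpha0 ->
     totally_geodesic P (scalings alpha0)) /\
  (forall f0 : M -> grassmannian R m n, smooth_grassmannian f0 ->
     totally_geodesic P (W_fiber f0) /\
     (W_fiber f0 !=set0 -> tangent_iso_pullback f0)).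
Proof.
split=> [alpha0 alpha0_plus|f0 _]; first exact: scalings_totally_geodesic.
split; first exact: fiber_totally_geodesic.
by move=> [al al_fiber]; exact: fiber_tangent_iso al_fiber.
Qed.
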